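(* Let $A$ be the first-order matrix differential operator on $\mathbb{R}^2$ (coordinates $(x,y)$) $$A=\begin{pmatrix}\partial_x & x\partial_y\\ -x\partial_y & \partial_x\end{pmatrix}.$$ (i) Let $u\in\mathcal{S}'(\mathbb{R}^2,\mathbb{R}^2)$ be constant polarized, $u=\lambda v$ with $\lambda\in\mathbb{S}^1$ and $v\in\mathcal{S}'(\mathbb{R}^2,\mathbb{R})$. Then $$Au\in L^2_{loc}\ \Longrightarrow\ u\in L^2_{loc},$$ and the result is sharp in the sense that we do not gain derivatives in $L^2$. Therefore $$Au\in\mathcal{C}^\infty\ \Longrightarrow\ u\in\mathcal{C}^\infty,$$ so $A\lambda$ is $\mathcal{C}^\infty$-hypoelliptic (with zero derivative gain). (ii) There exist solutions $u\in\mathcal{S}'(\mathbb{R}^2,\mathbb{R}^2)$ to $Au=0_{\mathbb{R}^2}$ that are not constant polarized and do not belong to $\mathcal{C}^\infty$, so the operator $A$ is not $\mathcal{C}^\infty$-hypoelliptic.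
   Context: $\mathcal{S}'(\mathbb{R}^2,\mathbb{R}^d)$ denotes the $\mathbb{R}^d$-valued tempered distributions on $\mathbb{R}^2$, $\mathbb{S}^1$ is the unit circle of $\mathbb{R}^2$, and $L^2_{loc}$, $\mathcal{C}^\infty$ refer to functions on $\mathbb{R}^2$ with values in $\mathbb{R}^2$. All equations are in the sense of distributions. A distribution $u\in\mathcal{S}'(\mathbb{R}^2,\mathbb{R}^2)$ is constant polarized if $u=\lambda v=(\lambda_1v,\lambda_2v)$ for a constant vector $\lambda=(\lambda_1,\lambda_2)\in\mathbb{S}^1$ and a scalar $v\in\mathcal{S}'(\mathbb{R}^2,\mathbb{R})$. For $\lambda\in\mathbb{S}^1$, $A\lambda$ denotes the operator $v\mapsto A(\lambda v)$ acting on scalar distributions. An operator $P$ is $\mathcal{C}^\infty$-hypoelliptic if $Pw\in\mathcal{C}^\infty$ implies $w\in\mathcal{C}^\infty$. *)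

(* Defs.v *)
From HB Require Import structures.
From mathcomp Require Import all_boot all_order all_algebra.
From mathcomp Require Import all_classical all_reals all_analysis.

Set Implicit Arguments.
Unset Strict Implicit.
Unset Printing Implicit Defensive.

Import Order.TTheory GRing.Theory Num.Theory.
Import numFieldNormedType.Exports.

Local Open Scope classical_set_scope.
Local Open Scope ring_scope.

Section smooth_functions.
Context {R : realType}.
Implicit Types (f g : R * R -> R) (s : seq bool) (p : R * R).

Definition dir (b : bool) : R * R := if b then (0, 1) else (1, 0).

(* A word s : seq bool encodes an iterated partial derivative: false stands
   for d/dx, true for d/dy, the head of the word being applied last. *)
Definition iterD s f : R * R -> R := foldr (fun b g => 'D_(dir b) g) f s.

Definition smooth f : Prop := forall s,
  continuous (iterD s f) /\ forall p b, derivable (iterD s f) p (dir b).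

Definition weighted (k : nat) s f p : R := (1 + `|p|) ^+ k * `|iterD s f p|.

Definition rapidly_decreasing f : Prop :=
  forall k s, exists C : R, forall p, weighted k s f p <= C.

Definition is_schwartz f : Prop := smooth f /\ rapidly_decreasing f.

Lemma iterD_cons b s f : iterD (b :: s) f = 'D_(dir b) (iterD s f).
Proof. by []. Qed.

Lemma iterD_rcons b s f : iterD (rcons s b) f = iterD s ('D_(dir b) f).
Proof. by rewrite /iterD foldr_rcons. Qed.

Lemma smooth_derive b f : smooth f -> smooth ('D_(dir b) f).
Proof. by move=> sf s; rewrite -iterD_rcons; exact: sf. Qed.

Lemma iterD_cst0 s : iterD s (cst 0) = cst 0.
Proof.
elim: s => // b s IH; rewrite iterD_cons IH.
by apply/funext => p; rewrite derive_cst.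
Qed.

Lemma iterD_comb s (a : R) f g : smooth f -> smooth g ->
  iterD s (a *: f + g : R * R -> R^o) = a *: (iterD s f : R * R -> R^o) + iterD s g.
Proof.
move=> sf sg; elim: s => // b s IH.
rewrite !iterD_cons IH; apply/funext => p.
rewrite deriveD; [|apply: derivableZ; exact: (sf s).2|exact: (sg s).2].
by rewrite deriveZ//; exact: (sf s).2.
Qed.

Lemma smooth_comb (a : R) f g : smooth f -> smooth g ->
  smooth (a *: (f : R * R -> R^o) + g).
Proof.
move=> sf sg s; rewrite iterD_comb//; split => [p|p b].
  by apply: cvgD; [apply: cvgZl_tmp; exact: (sf s).1|exact: (sg s).1].
by apply: derivableD; [apply: derivableZ; exact: (sf s).2|exact: (sg s).2].
Qed.

Lemma weighted_ge0 k s f p : 0 <= weighted k s f p.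
Proof. by rewrite mulr_ge0// exprn_ge0// addr_ge0. Qed.

Lemma weighted_homo k l s f p : (k <= l)%N ->
  weighted k s f p <= weighted l s f p.
Proof.
move=> kl; apply: ler_wpM2r => //.
by apply: ler_weXn2l => //; rewrite lerDl.
Qed.

Lemma weighted_comb k s (a : R) f g p : smooth f -> smooth g ->
  weighted k s (a *: (f : R * R -> R^o) + g) p
    <= `|a| * weighted k s f p + weighted k s g p.
Proof.
move=> sf sg; rewrite /weighted iterD_comb//.
rewrite mulrCA -mulrDr; apply: ler_wpM2l; first by rewrite exprn_ge0// addr_ge0.
by rewrite -normrM; exact: ler_normD.
Qed.

Lemma is_schwartz0 : is_schwartz (cst 0).
Proof.
split=> [s|k s]; first by rewrite iterD_cst0; split => [p|p b]; [exact: cvg_cst|].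
by exists 0 => p; rewrite /weighted iterD_cst0 normr0 mulr0.
Qed.

Lemma is_schwartz_comb (a : R) f g : is_schwartz f -> is_schwartz g ->
  is_schwartz (a *: (f : R * R -> R^o) + g).
Proof.
move=> [sf df] [sg dg]; split; first exact: smooth_comb.
move=> k s; have [C hC] := df k s; have [D hD] := dg k s.
exists (`|a| * C + D) => p; apply: le_trans (weighted_comb _ _ _ _ sf sg) _.
by rewrite lerD// ler_wpM2l.
Qed.

Lemma is_schwartz_derive b f : is_schwartz f -> is_schwartz ('D_(dir b) f).
Proof.
move=> [sf df]; split; first exact: smooth_derive.
move=> k s; have [C hC] := df k (rcons s b).
by exists C => p; rewrite /weighted -iterD_rcons; exact: hC.
Qed.

Definition xmul f : R * R -> R := fun p => p.1 * f p.

Lemma is_derive_fst p v : is_derive p v (fst : R * R -> R) v.1.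
Proof.
pose F : {linear (R * R)%type -> R^o} := fst.
have cF : continuous F by move=> q; exact: cvg_fst.
have dF q : differentiable F q by exact: linear_differentiable.
split; first exact: (diff_derivable (dF p)).
by rewrite -[LHS]/('D_v F p) deriveE// diff_lin.
Qed.

(* The words obtained from s by erasing one occurrence of d/dx, in the
   Leibniz formula for an iterated derivative of x f(x, y). *)
Fixpoint erase_dx s : seq (seq bool) :=
  if s is b :: s' then
    (if b then [::] else [:: s']) ++ map (cons b) (erase_dx s')
  else [::].

Definition sum_iterD (l : seq (seq bool)) f p : R := \sum_(t <- l) iterD t f p.

Lemma continuous_sum_iterD l f : smooth f -> continuous (sum_iterD l f).
Proof.
move=> sf; elim: l => [|t l IH].
  have -> : sum_iterD [::] f = cst 0 by apply/funext => p; rewrite /sum_iterD big_nil.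
  by move=> p; exact: cvg_cst.
have -> : sum_iterD (t :: l) f = iterD t f \+ sum_iterD l f.
  by apply/funext => p; rewrite /sum_iterD big_cons.
by move=> p; apply: cvgD; [exact: (sf t).1|exact: IH].
Qed.

Lemma is_derive_sum_iterD l f p b : smooth f ->
  is_derive p (dir b) (sum_iterD l f) (sum_iterD (map (cons b) l) f p).
Proof.
move=> sf; elim: l => [|t l IH].
  have -> : sum_iterD [::] f = cst 0 by apply/funext => q; rewrite /sum_iterD big_nil.
  exact: is_derive_cst.
have -> : sum_iterD (t :: l) f = iterD t f + sum_iterD l f.
  by apply/funext => q; rewrite /sum_iterD big_cons.
rewrite /sum_iterD/= big_cons; apply: is_deriveD.
by apply: derivableP; exact: (sf t).2.
Qed.

Lemma is_derive_xmul f p b : smooth f ->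
  is_derive p (dir b) (xmul f) ((if b then 0 else f p) + xmul ('D_(dir b) f) p).
Proof.
move=> sf.
have df : is_derive p (dir b) f ('D_(dir b) f p).
  by apply: derivableP; exact: (sf [::]).2.
have := is_deriveM (is_derive_fst p (dir b)) df.
rewrite [X in is_derive _ _ X _](_ : _ = xmul f)//; move/is_derive_eq; apply.
by rewrite addrC; case: (b); rewrite /= ?scaler0// /xmul -/(p.1 *: _) -[_ *: 1]/(_ * 1) mulr1.
Qed.

Lemma smooth_iterD s f : smooth f -> smooth (iterD s f).
Proof. by move=> sf; elim: s => // b s; exact: smooth_derive. Qed.

Lemma iterD_xmul s f : smooth f ->
  iterD s (xmul f) = xmul (iterD s f) + sum_iterD (erase_dx s) f.
Proof.
move=> sf; elim: s => [|b s IH].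
  by apply/funext => p; rewrite fctE /sum_iterD big_nil addr0.
rewrite iterD_cons IH; apply/funext => p.
have := is_deriveD (is_derive_xmul p b (smooth_iterD s sf))
                   (is_derive_sum_iterD (erase_dx s) p b sf).
move=> /@derive_val ->; rewrite fctE /sum_iterD /=.
by case: b => /=; rewrite ?big_cons ?add0r// addrCA addrA.
Qed.

Lemma smooth_xmul f : smooth f -> smooth (xmul f).
Proof.
move=> sf s; rewrite iterD_xmul//; split => [p|p b].
  apply: cvgD; last exact: continuous_sum_iterD.
  by apply: cvgM; [exact: cvg_fst|exact: (sf s).1].
have := is_deriveD (is_derive_xmul p b (smooth_iterD s sf))
                   (is_derive_sum_iterD (erase_dx s) p b sf).
by move=> /@ex_derive.
Qed.

Lemma size_erase_dx s : (size (erase_dx s) <= size s)%N.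
Proof.
elim: s => // b s IH /=; rewrite size_cat size_map.
by case: b => /=; [exact: leqW|rewrite add1n ltnS].
Qed.

Lemma erase_dx_size s t : t \in erase_dx s -> (size t <= size s)%N.
Proof.
elim: s t => // b s IH t /=; rewrite mem_cat => /orP[|/mapP[u /IH us ->]]//.
by case: b; rewrite // inE => /eqP ->.
Qed.

Lemma weighted_xmul k s f p (M : R) : smooth f ->
  (forall t, (size t <= size s)%N -> weighted k.+1 t f p <= M) ->
  weighted k s (xmul f) p <= (size s).+1%:R * M.
Proof.
move=> sf hM; have M0 : 0 <= M by exact: le_trans (weighted_ge0 _ _ _ _) (hM s _).
rewrite /weighted iterD_xmul//.
have w0 : 0 <= (1 + `|p|) ^+ k by rewrite exprn_ge0// addr_ge0.
apply: le_trans (ler_wpM2l w0 (ler_normD _ _)) _.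
rewrite mulrDr -natr1 addrC mulrDl mul1r; apply: lerD; last first.
  apply: le_trans (hM s _) => //; rewrite /weighted exprSr -mulrA ler_wpM2l//.
  rewrite normrM ler_wpM2r//.
  by rewrite prod_normE (@le_trans _ _ (Num.max `|p.1| `|p.2|)) ?le_max ?lexx ?lerDr.
apply: (@le_trans _ _ ((size (erase_dx s))%:R * M)); last first.
  by rewrite ler_wpM2r// ler_nat size_erase_dx.
rewrite /sum_iterD.
apply: le_trans (ler_wpM2l w0 (ler_norm_sum _ _ _)) _.
have -> : (size (erase_dx s))%:R * M = \sum_(t <- erase_dx s) M.
  by rewrite big_const_seq count_predT iter_addr_0 mulr_natl.
rewrite mulr_sumr big_seq [leRHS]big_seq; apply: ler_sum => t /erase_dx_size ts.
exact: le_trans (weighted_homo _ _ _ (leqnSn k)) (hM t ts).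
Qed.

Lemma rapidly_decreasing_derive b f :
  rapidly_decreasing f -> rapidly_decreasing ('D_(dir b) f).
Proof.
move=> df k s; have [C hC] := df k (rcons s b).
by exists C => p; rewrite /weighted -iterD_rcons; exact: hC.
Qed.

Lemma weighted_size_bound k n f : rapidly_decreasing f ->
  exists M : R, forall s p, (size s <= n)%N -> weighted k s f p <= M.
Proof.
elim: n f => [|n IH] f df; have [M0 h0] := df k [::].
  by exists M0 => s p; rewrite leqn0 size_eq0 => /eqP ->.
have [M1 h1] := IH _ (rapidly_decreasing_derive true df).
have [M2 h2] := IH _ (rapidly_decreasing_derive false df).
exists (Num.max M0 (Num.max M1 M2)) => s p; rewrite !le_max.
case/lastP: s => [|s b]; first by rewrite h0.
rewrite size_rcons ltnS /weighted iterD_rcons => sn.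
by case: b; [rewrite (h1 s p)|rewrite (h2 s p)]; rewrite // !orbT.
Qed.

Definition seminorm N f : R :=
  sup (\bigcup_(s in [set s | (size s <= N)%N]) range (weighted N s f)).

Lemma weighted_seminorm N s f p : rapidly_decreasing f -> (size s <= N)%N ->
  weighted N s f p <= seminorm N f.
Proof.
move=> df sN; apply: ub_le_sup; last by exists s => //; exists p.
have [M hM] := weighted_size_bound N N df.
by exists M => _ [t tN [q _ <-]]; exact: hM.
Qed.

Lemma seminorm_le N f (M : R) :
  (forall s p, (size s <= N)%N -> weighted N s f p <= M) -> seminorm N f <= M.
Proof.
move=> hM; apply: ge_sup; last by move=> _ [t tN [q _ <-]]; exact: hM.
by exists (weighted N [::] f 0); exists [::] => //; exists 0.
Qed.

Lemma seminorm_ge0 N f : rapidly_decreasing f -> 0 <= seminorm N f.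
Proof.
by move=> df; apply: le_trans (weighted_ge0 N [::] f 0) _; exact: weighted_seminorm.
Qed.

Lemma seminorm_homo M N f : rapidly_decreasing f -> (M <= N)%N ->
  seminorm M f <= seminorm N f.
Proof.
move=> df MN; apply: seminorm_le => s p sM.
apply: le_trans (weighted_homo _ _ _ MN) _.
by apply: weighted_seminorm => //; exact: leq_trans MN.
Qed.

Lemma seminorm_derive N b f : rapidly_decreasing f ->
  seminorm N ('D_(dir b) f) <= seminorm N.+1 f.
Proof.
move=> df; apply: seminorm_le => s p sN.
rewrite /weighted -iterD_rcons; apply: le_trans (weighted_homo _ _ _ (leqnSn N)) _.
by apply: weighted_seminorm => //; rewrite size_rcons.
Qed.

Lemma seminorm_xmul N f : is_schwartz f ->
  seminorm N (xmul f) <= N.+1%:R * seminorm N.+1 f.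
Proof.
move=> [sf df]; apply: seminorm_le => s p sN.
apply: (@le_trans _ _ ((size s).+1%:R * seminorm N.+1 f)).
  apply: weighted_xmul => // t ts; apply: weighted_seminorm => //.
  by rewrite (leq_trans ts)// leqW.
by rewrite ler_wpM2r ?seminorm_ge0// ler_nat ltnS.
Qed.

Lemma is_schwartz_xmul f : is_schwartz f -> is_schwartz (xmul f).
Proof.
move=> [sf df]; split; first exact: smooth_xmul.
move=> k s.
have [M hM] := weighted_size_bound k.+1 (size s) df.
by exists ((size s).+1%:R * M) => p; apply: weighted_xmul => // t /hM; apply.
Qed.

End smooth_functions.

Section test_functions.
Context (R : realType).

Definition schwartz_pred : {pred R * R -> R^o} := fun f => `[< is_schwartz f >].

Lemma schwartz_predP (f : R * R -> R^o) : reflect (is_schwartz f) (f \in schwartz_pred).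
Proof. exact: asboolP. Qed.

Lemma schwartz_submod_closed : submod_closed schwartz_pred.
Proof.
split; first by apply/schwartz_predP; exact: is_schwartz0.
move=> a f g /schwartz_predP hf /schwartz_predP hg; apply/schwartz_predP.
exact: is_schwartz_comb.
Qed.

HB.instance Definition _ := GRing.isSubmodClosed.Build R (R * R -> R^o)
  schwartz_pred schwartz_submod_closed.

Record schwartz := Schwartz {
  schwartz_fun :> R * R -> R^o;
  _ : schwartz_fun \in schwartz_pred }.

HB.instance Definition _ := [isSub for schwartz_fun].
HB.instance Definition _ := [Choice of schwartz by <:].
HB.instance Definition _ := [SubChoice_isSubLmodule of schwartz by <:].

Lemma schwartzP (f : schwartz) : is_schwartz f.
Proof. by apply/schwartz_predP; exact: valP. Qed.

Definition to_schwartz (f : R * R -> R^o) (hf : is_schwartz f) : schwartz :=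
  Schwartz (introT (schwartz_predP f) hf).

Definition sderive (b : bool) (f : schwartz) : schwartz :=
  to_schwartz (is_schwartz_derive b (schwartzP f)).

Definition sxmul (f : schwartz) : schwartz :=
  to_schwartz (is_schwartz_xmul (schwartzP f)).

Lemma sderive_linear b : linear (sderive b).
Proof.
move=> a f g; apply: val_inj.
exact: (iterD_comb [:: b] a (schwartzP f).1 (schwartzP g).1).
Qed.

Lemma sxmul_linear : linear sxmul.
Proof.
move=> a f g; apply/val_inj/funext => p; rewrite /= /xmul /=.
by rewrite mulrDr; congr (_ + _); exact: mulrCA.
Qed.

(* A linear form on the Schwartz space is continuous iff it is bounded by a
   multiple of one of the (increasing) seminorms. *)
Definition tempered_pred : {pred schwartz -> R^o} := fun T =>
  `[< linear T /\ exists N, exists C : R, forall f, `|T f| <= C * seminorm N f >].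

End test_functions.

Section tempered_distributions.
Context (R : realType).
Notation schwartz := (schwartz R).

Lemma tempered_predP (T : schwartz -> R^o) : reflect
  (linear T /\ exists N, exists C : R, forall f, `|T f| <= C * seminorm N f)
  (T \in @tempered_pred R).
Proof. exact: asboolP. Qed.

Lemma tempered_submod_closed : submod_closed (@tempered_pred R).
Proof.
split.
  apply/tempered_predP; split; first by move=> a f g; rewrite scaler0 addr0.
  by exists 0%N, 0 => f; rewrite normr0 mul0r.
move=> a S T /tempered_predP[lS [M [C hC]]] /tempered_predP[lT [N [D hD]]].
apply/tempered_predP; split.
  move=> c f g; rewrite !fctE lS lT !scalerDr !scalerA (mulrC a c).
  by rewrite addrACA.
exists (maxn M N), (`|a| * `|C| + `|D|) => f; rewrite fctE.
have df := (schwartzP f).2.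
apply: le_trans (ler_normD _ _) _; rewrite mulrDl; apply: lerD.
  rewrite normrM -mulrA ler_wpM2l//; apply: le_trans (hC f) _.
  apply: le_trans (ler_wpM2r (seminorm_ge0 M df) (ler_norm C)) _.
  by rewrite ler_wpM2l//; exact: seminorm_homo df (leq_maxl M N).
apply: le_trans (hD f) _.
apply: le_trans (ler_wpM2r (seminorm_ge0 N df) (ler_norm D)) _.
by rewrite ler_wpM2l//; exact: seminorm_homo df (leq_maxr M N).
Qed.

HB.instance Definition _ := GRing.isSubmodClosed.Build R (schwartz -> R^o)
  (@tempered_pred R) tempered_submod_closed.

Record tempered := Tempered {
  tempered_fun :> schwartz -> R^o;
  _ : tempered_fun \in @tempered_pred R }.

HB.instance Definition _ := [isSub for tempered_fun].
HB.instance Definition _ := [Choice of tempered by <:].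
HB.instance Definition _ := [SubChoice_isSubLmodule of tempered by <:].

Lemma temperedP (T : tempered) :
  linear T /\ exists N, exists C : R, forall f, `|T f| <= C * seminorm N f.
Proof. by apply/tempered_predP; exact: valP. Qed.

Lemma tderive_subproof b (T : tempered) :
  (fun f : schwartz => - T (sderive b f) : R^o) \in @tempered_pred R.
Proof.
have [lT [N [C hC]]] := temperedP T; apply/tempered_predP; split.
  by move=> a f g; rewrite sderive_linear lT opprD scalerN.
exists N.+1, `|C| => f; rewrite normrN; apply: le_trans (hC _) _.
apply: le_trans (ler_wpM2r _ (ler_norm C)) _.
  exact: seminorm_ge0 (schwartzP _).2.
by rewrite ler_wpM2l//; exact: seminorm_derive (schwartzP f).2.
Qed.

Definition tderive b (T : tempered) : tempered := Tempered (tderive_subproof b T).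

Lemma txmul_subproof (T : tempered) :
  (fun f : schwartz => T (sxmul f)) \in @tempered_pred R.
Proof.
have [lT [N [C hC]]] := temperedP T; apply/tempered_predP; split.
  by move=> a f g; rewrite sxmul_linear lT.
exists N.+1, (`|C| * N.+1%:R) => f; apply: le_trans (hC _) _.
apply: le_trans (ler_wpM2r _ (ler_norm C)) _.
  exact: seminorm_ge0 (schwartzP _).2.
by rewrite -mulrA ler_wpM2l//; exact: seminorm_xmul (schwartzP f).
Qed.

Definition txmul (T : tempered) : tempered := Tempered (txmul_subproof T).

Local Notation mu2 := (@lebesgue_measure R \x @lebesgue_measure R)%E.

(* Only compactly supported test functions are used: for f merely locally
   integrable the integral against a Schwartz function need not converge. *)
Definition represents (f : R * R -> R) (T : tempered) : Prop :=
  forall phi : schwartz, compact (closure [set p | phi p != 0]) ->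
    T phi = \int[mu2]_p (f p * phi p).

Definition L2loc_fun (f : R * R -> R) : Prop :=
  measurable_fun [set: measurableTypeR R * measurableTypeR R] f /\
  forall K : set (R * R), compact K ->
    (\int[mu2]_(p in K) ((`|f p| ^+ 2)%:E) < +oo)%E.

Definition L2loc d (u : 'cV[tempered]_d) : Prop :=
  forall i, exists2 f, L2loc_fun f & represents f (u i 0).

Definition Cinfty d (u : 'cV[tempered]_d) : Prop :=
  forall i, exists2 f, smooth f & represents f (u i 0).

Definition H1loc d (u : 'cV[tempered]_d) : Prop :=
  L2loc u /\ forall b, L2loc (map_mx (tderive b) u).

Definition dx := tderive false.
Definition dy := tderive true.

(* The matrix operator  ( d/dx    x d/dy )
                        ( -x d/dy   d/dx ). *)
Definition opA (u : 'cV[tempered]_2) : 'cV[tempered]_2 :=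
  \col_i if i == 0 then dx (u 0 0) + txmul (dy (u 1 0))
         else - txmul (dy (u 0 0)) + dx (u 1 0).

Definition unit_circle : set 'cV[R]_2 := [set l | \sum_i l i 0 ^+ 2 = 1].

Definition polarized (l : 'cV[R]_2) (v : tempered) : 'cV[tempered]_2 :=
  \col_i (l i 0 *: v).

Definition constant_polarized (u : 'cV[tempered]_2) : Prop :=
  exists2 l, unit_circle l & exists v, u = polarized l v.

(* Scalar distributions are the columns with one entry. *)
Definition opAl (l : 'cV[R]_2) (w : 'cV[tempered]_1) : 'cV[tempered]_2 :=
  opA (polarized l (w 0 0)).

Definition hypoelliptic m n (P : 'cV[tempered]_m -> 'cV[tempered]_n) : Prop :=
  forall w, Cinfty (P w) -> Cinfty w.

End tempered_distributions.

(* Main.v *)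
Require Import Defs.
From mathcomp Require Import all_boot all_order all_algebra.
From mathcomp Require Import all_classical all_reals all_analysis.
From mathcomp Require Import measurable_realfun ring lra.
Import Defs.

(** Part (i).  For u = l v with l on the unit circle, the two components of
A u are l0 (dv/dx) + l1 (x dv/dy) and l1 (dv/dx) - l0 (x dv/dy): an orthogonal
image of the pair f = dv/dx, g = x dv/dy ([polarized_dx], [polarized_xdy]).  So A u is
locally L2, or smooth, exactly when f and g are, and v has to be recovered from
f and g without losing anything.  Away from x = 0 this is an elliptic problem;
across x = 0 only f is available.  Hence y-derivatives are used on the strip
1 < x < 2 only, and the information is carried elsewhere along horizontal lines.

Concretely, fix rho supported in [1, 2] such that chi = x rho has integral 1.
Every test function phi is
     phi = d/dx P + d/dy (x rho(x) N(y)) + (int phi) chi(x) chi(y)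
([test_decomposition]).  Here P is the primitive in x of phi - chi(x) m(y), where
m(y) is the integral of phi(., y); P has compact support because chi has
integral 1.  The remainder chi(x) m(y) is treated in the same way in y, and its
weight chi = x rho supplies the factor x in front of d/dy.  Applying v gives
     v(phi) = - f(P) - g(rho N) + C int phi,
and transposing the operators phi -> P and phi -> rho N expresses v as a sum of
integral operators applied to f and g, plus a constant
([represents_reconstruct]).  These operators integrate in one variable against a
bounded kernel whose support is bounded in the integration variable, locally in
the other one; by the Cauchy-Schwarz inequality they preserve local square
integrability ([L2loc_kerop]), and since their kernels are jumps 1_{x <= s}
corrected by functions of x alone, they preserve smoothness
([smooth_kerop_step], [smooth_kerop_col]).

Sharpness.  Let zeta = x^2 - i y and v = x^2 Im(1/zeta) = x^2 y / (x^4 + y^2).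
This is bounded, and dv/dx and x dv/dy are O(|x| / |zeta|), whose square is a
Poisson kernel in y of width x^2: they are locally L2.  But dv/dy is
homogeneous of degree -2 for the dilations (e x, e^2 y), which multiply areas by
e^3, and is not locally L2; this is seen by testing on boxes of size e by e^2
([saddle_not_H1loc]).

Part (ii).  For zeta = x^2/2 - i y, every holomorphic function U of zeta
satisfies dU/dx = i x dU/dy, and then (Re U, Im U) is annihilated by A.  The
half-plane Re zeta >= 0 contains the range of zeta, so U = exp(-1/zeta) is
bounded by 1.  It is singular at the origin: |U| = 1 on the y axis whereas U
tends to 0 along the x axis ([not_Cinfty_sol]).  By part (i) it cannot be
constant polarized.  That the classical derivatives off the axes are the
distributional ones is checked by integrating by parts on almost every line
([Rint_by_parts1], [Rint_by_parts2]). *)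

Set Implicit Arguments.
Unset Strict Implicit.
Unset Printing Implicit Defensive.

Import Order.TTheory GRing.Theory Num.Theory.
Import numFieldNormedType.Exports.

Local Open Scope classical_set_scope.
Local Open Scope ring_scope.

(** * Smoothness from one-variable slices *)

Section smooth_calculus.
Context {R : realType}.
Implicit Types (f g h : R * R -> R) (p q : R * R) (b : bool).

Definition coord b p : R := if b then p.2 else p.1.

Definition move b p (t : R) : R * R := if b then (p.1, t) else (t, p.2).

Lemma move_coord b p : move b p (coord b p) = p.
Proof. by case: b p => -[]. Qed.

(** Reduces partial derivatives to derivatives of functions of one real
variable, for which the chain rule and the fundamental theorem are stated. *)
Lemma is_derive_move b h p (d : R) :
  is_derive p (dir b) h d <-> is_derive (coord b p) 1 (fun t => h (move b p t)) d.
Proof.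
have E : (fun t : R => t^-1 *: ((h \o shift p) (t *: dir b) - h p)) =
   (fun t : R => t^-1 *: (((fun t => h (move b p t)) \o shift (coord b p)) (t *: 1)
       - h (move b p (coord b p)))).
  apply/funext => t; rewrite move_coord; congr (_ *: (h _ - _)).
  case: b p => -[x y]; rewrite /move /coord /dir /=; congr pair;
    rewrite /= ?scaler0 ?add0r //.
split=> -[dh <-]; split; rewrite /derivable /derive ?E//.
by rewrite -E.
Qed.

Definition locally_bounded h := forall r : R, exists M : R,
  forall p, `|p| <= r -> `|h p| <= M.

Lemma norm_pairE p : `|p| = Num.max `|p.1| `|p.2|.
Proof. exact: prod_normE. Qed.

Lemma norm_pair_le p (r : R) : (`|p| <= r) = (`|p.1| <= r) && (`|p.2| <= r).
Proof. by rewrite norm_pairE ge_max. Qed.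

Lemma MVT_bound (f : R -> R) (df : R -> R) (M x y c r : R) :
  (forall t : R, is_derive t 1 f (df t)) ->
  (forall t, `|t - c| <= r -> `|df t| <= M) ->
  `|x - c| <= r -> `|y - c| <= r ->
  `|f x - f y| <= M * `|x - y|.
Proof.
move=> fd fM.
wlog xy : x y / x <= y => [hw|xr yr].
  move=> xr yr; case: (leP x y) => [xy|/ltW yx]; first exact: hw.
  by rewrite distrC (distrC x); exact: hw.
have [|z zxy E] := @MVT_segment R f df x y xy (fun t _ => fd t).
  apply/continuous_subspaceT => t.
  by apply/differentiable_continuous/derivable1_diffP; have [] := fd t.
rewrite distrC E normrM (distrC x); apply: ler_wpM2r => //; apply: fM.
move: zxy; rewrite in_itv/= => /andP[xz zy].
move: xr yr; rewrite !ler_norml => /andP[? ?] /andP[? ?].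
by apply/andP; split; lra.
Qed.

(** The increment of h is the sum of an increment in each variable, and each of
them is controlled by the mean value theorem; so h is locally Lipschitz. *)
Lemma continuous_bounded_partials h :
  (forall p b, derivable h p (dir b)) ->
  (forall b, locally_bounded ('D_(dir b) h)) -> continuous h.
Proof.
move=> dh bh p.
have [M hM] := bh false (`|p| + 1); have [N hN] := bh true (`|p| + 1).
have M0 : 0 <= M by rewrite (le_trans (normr_ge0 _) (hM p _))// lerDl.
have N0 : 0 <= N by rewrite (le_trans (normr_ge0 _) (hN p _))// lerDl.
have hd b q : is_derive (coord b q) 1 (fun t => h (move b q t)) ('D_(dir b) h q).
  by apply/is_derive_move/derivableP/dh.
have bnd (x y : R) : `|x - p.1| <= 1 -> `|y - p.2| <= 1 -> `|(x, y)| <= `|p| + 1.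
  move=> xp yp; rewrite norm_pair_le /=; apply/andP; split.
    rewrite -(subrK p.1 x) addrC (le_trans (ler_normD _ _))// lerD//.
    by rewrite norm_pairE le_max lexx.
  rewrite -(subrK p.2 y) addrC (le_trans (ler_normD _ _))// lerD//.
  by rewrite norm_pairE le_max lexx orbT.
have lip q : `|q - p| <= 1 -> `|h q - h p| <= (`|M| + `|N|) * `|q - p|.
  rewrite norm_pair_le/= => /andP[q1 q2].
  rewrite (_ : h q - h p = (h (q.1, q.2) - h (p.1, q.2)) + (h (p.1, q.2) - h (p.1, p.2))).
    rewrite (le_trans (ler_normD _ _))// mulrDl lerD//.
      apply: (@le_trans _ _ (M * `|q.1 - p.1|)).
        apply: (@MVT_bound (fun t => h (t, q.2)) (fun t => 'D_(dir false) h (t, q.2))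
          M q.1 p.1 p.1 1) => //.
        - by move=> t; exact: (hd false (t, q.2)).
        - by move=> t tp; apply: hM; exact: bnd.
        - by rewrite subrr normr0.
      by apply: ler_pM => //; [rewrite ler_norm|rewrite norm_pairE le_max lexx].
    apply: (@le_trans _ _ (N * `|q.2 - p.2|)).
      apply: (@MVT_bound (fun t => h (p.1, t)) (fun t => 'D_(dir true) h (p.1, t))
          N q.2 p.2 p.2 1) => //.
        - by move=> t; exact: (hd true (p.1, t)).
        - by move=> t tp; apply: hN; apply: bnd => //; rewrite subrr normr0.
        - by rewrite subrr normr0.
    by apply: ler_pM => //; [rewrite ler_norm|rewrite norm_pairE le_max lexx orbT].
  by rewrite -!surjective_pairing addrA subrK.
apply/cvgrPdist_le => e e0.
have K0 : 0 < `|M| + `|N| + 1 by rewrite ltr_wpDl.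
near=> q.
have qp : `|q - p| <= Num.min 1 (e / (`|M| + `|N| + 1)).
  rewrite distrC; near: q; apply: (@cvgr_dist_le _ _ _ _ _ id p); first exact: cvg_id.
  by rewrite lt_min ltr01 divr_gt0.
move: qp; rewrite le_min => /andP[q1 qe].
rewrite distrC (le_trans (lip _ q1))//.
apply: (@le_trans _ _ ((`|M| + `|N| + 1) * `|q - p|)).
  by rewrite ler_wpM2r// lerDl.
by rewrite mulrC -ler_pdivlMr.
Unshelve. all: by end_near. Qed.

Inductive span (P : (R * R -> R) -> Prop) : (R * R -> R) -> Prop :=
| span_base f : P f -> span P f
| span_comb (a : R) f g : span P f -> span P g -> span P (fun p => a * f p + g p).

Lemma derive_comb_span b (a : R) f g p : derivable f p (dir b) -> derivable g p (dir b) ->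
  is_derive p (dir b) (fun q => a * f q + g q)
     (a * 'D_(dir b) f p + 'D_(dir b) g p).
Proof.
move=> df dg.
apply: (@is_deriveD _ _ _ (fun q => a * f q : R^o) g); last exact: derivableP.
by apply: (@is_deriveZ _ _ _ f a); exact: derivableP.
Qed.

(** The way smoothness of a concrete family of functions is established: when P
is stable under both partial derivatives up to linear combinations, every
iterated derivative stays in the span of P, and continuity comes for free from
the local boundedness of the next derivatives. *)
Lemma smooth_span (P : (R * R -> R) -> Prop) :
  (forall f, P f -> locally_bounded f /\ forall b,
     (forall p, derivable f p (dir b)) /\ span P ('D_(dir b) f)) ->
  forall f, span P f -> smooth f.
Proof.
move=> HP.
have der f : span P f -> forall p b, derivable f p (dir b).
  elim=> [g /HP[_ +] p b|a g h _ dg _ dh p b]; first by case/(_ b).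
  by have [] := derive_comb_span a (dg p b) (dh p b).
have sp f : span P f -> forall b, span P ('D_(dir b) f).
  elim=> [g /HP[_ +] b|a g h Pg dg Ph dh b]; first by case/(_ b).
  rewrite (_ : 'D_(dir b) _ = fun p => a * 'D_(dir b) g p + 'D_(dir b) h p).
    exact: span_comb.
  apply/funext => p.
  by have [_ ->] := derive_comb_span a (der _ Pg p b) (der _ Ph p b).
have lb f : span P f -> locally_bounded f.
  elim=> [g /HP[]//|a g h _ bg _ bh r].
  have [M hM] := bg r; have [N hN] := bh r; exists (`|a| * M + N) => p pr.
  rewrite (le_trans (ler_normD _ _))// lerD ?hN// normrM ler_wpM2l// hM//.
move=> f Pf s.
suff : span P (iterD s f).
  by move=> Ps; split; [apply: continuous_bounded_partials => [p b|b];
    [exact: der|exact/lb/sp]|exact: der].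
by elim: s => // b s IH; rewrite iterD_cons; exact: sp.
Qed.

Lemma compact_ball0 (r : R) : compact [set p : R * R | `|p| <= r].
Proof.
have -> : [set p : R * R | `|p| <= r] = (`[- r, r] `*` `[- r, r])%classic.
  apply/seteqP; split=> -[x y] /=; rewrite norm_pair_le/= !in_itv/= !ler_norml.
    by move=> /andP[].
  by move=> [-> ->].
by apply: compact_setX; exact: segment_compact.
Qed.

Lemma continuous_locally_bounded h : continuous h -> locally_bounded h.
Proof.
move=> ch r.
have /compact_bounded[M [_ hM]] : compact (h @` [set p : R * R | `|p| <= r]).
  apply: continuous_compact; last exact: compact_ball0.
  exact: continuous_subspaceT.
exists (M + 1) => p pr; apply: (hM (M + 1)); first by rewrite ltrDl.
by exists p.
Qed.

Lemma smooth_continuous h : smooth h -> continuous h.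
Proof. by move=> /(_ [::])[]. Qed.

Lemma smooth_derivable h : smooth h -> forall p b, derivable h p (dir b).
Proof. by move=> /(_ [::])[]. Qed.

Lemma smooth_bounded h : smooth h -> locally_bounded h.
Proof. by move=> /smooth_continuous; exact: continuous_locally_bounded. Qed.

End smooth_calculus.
Arguments smooth_derivable {R h} _ p b.

Section directional_derivatives.
Context {R : realType}.
Implicit Types (f g : R * R -> R) (p : R * R) (b : bool) (d e : R).

Lemma is_derive_coord b c p :
  is_derive p (dir b) (coord c) (b == c)%:R.
Proof.
apply/is_derive_move; have [->|bc] := eqVneq b c.
  rewrite (_ : (fun _ => _) = id); last by apply/funext => t; case: (c) p => -[].
  exact: is_derive_id.
rewrite (_ : (fun _ => _) = cst (coord c p)); first exact: is_derive_cst.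
by apply/funext => t; case: b c bc p => -[]// _ [].
Qed.

Lemma is_derive_mul f g p b d e : is_derive p (dir b) f d -> is_derive p (dir b) g e ->
  is_derive p (dir b) (fun q => f q * g q) (d * g p + f p * e).
Proof.
move=> df dg; have := is_deriveM df dg.
rewrite [X in is_derive _ _ X _](_ : _ = fun q => f q * g q)//; move/is_derive_eq; apply.
by rewrite addrC; congr (_ + _); exact: mulrC.
Qed.

Lemma is_derive_add f g p b d e : is_derive p (dir b) f d -> is_derive p (dir b) g e ->
  is_derive p (dir b) (fun q => f q + g q) (d + e).
Proof. exact: is_deriveD. Qed.

Lemma is_derive_comp1 (F : R -> R) f p b d e : is_derive (f p) 1 F d ->
  is_derive p (dir b) f e -> is_derive p (dir b) (fun q => F (f q)) (d * e).
Proof.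
move=> dF /is_derive_move df; apply/is_derive_move.
by apply: (is_derive1_comp _ df); rewrite move_coord.
Qed.

Lemma is_derive_inv (y : R) : y != 0 -> is_derive y 1 (fun t : R => t^-1) (- y ^- 2).
Proof.
move=> y0; have := @is_deriveV _ id y 1 1 y0 (is_derive_id _ _).
by move/is_derive_eq; apply; rewrite [LHS]mulr1.
Qed.

Lemma is_derive_neg f p b d : is_derive p (dir b) f d -> is_derive p (dir b) (fun q => - f q) (- d).
Proof. exact: is_deriveN. Qed.

End directional_derivatives.

(** * Closure properties of smooth functions, and bump functions *)

Section smooth_algebra.
Context {R : realType}.
Implicit Types (f g h : R * R -> R) (p q : R * R) (b : bool).

Lemma smooth_class (P : (R * R -> R) -> Prop) :
  (forall f, P f -> locally_bounded f /\ forall b,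
     (forall p, derivable f p (dir b)) /\ span P ('D_(dir b) f)) ->
  forall f, P f -> smooth f.
Proof. by move=> HP f Pf; apply: smooth_span HP _ _; exact: span_base. Qed.

Lemma smoothD_scale (a : R) f g :
  smooth f -> smooth g -> smooth (fun p => a * f p + g p).
Proof. by move=> sf sg; exact: smooth_comb. Qed.

Lemma smooth_cst (c : R) : smooth (fun _ => c).
Proof.
apply: (@smooth_class (fun h => exists c : R, h = fun=> c)); last by exists c.
move=> _ [d ->]; split; first by move=> r; exists `|d|.
move=> b; split; first by move=> p; apply: ex_derive.
apply: span_base; exists 0; apply/funext => p; exact: derive_cst.
Qed.

Lemma smoothD f g : smooth f -> smooth g -> smooth (fun p => f p + g p).
Proof.
move=> sf sg; rewrite (_ : (fun _ => _) = fun p => 1 * f p + g p).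
  exact: smoothD_scale.
by apply/funext => p; rewrite mul1r.
Qed.

Lemma smoothZ (a : R) f : smooth f -> smooth (fun p => a * f p).
Proof.
move=> sf; rewrite (_ : (fun _ => _) = fun p => a * f p + 0).
  by apply: smoothD_scale; [exact: sf|exact: smooth_cst].
by apply/funext => p; rewrite addr0.
Qed.

Lemma smoothB f g : smooth f -> smooth g -> smooth (fun p => f p - g p).
Proof.
move=> sf sg; rewrite (_ : (fun _ => _) = fun p => -1 * g p + f p).
  exact: smoothD_scale.
by apply/funext => p; rewrite mulN1r addrC.
Qed.

Lemma smoothM f g : smooth f -> smooth g -> smooth (fun p => f p * g p).
Proof.
move=> sf sg.
apply: (@smooth_class (fun h => exists f g, [/\ smooth f, smooth g & h = fun p => f p * g p]));
  last by exists f, g.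
move=> _ [{sf}f [{sg}g [sf sg ->]]]; split.
  move=> r; have [M hM] := smooth_bounded sf r; have [N hN] := smooth_bounded sg r.
  by exists (M * N) => p pr; rewrite normrM ler_pM// ?hM ?hN.
have dM b p : is_derive p (dir b) (fun p => f p * g p)
    (1 * (f p * 'D_(dir b) g p) + 'D_(dir b) f p * g p).
  have df := derivableP (smooth_derivable sf p b).
  have dg := derivableP (smooth_derivable sg p b).
  by apply: is_derive_eq (is_derive_mul df dg) _; rewrite mul1r addrC.
move=> b; split; first by move=> p; have [] := dM b p.
rewrite (_ : 'D_(dir b) _ = fun p => 1 * (f p * 'D_(dir b) g p) + 'D_(dir b) f p * g p).
  apply: span_comb; apply: span_base.
    by exists f, ('D_(dir b) g); split; [exact: sf|exact: smooth_derive|].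
  by exists ('D_(dir b) f), g; split; [exact: smooth_derive|exact: sg|].
by apply/funext => p; have [] := dM b p.
Qed.

Definition swap p : R * R := (p.2, p.1).

Lemma swapK : involutive swap. Proof. by case. Qed.

Lemma norm_swap p : `|swap p| = `|p|.
Proof. by rewrite !norm_pairE maxC. Qed.

Lemma is_derive_swap b f p (d : R) :
  is_derive (swap p) (dir (~~ b)) f d -> is_derive p (dir b) (fun p => f (swap p)) d.
Proof. by move=> fd; apply/is_derive_move; move: ((is_derive_move _ _ _ _).1 fd); case: b {fd}. Qed.

Lemma derive_swap b f p : smooth f ->
  'D_(dir b) (fun p => f (swap p)) p = 'D_(dir (~~ b)) f (swap p).
Proof.
by move=> sf; have [] := is_derive_swap (derivableP (smooth_derivable sf (swap p) (~~ b))).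
Qed.

Lemma smooth_swap f : smooth f -> smooth (fun p => f (swap p)).
Proof.
move=> sf.
apply: (@smooth_class (fun h => exists2 f, smooth f & h = fun p => f (swap p)));
  last by exists f.
move=> _ [{sf}f sf ->]; split.
  move=> r; have [M hM] := smooth_bounded sf r.
  by exists M => p pr; apply: hM; rewrite norm_swap.
move=> b; split => [p|].
  by have [] := is_derive_swap (derivableP (smooth_derivable sf (swap p) (~~ b))).
apply: span_base; exists ('D_(dir (~~ b)) f); first exact: smooth_derive.
by apply/funext => p; exact: derive_swap.
Qed.

Lemma smooth_coord b : smooth (@coord R b).
Proof.
apply: (@smooth_class (fun h => (h = coord b) \/ smooth h)); last by left.
have sd h : smooth h -> locally_bounded h /\ forall b',
     (forall p, derivable h p (dir b')) /\ span (fun h => h = coord b \/ smooth h) ('D_(dir b') h).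
  move=> sh; split; first exact: smooth_bounded.
  move=> b'; split; first by move=> p; exact: smooth_derivable.
  by apply: span_base; right; exact: smooth_derive.
move=> h [->|]; last exact: sd.
split.
  move=> r; exists r => p; rewrite norm_pair_le => /andP[]; by case: (b).
have d b' p : is_derive p (dir b') (coord b) (b' == b)%:R by exact: is_derive_coord.
move=> b'; split; first by move=> p; have [] := d b' p.
apply: span_base; right.
rewrite (_ : 'D_(dir b') _ = fun=> (b' == b)%:R : R); first exact: smooth_cst.
by apply/funext => p; have [] := d b' p.
Qed.

End smooth_algebra.

Section flat_functions.
Context {R : realType}.
Implicit Types (t : R) (n : nat) (p : R * R) (b : bool).

(** Vanishes to infinite order at 0.  The powers of 1/t are included to make the
family stable under differentiation. *)
Definition flat n t : R := if 0 < t then t ^- n * expR (- t^-1) else 0.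

Lemma flat_ge0 n t : 0 <= flat n t.
Proof.
by rewrite /flat; case: ltP => // t0; rewrite mulr_ge0 ?expR_ge0// invr_ge0 exprn_ge0// ltW.
Qed.

(** The exponential series gives t^-n <= n! exp(1/t). *)
Lemma flat_le n t : flat n t <= n`!%:R.
Proof.
rewrite /flat; case: ltP => // t0.
have t0' : 0 <= t^-1 by rewrite invr_ge0 ltW.
rewrite expRN ler_pdivrMr ?expR_gt0// -exprVn.
case: n => [|n]; first by rewrite expr0 fact0 mul1r -expR0 ler_expR.
rewrite mulrC -ler_pdivrMr ?ltr0n ?fact_gt0//.
by apply: le_trans (expR_ge1Dxn n t0'); rewrite lerDr.
Qed.

Lemma flatS n t : flat n t = t * flat n.+1 t.
Proof.
rewrite /flat; case: ltP => [t0|]; last by rewrite mulr0.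
by rewrite mulrA exprS invfM mulrA divff ?mul1r// gt_eqF.
Qed.

(** At t = 0 the difference quotient is flat n.+1, which is t times a
bounded function. *)
Lemma is_derive_flat n t : is_derive t 1 (flat n) (flat n.+2 t - n%:R * flat n.+1 t).
Proof.
have [t0|t0|->] := ltgtP t 0.
- rewrite /flat ltNge (ltW t0)/= mulr0 subrr.
  apply: (@near_eq_is_derive _ _ _ (cst 0)).
  near=> x; suff : x < 0 by move=> /ltW; rewrite leNgt /= => /negbTE ->.
  by near: x; exact: lt_nbhsl.
- have tN0 : t != 0 by rewrite gt_eqF.
  apply: (@near_eq_is_derive _ _ _ (fun x : R => (x^-1) ^+ n * expR (- x^-1))).
    near=> x; suff x0 : 0 < x by rewrite /flat x0 exprVn.
    by near: x; exact: lt_nbhsr.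
  have dV := is_derive_inv tN0.
  have dX : is_derive t (1 : R) (fun x : R => (x^-1) ^+ n) (n%:R * t ^- n.-1 * (- t ^- 2)).
    have := is_deriveX n dV.
    rewrite [X in is_derive _ _ X _](_ : _ = fun x => (x^-1) ^+ n); last first.
      by apply/funext => x; rewrite exprfctE.
    by move/is_derive_eq; apply; rewrite exprVn.
  have dE : is_derive t (1 : R) (fun x : R => expR (- x^-1)) (expR (- t^-1) * t ^- 2).
    have := @is_derive1_comp R expR (fun x => - x^-1) t _ _ (is_derive_expR _) (is_deriveN dV).
    by rewrite opprK.
  have := is_deriveM dX dE.
  rewrite [X in is_derive _ _ X _](_ : _ = fun x => (x^-1) ^+ n * expR (- x^-1))//.
  move/is_derive_eq; apply; rewrite /flat t0.
  rewrite -![_ *: _]/(_ * _) -!exprVn /=.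
  case: n {dX} => [|n] /=; first by rewrite expr0 !mul0r subr0 mulr0 addr0 mul1r mulrC.
  by rewrite !exprS; ring.
- have -> : flat n.+2 0 - n%:R * flat n.+1 0 = 0 :> R by rewrite /flat ltxx mulr0 subrr.
  have lim0 : (fun h : R => h^-1 *: ((flat n \o shift 0) (h *: 1) - flat n 0)) @ 0^' --> (0 : R).
    apply/cvgrPdist_le => e e0.
    near=> h.
    have hN0 : h != 0 by near: h; exact: nbhs_dnbhs_neq.
    rewrite sub0r normrN /= addr0 -[h *: 1]/(h * 1) mulr1 {2}/flat ltxx subr0.
    rewrite flatS -[_ *: _]/(_ * _) mulKf// flatS normrM (ger0_norm (flat_ge0 _ _)).
    apply: (@le_trans _ _ (`|h| * n.+2`!%:R)); first by rewrite ler_wpM2l// flat_le.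
    rewrite -ler_pdivlMr ?ltr0n ?fact_gt0//.
    have : `|0 - h| <= e / n.+2`!%:R.
      near: h; apply: (@cvgr_dist_le _ _ _ _ _ id 0).
        by apply: cvg_trans; [apply: cvg_within|exact: cvg_id].
      by rewrite divr_gt0// ltr0n fact_gt0.
    by rewrite sub0r normrN.
  split; first by apply/cvg_ex; exists 0.
  exact: cvg_lim.
Unshelve. all: by end_near. Qed.

Lemma smooth_flat b (a c : R) n : smooth (fun p => flat n (a * coord b p + c)).
Proof.
apply: (@smooth_class _ (fun h => exists n, h = fun p => flat n (a * coord b p + c)));
  last by exists n.
move=> _ [{}n ->]; split.
  by move=> r; exists n`!%:R => p _; rewrite ger0_norm ?flat_ge0// flat_le.
pose k b' : R := (b == b')%:R * a.
have d b' p : is_derive p (dir b') (fun p => flat n (a * coord b p + c))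
    (k b' * flat n.+2 (a * coord b p + c) + ((- n%:R * k b') * flat n.+1 (a * coord b p + c)
       + (-1 * flat n (a * coord b p + c) + flat n (a * coord b p + c)))).
  apply/is_derive_move; rewrite mulN1r addNr addr0 /k.
  have [<-|bb'] := eqVneq b b'; last first.
    rewrite mul0r mulr0 !mul0r addr0 (_ : (fun _ => _) = cst (flat n (a * coord b p + c))).
      exact: is_derive_cst.
    by apply/funext => t; case: (b) (b') bb' p => -[]// _ [].
  rewrite mul1r (_ : (fun _ => _) = flat n \o (fun t => a * t + c)); last first.
    by apply/funext => t; case: (b).
  have dl : is_derive (coord b p) (1 : R) (fun t : R => a * t + c) a.
    have := is_deriveD (is_deriveZ a (is_derive_id (coord b p) (1 : R))) (is_derive_cst c (coord b p) (1:R)).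
    rewrite [X in is_derive _ _ X _](_ : _ = fun t => a * t + c)//.
    by move/is_derive_eq; apply; rewrite addr0 [LHS]mulr1.
  have := is_derive1_comp (is_derive_flat n _) dl.
  move/is_derive_eq; apply; ring.
move=> b'; split; first by move=> p; have [] := d b' p.
rewrite (_ : 'D_(dir b') _ = fun p => k b' * flat n.+2 (a * coord b p + c) + ((- n%:R * k b') * flat n.+1 (a * coord b p + c)
       + (-1 * flat n (a * coord b p + c) + flat n (a * coord b p + c)))).
  pose F m := fun p => flat m (a * coord b p + c).
  have HF m : span (fun h => exists n, h = F n) (F m) by apply: span_base; exists m.
  exact: (span_comb (k b') (HF n.+2) (span_comb (- n%:R * k b') (HF n.+1) (span_comb (-1) (HF n) (HF n)))).
by apply/funext => p; have [_ ->] := d b' p.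
Qed.

(** Positive exactly on (u, v), and bounded below on the middle half of
the interval by a constant that does not depend on u and v. *)
Definition bump (u v t : R) : R :=
  flat 0 ((t - u) / (v - u)) * flat 0 ((v - t) / (v - u)).

Lemma bump_ge0 u v t : 0 <= bump u v t.
Proof. by rewrite mulr_ge0// flat_ge0. Qed.

Lemma bump_le1 u v t : bump u v t <= 1.
Proof. by rewrite mulr_ile1 ?flat_ge0// (le_trans (flat_le _ _)). Qed.

Lemma bump_eq0 u v t : u < v -> ~~ (u < t < v) -> bump u v t = 0.
Proof.
move=> uv; rewrite negb_and -!leNgt /bump /flat => /orP[ta|bt].
  by rewrite pmulr_lgt0 ?invr_gt0 ?subr_gt0// ltNge ta/= mul0r.
by rewrite (pmulr_lgt0 (v - t)) ?invr_gt0 ?subr_gt0// (ltNge t) bt/= mulr0.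
Qed.

Lemma bump_ge u v t : u < v -> u + (v - u) / 4 <= t <= v - (v - u) / 4 ->
  expR (- 8) <= bump u v t.
Proof.
move=> uv /andP[ut tv].
have fl x : 4^-1 <= x -> expR (- 4) <= flat 0 x :> R.
  move=> x4; have x0 : 0 < x by apply: lt_le_trans x4; rewrite invr_gt0.
  rewrite /flat x0 expr0 invr1 mul1r ler_expR lerN2 -(invrK 4).
  by rewrite lef_pV2 // posrE invr_gt0.
have -> : - 8 = - 4 + - 4 :> R by ring.
by rewrite expRD ler_pM ?expR_ge0// fl// ler_pdivlMr ?subr_gt0//; lra.
Qed.

Lemma smooth_bump c (u v : R) : smooth (fun p => bump u v (coord c p)).
Proof.
apply: smoothM.
  rewrite (_ : (fun _ => _) = fun p => flat 0 ((v - u)^-1 * coord c p + (- u / (v - u)))).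
    exact: smooth_flat.
  by apply/funext => p; congr flat; ring.
rewrite (_ : (fun _ => _) = fun p => flat 0 (- (v - u)^-1 * coord c p + (v / (v - u)))).
  exact: smooth_flat.
by apply/funext => p; congr flat; ring.
Qed.

End flat_functions.

(** * Borel sets and integrals on the plane *)

Lemma countable_bigcup_measurable d (T : measurableType d) (I : countType)
    (D : set I) (F : I -> set T) :
  (forall i, D i -> measurable (F i)) -> measurable (\bigcup_(i in D) F i).
Proof.
move=> mF.
have -> : \bigcup_(i in D) F i =
    \bigcup_n (if unpickle n is Some i then if `[< D i >] then F i else set0 else set0).
  apply/seteqP; split=> [p [i iU Bip]|p [n _]].
    by exists (pickle i) => //; rewrite pickleK; case: asboolP.
  by case: (unpickle n) => [i|//]; case: asboolP => // iU Bip; exists i.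
apply: bigcupT_measurable => n; case: (unpickle n) => [i|]; last exact: measurable0.
by case: asboolP => [/mF|_]//; exact: measurable0.
Qed.

Section plane_measure.
Context {R : realType}.
Notation mR := (measurableTypeR R).
Notation mu := (@lebesgue_measure R).
Notation mu2 := (mu \x mu)%E.
Implicit Types (f g h : R * R -> R) (p q : R * R) (r : R).

(** The product sigma-algebra contains the open sets of the plane because the
squares with rational centre and radius 1/n form a countable basis. *)
Lemma open_measurable2 (U : set (R * R)) : open U -> measurable (U : set (mR * mR)).
Proof.
move=> oU.
pose B (i : rat * rat * nat) : set (R * R) :=
  (ball (ratr i.1.1 : R) (i.2.+1%:R^-1) `*` ball (ratr i.1.2 : R) (i.2.+1%:R^-1))%classic.
have -> : U = \bigcup_(i in [set i | B i `<=` U]) B i.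
  apply/seteqP; split; last by move=> p [i iU /iU].
  move=> p Up; have [e /= e0 eU] := (nbhs_ballP _ _).1 (oU p Up).
  pose n := Num.bound (2 / e).
  have ne : n.+1%:R^-1 + n.+1%:R^-1 < e.
    have : 2 / e < n.+1%:R by rewrite (lt_trans (archi_boundP _)) ?ltr_nat// divr_ge0// ltW.
    rewrite ltr_pdivrMr// => ne2.
    by rewrite (_ : _ + _ = 2 / n.+1%:R); [rewrite ltr_pdivrMr ?ltr0n// mulrC|ring].
  have near_rat (x : R) : exists q : rat, `|ratr q - x| < n.+1%:R^-1.
    have /rat_in_itvoo[q] : x - n.+1%:R^-1 < x + n.+1%:R^-1 by rewrite ltrD2l gtrN ?invr_gt0.
    rewrite inE/= => /andP[]; rewrite !bnd_simp => q1 q2; exists q.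
    rewrite ltr_norml; move: (_^-1) q1 q2 => d q1 q2.
    by apply/andP; split; lra.
  have [q1 hq1] := near_rat p.1; have [q2 hq2] := near_rat p.2.
  exists (q1, q2, n) => //=.
  move=> z [/= z1 z2]; apply: eU; split.
    apply: (le_ball (ltW ne)); apply: (ball_triangle _ z1); rewrite /ball/= distrC; exact: hq1.
  apply: (le_ball (ltW ne)); apply: (ball_triangle _ z2); rewrite /ball/= distrC; exact: hq2.
apply: countable_bigcup_measurable => i _.
by apply: measurableX; exact: measurable_ball.
Qed.

Lemma closed_measurable2 (U : set (R * R)) : closed U -> measurable (U : set (mR * mR)).
Proof.
by move=> cU; rewrite -(setCK U); apply: measurableC; apply: open_measurable2; exact: closed_openC.
Qed.

Lemma continuous_measurable2 f : continuous f -> measurable_fun [set: mR * mR] f.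
Proof.
move=> /continuousP cf; apply: (measurability _ (RGenOpens.measurableE R)).
move=> _ [_ [a [b ->] <-]]; rewrite setTI; apply: open_measurable2.
exact/cf/interval_open.
Qed.

Lemma compact_measurable2 (U : set (R * R)) : compact U -> measurable (U : set (mR * mR)).
Proof.
move=> cU; apply: closed_measurable2; apply: compact_closed cU.
exact: norm_hausdorff.
Qed.

End plane_measure.

Section integrable_functions.
Context d (T : measurableType d) (R : realType) (m : {measure set T -> \bar R}).
Implicit Types (f g : T -> R).

Definition L1 f := m.-integrable [set: T] (EFin \o f).

Lemma L1_measurable f : L1 f -> measurable_fun [set: T] f.
Proof. by move=> /integrableP[/measurable_EFinP]. Qed.

Lemma L1_dom f g : measurable_fun [set: T] f -> L1 g -> (forall x, `|f x| <= g x) -> L1 f.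
Proof.
move=> mf ig fg; apply: le_integrable ig => //; first exact/measurable_EFinP.
by move=> x _ /=; rewrite lee_fin (le_trans (fg x))// ler_norm.
Qed.

Lemma L1Z (a : R) f : L1 f -> L1 (fun x => a * f x).
Proof.
move=> fi; have := @integrableZl _ _ _ m setT measurableT a _ fi.
by apply: eq_integrable => // x _ /=; rewrite EFinM.
Qed.

Lemma L1D f g : L1 f -> L1 g -> L1 (fun x => f x + g x).
Proof.
move=> fi gi; have := @integrableD _ _ _ m setT measurableT _ _ fi gi.
by apply: eq_integrable => // x _ /=; rewrite EFinD.
Qed.

Lemma L1B f g : L1 f -> L1 g -> L1 (fun x => f x - g x).
Proof.
move=> fi gi; rewrite (_ : (fun _ => _) = fun x => f x + -1 * g x).
  by apply: L1D => //; exact: L1Z.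
by apply/funext => x; rewrite mulN1r.
Qed.

Lemma L1_norm f : L1 f -> L1 (fun x => `|f x|).
Proof.
move=> fi; have := integrable_abse fi.
by apply: eq_integrable => // x _ /=.
Qed.

Lemma L1_bounded f g (M : R) : measurable_fun [set: T] f -> (forall x, `|f x| <= M) ->
  L1 g -> L1 (fun x => f x * g x).
Proof.
move=> mf fM gi; apply: (@L1_dom _ (fun x => M * `|g x|)).
- by apply: measurable_funM => //; exact: L1_measurable.
- by apply: L1Z; exact: L1_norm.
- by move=> x; rewrite normrM ler_wpM2r.
Qed.

Lemma ae_eq_Rint f g : measurable_fun [set: T] f -> measurable_fun [set: T] g ->
  {ae m, forall x, f x = g x} -> (\int[m]_x f x = \int[m]_x g x)%R.
Proof.
move=> mf mg fg; congr fine; apply: ae_eq_integral => //; try exact/measurable_EFinP.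
by apply: filterS fg => x -> _.
Qed.

Lemma RintZ (a : R) f : L1 f -> (\int[m]_x (a * f x) = a * \int[m]_x f x)%R.
Proof. by move=> fi; rewrite RintegralZl. Qed.

Lemma RintD f g : L1 f -> L1 g -> (\int[m]_x (f x + g x) = \int[m]_x f x + \int[m]_x g x)%R.
Proof. by move=> fi gi; rewrite RintegralD. Qed.

Lemma RintB f g : L1 f -> L1 g -> (\int[m]_x (f x - g x) = \int[m]_x f x - \int[m]_x g x)%R.
Proof. by move=> fi gi; rewrite RintegralB. Qed.

Lemma le_Rint f g : L1 f -> L1 g -> (forall x, f x <= g x) ->
  (\int[m]_x f x <= \int[m]_x g x)%R.
Proof. by move=> fi gi fg; apply: le_Rintegral. Qed.

Lemma normr_Rint f : L1 f -> (`|\int[m]_x f x| <= \int[m]_x `|f x|)%R.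
Proof. by move=> fi; apply: le_normr_Rintegral. Qed.

Lemma Rint0 : (\int[m]_x (0 : R) = 0)%R.
Proof. by rewrite /Rintegral integral0. Qed.

Lemma eq_Rint f g : f =1 g -> (\int[m]_x f x = \int[m]_x g x)%R.
Proof. by move=> fg; apply: eq_Rintegral. Qed.

Lemma L1_EFin f : L1 f -> (\int[m]_x (f x)%:E = (\int[m]_x f x)%R%:E)%E.
Proof. by move=> fi; rewrite fineK//; exact: integrable_fin_num. Qed.

End integrable_functions.

Section plane_integrals.
Context {R : realType}.
Notation mR := (measurableTypeR R).
Notation mu := (@lebesgue_measure R).
Notation mu2 := (mu \x mu)%E.
Implicit Types (f g : R * R -> R) (a b : R -> R).

Lemma measurable_Rint1 d (T1 : measurableType d) (f : T1 * R -> R) :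
  measurable_fun [set: T1 * mR] f ->
  measurable_fun [set: T1] (fun x => \int[mu]_y f (x, y))%R.
Proof.
move=> mf; apply: measurableT_comp => //.
have mf' : measurable_fun [set: T1 * mR] (EFin \o f) by exact/measurable_EFinP.
rewrite (_ : (fun _ => _) = fubini_F mu ((EFin \o f)^\+)%E \- fubini_F mu ((EFin \o f)^\-)%E)%E.
  apply: emeasurable_funB.
    by apply: measurable_fun_fubini_tonelli_F; [exact: measurable_funepos|exact: funepos_ge0].
  by apply: measurable_fun_fubini_tonelli_F; [exact: measurable_funeneg|exact: funeneg_ge0].
by apply/funext => x; rewrite [LHS]integralE; congr (_ - _)%E; apply: eq_integral => y _; rewrite ?funeposE ?funenegE.
Qed.

Lemma measurable_Rint2 f : measurable_fun [set: mR * mR] f ->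
  measurable_fun [set: mR] (fun y => \int[mu]_x f (x, y))%R.
Proof.
move=> mf; apply: measurableT_comp => //.
have mf' : measurable_fun [set: mR * mR] (EFin \o f) by exact/measurable_EFinP.
rewrite (_ : (fun _ => _) = fubini_G mu ((EFin \o f)^\+)%E \- fubini_G mu ((EFin \o f)^\-)%E)%E.
  apply: emeasurable_funB.
    by apply: measurable_fun_fubini_tonelli_G; [exact: measurable_funepos|exact: funepos_ge0].
  by apply: measurable_fun_fubini_tonelli_G; [exact: measurable_funeneg|exact: funeneg_ge0].
by apply/funext => x; rewrite [LHS]integralE; congr (_ - _)%E; apply: eq_integral => y _; rewrite ?funeposE ?funenegE.
Qed.

Lemma Rfubini1 f : L1 mu2 f ->
  (\int[mu2]_p f p = \int[mu]_x \int[mu]_y f (x, y))%R.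
Proof.
move=> fi; rewrite {1}/Rintegral -(integral12_prod_meas1 fi).
rewrite {1}/Rintegral; congr fine; apply: ae_eq_integral => //.
- exact: measurable_fubini_F fi.
- by apply/measurable_EFinP; apply: measurable_Rint1; apply: L1_measurable fi.
have := ae_integrable1 fi; apply: filterS => x ix _.
by rewrite /fubini_F /Rintegral fineK//; exact: integrable_fin_num.
Qed.

Lemma Rfubini2 f : L1 mu2 f ->
  (\int[mu2]_p f p = \int[mu]_y \int[mu]_x f (x, y))%R.
Proof.
move=> fi; rewrite {1}/Rintegral -(integral21_prod_meas1 fi).
rewrite {1}/Rintegral; congr fine; apply: ae_eq_integral => //.
- exact: measurable_fubini_G fi.
- by apply/measurable_EFinP; apply: measurable_Rint2; apply: L1_measurable fi.
have := ae_integrable2 fi; apply: filterS => x ix _.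
by rewrite /fubini_G /Rintegral fineK//; exact: integrable_fin_num.
Qed.

Lemma measurable_swap2 : measurable_fun [set: mR * mR] (swap : mR * mR -> mR * mR).
Proof. exact: measurable_swap. Qed.

Lemma measurable_fun_swap f : measurable_fun [set: mR * mR] f ->
  measurable_fun [set: mR * mR] (fun p => f (swap p)).
Proof. by move=> mf; apply: measurableT_comp mf measurable_swap2. Qed.

Lemma L1_swap f : L1 mu2 f -> L1 mu2 (fun p => f (swap p)).
Proof.
move=> fi; have mf := L1_measurable fi.
apply/integrable21ltyP; first by apply/measurable_EFinP; apply: measurable_fun_swap.
by move/integrable12ltyP: fi; apply; exact/measurable_EFinP.
Qed.

Lemma Rint_swap f : L1 mu2 f -> (\int[mu2]_p f (swap p) = \int[mu2]_p f p)%R.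
Proof. by move=> fi; rewrite (Rfubini1 fi) (Rfubini2 (L1_swap fi)). Qed.

Lemma L1_tensor a b : L1 mu a -> L1 mu b -> L1 mu2 (fun p => a p.1 * b p.2).
Proof.
move=> ia ib; have ma := L1_measurable ia; have mb := L1_measurable ib.
apply/integrable12ltyP.
  apply/measurable_EFinP/measurable_funM.
    exact: (measurableT_comp ma).
  exact: (measurableT_comp mb).
under eq_integral => x _.
  under eq_integral => y _ do rewrite /= normrM EFinM.
  rewrite ge0_integralZl//; last exact/measurable_EFinP/measurableT_comp.
  rewrite (L1_EFin (L1_norm ib)).
  over.
rewrite ge0_integralZr//; last 2 first.
- by apply/measurable_EFinP/measurableT_comp.
- by rewrite lee_fin Rintegral_ge0.
by rewrite (L1_EFin (L1_norm ia)) -EFinM ltry.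
Qed.

Lemma Rint_tensor a b : L1 mu a -> L1 mu b ->
  (\int[mu2]_p (a p.1 * b p.2) = (\int[mu]_x a x) * \int[mu]_y b y)%R.
Proof.
move=> ia ib; rewrite (Rfubini1 (L1_tensor ia ib)) mulrC -RintZ//.
by apply: eq_Rint => x /=; rewrite RintZ// mulrC.
Qed.

End plane_integrals.

(** * Local integrability and test functions *)

Section local_integrability.
Context {R : realType}.
Notation mR := (measurableTypeR R).
Notation mu := (@lebesgue_measure R).
Notation mu2 := (mu \x mu)%E.
Implicit Types (f g h phi : R * R -> R) (p q : R * R) (r M : R).

Definition cball r : set (R * R) := [set p | `|p| <= r].

Lemma cball_indicE r p : \1_(cball r) p = if `|p| <= r then 1 else 0 :> R.
Proof.
rewrite indicE (_ : (p \in cball r) = (`|p| <= r)); first by case: leP.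
by apply/idP/idP => [/set_mem|/mem_set].
Qed.

Lemma compact_cball r : compact (cball r).
Proof. exact: compact_ball0. Qed.

Lemma measurable_cball r : measurable (cball r : set (mR * mR)).
Proof. by apply: compact_measurable2; exact: compact_cball. Qed.

Lemma measurable_fun_cball r : measurable_fun [set: mR * mR] (\1_(cball r) : R * R -> R).
Proof. by apply: measurable_indic; exact: measurable_cball. Qed.

Lemma L1_itv (u v : R) : L1 mu (\1_`[u, v]).
Proof. exact: integrable_indic_itv. Qed.

Lemma L1_cball r : L1 mu2 (\1_(cball r)).
Proof.
have := L1_tensor (L1_itv (- r) r) (L1_itv (- r) r).
apply: eq_integrable => // p _ /=; congr EFin.
have E (x : R) : \1_`[- r, r] x = (`|x| <= r)%R%:R :> R.
  by rewrite indicE mem_setE in_itv/= ler_norml.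
by rewrite cball_indicE norm_pair_le !E -natrM mulnb; case: andP.
Qed.

Definition supported r phi := forall p, r < `|p| -> phi p = 0.

(** Local integrability is tested on the balls of the maximum norm, which turns
it into integrability of honest products on the plane. *)
Definition locint f := measurable_fun [set: mR * mR] f /\
  forall r, L1 mu2 (fun p => \1_(cball r) p * f p).

Lemma locint_mul f phi r M : locint f -> measurable_fun [set: mR * mR] phi ->
  (forall p, `|phi p| <= M) -> supported r phi -> L1 mu2 (fun p => f p * phi p).
Proof.
move=> [mf fi] mphi phiM phir.
have := L1_bounded mphi phiM (fi r).
apply: eq_integrable => // p _ /=; congr EFin; rewrite cball_indicE.
by case: leP => [_|/phir ->]; rewrite ?mul1r ?mul0r ?mulr0// mulrC.
Qed.

Lemma L2loc_funP f : L2loc_fun f <-> measurable_fun [set: mR * mR] f /\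
  forall r, L1 mu2 (fun p => \1_(cball r) p * f p ^+ 2).
Proof.
split=> -[mf fi]; (split; first exact: mf); [move=> r|move=> K cK].
  apply/integrableP; split.
    apply/measurable_EFinP/measurable_funM; first exact: measurable_fun_cball.
    exact: measurable_funX.
  rewrite (le_lt_trans _ (fi _ (@compact_cball r)))// [leRHS]integral_mkcond.
  rewrite le_eqVlt; apply/orP; left; apply/eqP; apply: eq_integral => p _ /=.
  rewrite patchE -[\1_(cball r) p]/(\1_(cball r) p) indicE.
  by case: ifP => _; rewrite ?mul1r ?mul0r ?normr0 ?normrX.
have /compact_bounded[M [_ hM]] := cK.
have KM : K `<=` cball (M + 1) by move=> p Kp; apply: hM Kp; rewrite ltrDl.
apply: (@le_lt_trans _ _ (\int[mu2]_(p in cball (M + 1)) (`|f p| ^+ 2)%:E)%E).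
  apply: ge0_subset_integral => //.
  - exact: compact_measurable2.
  - exact: measurable_cball.
  - apply/measurable_EFinP/measurable_funX/measurableT_comp => //.
    exact: measurable_funTS.
rewrite integral_mkcond.
have /integrableP[_] := fi (M + 1); apply: le_lt_trans.
rewrite le_eqVlt; apply/orP; left; apply/eqP; apply: eq_integral => p _ /=.
rewrite patchE indicE.
by case: ifP => _; rewrite ?mul1r ?mul0r ?normr0 ?normrX.
Qed.

Lemma L2loc_locint f : L2loc_fun f -> locint f.
Proof.
move=> /L2loc_funP[mf fi]; split=> // r.
have gi : L1 mu2 (fun p => \1_(cball r) p + \1_(cball r) p * f p ^+ 2).
  by apply: L1D; [exact: L1_cball|exact: fi].
apply: L1_dom gi _.
  by apply: measurable_funM => //; exact: measurable_fun_cball.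
move=> p; rewrite cball_indicE; case: ifP => _; last by rewrite !mul0r normr0 addr0.
rewrite !mul1r -(ger0_norm (sqr_ge0 (f p))) normrX.
have := sqr_ge0 (`|f p| - 1); nra.
Qed.

Lemma continuous_L2loc f : continuous f -> L2loc_fun f.
Proof.
move=> cf; have mf := continuous_measurable2 cf; apply/L2loc_funP; split => // r.
have [M hM] := continuous_locally_bounded cf r.
have gi : L1 mu2 (fun p => M ^+ 2 * \1_(cball r) p) by apply: L1Z; exact: L1_cball.
apply: L1_dom gi _.
  by apply: measurable_funM; [exact: measurable_fun_cball|exact: measurable_funX].
move=> p; rewrite cball_indicE; case: ifP => pr; last by rewrite !mul0r normr0 mulr0.
rewrite mul1r mulr1 normrX -![_ ^+ 2]/(_ * _) ler_pM ?hM//.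
Qed.

Lemma smooth_L2loc f : smooth f -> L2loc_fun f.
Proof. by move=> sf; apply: continuous_L2loc; exact: smooth_continuous. Qed.

Lemma L2locD f g : L2loc_fun f -> L2loc_fun g -> L2loc_fun (fun p => f p + g p).
Proof.
move=> /L2loc_funP[mf fi] /L2loc_funP[mg gi]; apply/L2loc_funP.
split=> [|r]; first exact: measurable_funD.
have hi : L1 mu2 (fun p => 2 * (\1_(cball r) p * f p ^+ 2) + 2 * (\1_(cball r) p * g p ^+ 2)).
  by apply: L1D; apply: L1Z; [exact: fi|exact: gi].
apply: L1_dom hi _.
  apply: measurable_funM; first exact: measurable_fun_cball.
  by apply: measurable_funX; exact: measurable_funD.
move=> p; rewrite cball_indicE; case: ifP => pr; last by rewrite !mul0r normr0 !mulr0 addr0.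
rewrite !mul1r ger0_norm ?sqr_ge0//; have := sqr_ge0 (f p - g p); nra.
Qed.

Lemma L2locZ (a : R) f : L2loc_fun f -> L2loc_fun (fun p => a * f p).
Proof.
move=> /L2loc_funP[mf fi]; apply/L2loc_funP.
split=> [|r]; first exact: measurable_funM.
have := L1Z (a ^+ 2) (fi r).
by apply: eq_integrable => // p _ /=; rewrite exprMn mulrCA.
Qed.

Lemma L2loc_swap f : L2loc_fun f -> L2loc_fun (fun p => f (swap p)).
Proof.
move=> /L2loc_funP[mf fi]; apply/L2loc_funP.
split=> [|r]; first exact: measurable_fun_swap.
have := L1_swap (fi r).
by apply: eq_integrable => // p _ /=; rewrite !cball_indicE norm_swap.
Qed.

Definition is_test r phi := smooth phi /\ supported r phi.

(** The complement of a closed ball is open, so the function vanishes near each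
of its points. *)
Lemma supported_derive r phi b : supported r phi -> supported r ('D_(dir b) phi).
Proof.
move=> phir p rp; rewrite (@near_eq_derive _ _ _ _ (cst 0)) ?derive_cst//.
near=> q; apply: phir; near: q.
apply: (@cvgr_gt _ _ _ _ (fun q => `|q|) `|p|); last by [].
by apply: cvg_norm; exact: cvg_id.
Unshelve. all: by end_near. Qed.

Lemma is_test_derive r phi b : is_test r phi -> is_test r ('D_(dir b) phi).
Proof.
by move=> [sphi phir]; split; [exact: smooth_derive|exact: supported_derive].
Qed.

Lemma is_test_iterD r phi s : is_test r phi -> is_test r (iterD s phi).
Proof. by move=> tphi; elim: s => // b s IH; exact: is_test_derive. Qed.

Lemma test_schwartz r phi : is_test r phi -> is_schwartz phi.
Proof.
move=> tphi; split; first by case: tphi.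
move=> k s; have [sD Dr] := is_test_iterD s tphi.
have [M hM] := smooth_bounded sD `|r|.
exists ((1 + `|r|) ^+ k * `|M|) => p; rewrite /weighted.
case: (leP `|p| r) => [pr|/Dr ->]; last by rewrite normr0 mulr0 mulr_ge0// exprn_ge0// addr_ge0.
have pr' : `|p| <= `|r| by rewrite (le_trans pr)// ler_norm.
apply: ler_pM => //.
  by apply: lerXn2r; rewrite ?nnegrE ?addr_ge0// lerD2l.
by rewrite (le_trans (hM _ pr'))// ler_norm.
Qed.

Lemma compact_support_closure r phi : supported r phi ->
  compact (closure [set p | phi p != 0]).
Proof.
move=> phir; apply: (@subclosed_compact _ _ (cball r)).
- exact: closed_closure.
- exact: compact_cball.
rewrite -(_ : closure (cball r) = cball r).
  apply: closure_subset => p /= /eqP phip; rewrite /cball/= leNgt.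
  by apply/negP => /phir.
apply/esym/closure_id; apply: compact_closed; first exact: norm_hausdorff.
exact: compact_cball.
Qed.

Lemma support_compact phi : compact (closure [set p | phi p != 0]) ->
  exists r, supported r phi.
Proof.
move=> /compact_bounded[M [_ hM]]; exists (M + 1) => p Mp.
apply/eqP; apply: contraTT Mp => phip; rewrite -leNgt.
by apply: (hM (M + 1)); [rewrite ltrDl|exact: subset_closure].
Qed.

Lemma test_bounded r phi : is_test r phi -> exists M, forall p, `|phi p| <= M.
Proof.
move=> [sphi phir]; have [M hM] := smooth_bounded sphi r.
exists (Num.max M 0) => p; case: (leP `|p| r) => [/hM|/phir ->]; rewrite le_max.
  by move=> ->.
by rewrite normr0 lexx orbT.
Qed.

Lemma test_measurable r phi : is_test r phi -> measurable_fun [set: mR * mR] phi.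
Proof. by move=> [/smooth_continuous/continuous_measurable2]. Qed.

Lemma locint_test f r phi : locint f -> is_test r phi -> L1 mu2 (fun p => f p * phi p).
Proof.
move=> fi tphi; have [M hM] := test_bounded tphi.
by apply: locint_mul hM _ => //; [exact: test_measurable tphi|exact: tphi.2].
Qed.

End local_integrability.

(** * Integral operators in the first variable *)

Section partial_kernels.
Context {R : realType}.
Notation mR := (measurableTypeR R).
Notation mu := (@lebesgue_measure R).
Notation mu2 := (mu \x mu)%E.
Implicit Types (f g h phi : R * R -> R) (p : R * R) (r M x y s : R) (q : R -> R -> R).

(** Acts on each horizontal line separately. *)
Definition kerop q f : R * R -> R := fun p => (\int[mu]_x (q x p.1 * f (x, p.2)))%R.

Definition tr q : R -> R -> R := fun x s => q s x.

(** Makes kerop q meaningful on locally integrable functions; its transpose then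
preserves compact supports. *)
Definition kernel q := [/\ measurable_fun [set: mR * mR] (fun p => q p.1 p.2),
  exists B, forall x s, `|q x s| <= B &
  forall r, exists A, forall x s, `|s| <= r -> A < `|x| -> q x s = 0].

Lemma measurable_kerop q f : measurable_fun [set: mR * mR] (fun p => q p.1 p.2) ->
  measurable_fun [set: mR * mR] f -> measurable_fun [set: mR * mR] (kerop q f).
Proof.
move=> mq mf.
pose H (z : (mR * mR) * mR) : R := q z.2 z.1.1 * f (z.2, z.1.2).
have mH : measurable_fun [set: (mR * mR) * mR] H.
  have m1 : measurable_fun [set: (mR * mR) * mR] (fun z : (mR * mR) * mR => (z.2, z.1.1)).
    apply: measurable_fun_pair; first exact: measurable_snd.
    exact: (measurableT_comp measurable_fst measurable_fst).
  have m2 : measurable_fun [set: (mR * mR) * mR] (fun z : (mR * mR) * mR => (z.2, z.1.2)).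
    apply: measurable_fun_pair; first exact: measurable_snd.
    exact: (measurableT_comp measurable_snd measurable_fst).
  by apply: measurable_funM; [exact: (measurableT_comp mq m1)|exact: (measurableT_comp mf m2)].
exact: (measurable_Rint1 mH).
Qed.

Lemma measurable_tr q : measurable_fun [set: mR * mR] (fun p => q p.1 p.2) ->
  measurable_fun [set: mR * mR] (fun p => tr q p.1 p.2).
Proof. by move=> mq; apply: (measurable_fun_swap mq). Qed.

Lemma measurable_slice1 f y : measurable_fun [set: mR * mR] f ->
  measurable_fun [set: mR] (fun x => f (x, y)).
Proof. by move=> mf; apply: (measurableT_comp mf (pair2_measurable (y : mR))). Qed.

Lemma measurable_slice2 f x : measurable_fun [set: mR * mR] f ->
  measurable_fun [set: mR] (fun y => f (x, y)).
Proof. by move=> mf; apply: (measurableT_comp mf (pair1_measurable (x : mR))). Qed.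

Lemma indic_itvE A x : \1_`[- A, A] x = if `|x| <= A then 1 else 0 :> R.
Proof. by rewrite indicE mem_setE in_itv/= ler_norml; case: andP. Qed.

Lemma Rint_segment (u v : R) : u <= v -> (\int[mu]_x (\1_`[u, v] x : R) = v - u)%R.
Proof.
move=> uv; rewrite /Rintegral integral_indic// setIT.
rewrite [X in fine X](lebesgue_measure_itv `[u, v])/= lte_fin.
case: ltP => [_|vu]; first by rewrite -EFinD.
by rewrite (_ : v = u) ?subrr//; lra.
Qed.

Lemma Rint_itv A : 0 <= A -> (\int[mu]_x (\1_`[- A, A] x : R) = A *+ 2)%R.
Proof. by move=> A0; rewrite Rint_segment ?opprK//; lra. Qed.

(** The Cauchy-Schwarz inequality on [- A, A], obtained by expanding the square of
h - t with t the mean value of h. *)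
Lemma sqr_Rint_le (h : R -> R) A : 0 < A -> measurable_fun [set: mR] h ->
  (forall x, A < `|x| -> h x = 0) ->
  (((\int[mu]_x h x)%R ^+ 2)%:E <= (A *+ 2)%:E * \int[mu]_x (h x ^+ 2)%:E)%E.
Proof.
move=> A0 mh hA.
have mh2 : measurable_fun [set: mR] (fun x => h x ^+ 2) by exact: measurable_funX.
have A2 : 0 < A *+ 2 by rewrite mulrn_wgt0.
have S0 : (0 <= \int[mu]_x (h x ^+ 2)%:E)%E.
  by apply: integral_ge0 => x _; rewrite lee_fin sqr_ge0.
have [Sy|Sfin] := eqVneq (\int[mu]_x (h x ^+ 2)%:E)%E +oo%E.
  by rewrite Sy gt0_muley ?lte_fin// leey.
have i2 : L1 mu (fun x => h x ^+ 2).
  apply/integrableP; split; first exact/measurable_EFinP.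
  under eq_integral do rewrite /= ger0_norm ?sqr_ge0//.
  by rewrite ltey.
have ih : L1 mu h.
  have gi : L1 mu (fun x => \1_`[- A, A] x + h x ^+ 2) by apply: L1D => //; exact: L1_itv.
  apply: L1_dom gi _ => // x; rewrite indic_itvE.
  case: ifP => [_|/negbT]; last by rewrite -ltNge => /hA ->; rewrite normr0 expr0n addr0.
  rewrite -(ger0_norm (sqr_ge0 (h x))) normrX.
  have := sqr_ge0 (`|h x| - 1); nra.
rewrite (L1_EFin i2) -EFinM lee_fin.
set I := (\int[mu]_x h x)%R; set S := (\int[mu]_x (h x ^+ 2))%R.
pose t := I / (A *+ 2).
have : (2 * t) * I <= S + t ^+ 2 * (A *+ 2).
  rewrite /I /S -RintZ// -(Rint_itv (ltW A0)) -RintZ; last exact: L1_itv.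
  rewrite -RintD//; last by apply: L1Z; exact: L1_itv.
  apply: le_Rint; [exact: L1Z|by apply: L1D => //; apply: L1Z; exact: L1_itv|].
  move=> x; rewrite indic_itvE; case: ifP => [_|/negbT].
    by have := sqr_ge0 (h x - t); nra.
  by rewrite -ltNge => /hA ->; rewrite expr0n !mulr0 addr0.
have tI : t * (A *+ 2) = I by rewrite /t divfK// gt_eqF.
rewrite -tI => H; have {}H : t ^+ 2 * (A *+ 2) <= S.
  by move: H; rewrite (_ : 2 * t * _ = t ^+ 2 * (A *+ 2) + t ^+ 2 * (A *+ 2)); [lra|ring].
rewrite exprMn (_ : _ * _ = (A *+ 2) * (t ^+ 2 * (A *+ 2))); last by ring.
by rewrite ler_wpM2l// ltW.
Qed.

(** By the Cauchy-Schwarz inequality on each horizontal line, the square of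
kerop q f at (s, y) is at most a constant times the integral G(y) of f^2 over a
bounded part of the line at height y; G is integrable by Tonelli's theorem. *)
Lemma L2loc_kerop q f : kernel q -> L2loc_fun f -> L2loc_fun (kerop q f).
Proof.
move=> [mq [B hB] hA] /L2loc_funP[mf fi]; have mK := measurable_kerop mq mf.
apply/L2loc_funP; split=> // r.
have [A0 hA0] := hA r.
pose A := Num.max 1 (Num.max A0 r).
have A1 : 0 < A by rewrite lt_max ltr01.
have rA : r <= A by rewrite !le_max lexx !orbT.
have AA : A0 <= A by rewrite !le_max lexx !orbT.
pose F (p : mR * mR) : R := \1_(cball A) p * f p ^+ 2.
have F0 p : 0 <= F p by rewrite mulr_ge0// ?sqr_ge0//.
have mF : measurable_fun [set: mR * mR] F by have := L1_measurable (fi A).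
pose G (y : mR) : \bar R := (\int[mu]_x (F (x, y))%:E)%E.
have mG : measurable_fun [set: mR] G.
  apply: (measurable_fun_fubini_tonelli_G (EFin \o F)) => //.
    exact/measurable_EFinP.
have G0 y : (0 <= G y)%E by apply: integral_ge0 => x _; rewrite lee_fin.
pose c := (A *+ 2 * B ^+ 2).
have c0 : 0 <= c by rewrite mulr_ge0 ?sqr_ge0// mulrn_wge0// ltW.
have bound (p : mR * mR) : ((\1_(cball r) p * kerop q f p ^+ 2)%:E
     <= (\1_`[- r, r] p.1)%:E * (c%:E * G p.2))%E.
  rewrite cball_indicE norm_pair_le indic_itvE.
  case: ifP => [/andP[p1 p2]|_]; last first.
    by rewrite mul0r mule_ge0// ?lee_fin ?mule_ge0//; case: ifP.
  rewrite p1 mul1r mul1e /kerop.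
  have hx x : A < `|x| -> q x p.1 * f (x, p.2) = 0.
    by move=> Ax; rewrite hA0 ?mul0r// (le_lt_trans AA).
  have mh : measurable_fun [set: mR] (fun x => q x p.1 * f (x, p.2)).
    apply: measurable_funM; last exact: measurable_slice1.
    exact: (measurable_slice1 p.1 mq).
  apply: le_trans (sqr_Rint_le A1 mh hx) _.
  rewrite /c EFinM -muleA lee_wpmul2l ?lee_fin ?mulrn_wge0 ?(ltW A1)//.
  rewrite /G -ge0_integralZl ?lee_fin ?sqr_ge0//; last 2 first.
  - by apply/measurable_EFinP; apply: measurable_slice1.
  - by move=> x _; rewrite lee_fin.
  apply: ge0_le_integral => //.
  - by move=> x _; rewrite lee_fin sqr_ge0.
  - by apply/measurable_EFinP/measurable_funX.
  - by apply/measurable_EFinP; apply: measurable_funM => //; apply: measurable_slice1.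
  move=> x _; rewrite -EFinM lee_fin /F cball_indicE norm_pair_le /= (le_trans p2 rA) andbT.
  case: ifP => [_|/negbT]; last by rewrite -ltNge => /hx ->; rewrite expr0n mul0r mulr0.
  rewrite mul1r exprMn ler_wpM2r ?sqr_ge0//.
  by rewrite -(ger0_norm (sqr_ge0 (q _ _))) normrX ler_pXn2r ?nnegrE//
    (le_trans (normr_ge0 _) (hB x p.1)).
apply/integrableP; split.
  apply/measurable_EFinP; apply: measurable_funM; first exact: measurable_fun_cball.
  exact: measurable_funX.
have mU : measurable_fun [set: mR] (fun x => (\1_`[- r, r] x : R)%:E).
  by apply/measurable_EFinP; exact: measurable_indic.
apply: (@le_lt_trans _ _ (\int[mu2]_p ((\1_`[- r, r] p.1)%:E * (c%:E * G p.2)))%E).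
  apply: ge0_le_integral => //.
  - apply: measurableT_comp => //; apply/measurable_EFinP.
    apply: measurable_funM; first exact: measurable_fun_cball.
    exact: measurable_funX.
  - apply: emeasurable_funM.
      exact: (measurableT_comp mU measurable_fst).
    apply: measurable_funeM.
    exact: (measurableT_comp mG measurable_snd).
  move=> p _; apply: le_trans (bound p); rewrite /= lee_fin ger0_norm//.
  by rewrite mulr_ge0 ?sqr_ge0// cball_indicE; case: ifP.
rewrite fubini_tonelli1//=; last 2 first.
- apply: emeasurable_funM.
    exact: (measurableT_comp mU measurable_fst).
  apply: measurable_funeM.
  exact: (measurableT_comp mG measurable_snd).
- by move=> p; rewrite mule_ge0 ?lee_fin// ?mule_ge0 ?lee_fin//.
rewrite /fubini_F /=.
have GE : (\int[mu]_y (c%:E * G y) = (c * (\int[mu2]_p F p)%R)%:E)%E.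
  rewrite ge0_integralZl ?lee_fin// EFinM; congr (_ * _)%E.
  by rewrite -(L1_EFin (fi A)) fubini_tonelli2//=; exact/measurable_EFinP.
under eq_integral => x _.
  rewrite ge0_integralZl//; last 2 first.
  - exact: measurable_funeM.
  - by move=> y _; rewrite mule_ge0 ?lee_fin.
  rewrite GE.
  over.
rewrite ge0_integralZr//; last by rewrite lee_fin mulr_ge0// Rintegral_ge0.
by rewrite (L1_EFin (L1_itv _ _)) -EFinM ltry.
Qed.

End partial_kernels.

Section kernel_duality.
Context {R : realType}.
Notation mR := (measurableTypeR R).
Notation mu := (@lebesgue_measure R).
Notation mu2 := (mu \x mu)%E.
Implicit Types (f g h phi : R * R -> R) (p : R * R) (r M x y s : R) (q : R -> R -> R).

Lemma L1_bounded_support (h : R -> R) A M : measurable_fun [set: mR] h ->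
  (forall x, `|h x| <= M) -> (forall x, A < `|x| -> h x = 0) -> L1 mu h.
Proof.
move=> mh hM hA.
have gi : L1 mu (fun x => M * \1_`[- A, A] x) by apply: L1Z; exact: L1_itv.
apply: L1_dom gi _ => // x; rewrite indic_itvE.
by case: ifP => [_|/negbT]; rewrite ?mulr1// -ltNge => /hA ->; rewrite normr0 mulr0.
Qed.

Lemma Rint_bounded_support (h : R -> R) A M : 0 <= A -> measurable_fun [set: mR] h ->
  (forall x, `|h x| <= M) -> (forall x, A < `|x| -> h x = 0) ->
  (`|\int[mu]_x h x| <= M * (A *+ 2))%R.
Proof.
move=> A0 mh hM hA.
have ih := L1_bounded_support mh hM hA.
rewrite (le_trans (normr_Rint ih))// -Rint_itv// -RintZ; last exact: L1_itv.
apply: le_Rint; [exact: L1_norm|by apply: L1Z; exact: L1_itv|].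
move=> x; rewrite indic_itvE.
by case: ifP => [_|/negbT]; rewrite ?mulr1// -ltNge => /hA ->; rewrite normr0 mulr0.
Qed.

Lemma kerop_tr_bound q phi r M : kernel q -> measurable_fun [set: mR * mR] phi ->
  (forall p, `|phi p| <= M) -> supported r phi ->
  (exists N, forall p, `|kerop (tr q) phi p| <= N) /\
  exists A, supported A (kerop (tr q) phi).
Proof.
move=> [mq [B hB] hA] mphi phiM phir; split.
  exists (B * M * (`|r| *+ 2)) => -[x y]; rewrite /kerop /tr /=.
  apply: Rint_bounded_support => //.
  - apply: measurable_funM; last exact: measurable_slice1.
    exact: (measurable_slice2 x mq).
  - by move=> s; rewrite normrM ler_pM.
  - move=> s rs; rewrite phir ?mulr0// norm_pairE lt_max/= (le_lt_trans (ler_norm r) rs)//.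
have [A qA] := hA r; exists (Num.max A r) => -[x y].
rewrite norm_pairE lt_max /= !gt_max /kerop /tr /= => Axy.
rewrite -[RHS](Rint0 mu); apply: eq_Rint => s.
have [sr|rs] := leP `|s| r; last by rewrite phir ?mulr0// norm_pairE lt_max/= rs.
case/orP: Axy => /andP[Ax ry]; first by rewrite qA ?mul0r.
by rewrite phir ?mulr0// norm_pairE lt_max/= ry orbT.
Qed.

Lemma L1_mul_kerop_tr q f phi r M : kernel q -> locint f ->
  measurable_fun [set: mR * mR] phi ->
  (forall p, `|phi p| <= M) -> supported r phi ->
  L1 mu2 (fun p => f p * kerop (tr q) phi p).
Proof.
move=> kq fi mphi phiM phir.
have [[N hN] [A hA]] := kerop_tr_bound kq mphi phiM phir.
apply: locint_mul hN hA => //; apply: measurable_kerop => //.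
by apply: measurable_tr; case: kq.
Qed.

(** Fubini's theorem on almost every horizontal line.  On the support of phi the
kernel only sees x in [- A, A], which is why f is replaced by its truncation g,
integrable on almost every line. *)
Lemma kerop_duality q f phi r M : kernel q -> L2loc_fun f ->
  measurable_fun [set: mR * mR] phi ->
  (forall p, `|phi p| <= M) -> supported r phi ->
  (\int[mu2]_p (kerop q f p * phi p) = \int[mu2]_p (f p * kerop (tr q) phi p))%R.
Proof.
move=> kq f2 mphi phiM phir.
have [mq [B hB] qA] := kq.
have fi := L2loc_locint f2; have mf := fi.1.
have Ki := L2loc_locint (L2loc_kerop kq f2).
have iL := locint_mul Ki mphi phiM phir.
have iR := L1_mul_kerop_tr kq fi mphi phiM phir.
rewrite (Rfubini2 iL) (Rfubini2 iR).
have M0 : 0 <= M by rewrite (le_trans (normr_ge0 _) (phiM 0)).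
apply: ae_eq_Rint.
- exact: (measurable_Rint2 (L1_measurable iL)).
- exact: (measurable_Rint2 (L1_measurable iR)).
have [A0 hA0] := qA r; pose A := Num.max A0 r.
have := ae_integrable2 (fi.2 A); apply: filterS => y iy.
have [yr|ry] := leP `|y| r; last first.
  have phi0 s : phi (s, y) = 0 by rewrite phir// norm_pairE lt_max/= ry orbT.
  transitivity (0 : R).
    by rewrite -[RHS](Rint0 mu); apply: eq_Rint => s; rewrite phi0 mulr0.
  rewrite -[LHS](Rint0 mu); apply: eq_Rint => x; rewrite /kerop /tr /= (_ : Rintegral _ _ _ = 0) ?mulr0//.
  by rewrite -[RHS](Rint0 mu); apply: eq_Rint => s; rewrite phi0 mulr0.
pose g x := \1_(cball A) (x, y) * f (x, y).
have ig : L1 mu g := iy.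
have rA : r <= A by rewrite le_max lexx orbT.
have gE x : `|x| <= A -> g x = f (x, y).
  by move=> xA; rewrite /g cball_indicE norm_pair_le/= xA (le_trans yr rA) mul1r.
have q0 x s : `|s| <= r -> A < `|x| -> q x s = 0.
  by move=> sr Ax; apply: hA0 => //; rewrite (le_lt_trans _ Ax)// le_max lexx.
have phis s : r < `|s| -> phi (s, y) = 0.
  by move=> rs; rewrite phir// norm_pairE lt_max/= rs.
pose H (p : R * R) := q p.1 p.2 * (g p.1 * phi (p.2, y)).
have mphiy : measurable_fun [set: mR] (fun s => phi (s, y)) by exact: measurable_slice1.
have iphi : L1 mu (fun s => phi (s, y)).
  by apply: (@L1_bounded_support _ r M).
have iH : L1 mu2 H.
  exact: (L1_bounded mq (fun p => hB p.1 p.2) (L1_tensor ig iphi)).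
transitivity ((\int[mu]_s \int[mu]_x H (x, s))%R).
  apply: eq_Rint => s; rewrite /kerop /H /= mulrC.
  have [sr|rs] := leP `|s| r; last first.
    rewrite phis// mul0r -[LHS](Rint0 mu); apply: eq_Rint => x.
    by rewrite !mulr0.
  have iqg : L1 mu (fun x => q x s * g x).
    exact: (L1_bounded (measurable_slice1 s mq) (fun x => hB x s) ig).
  rewrite (_ : Rintegral _ _ _ = \int[mu]_x (q x s * g x))%R.
    rewrite -(RintZ _ iqg); apply: eq_Rint => x. by rewrite /=; ring.
  apply: eq_Rint => x; have [xA|Ax] := leP `|x| A; first by rewrite gE.
  by rewrite q0// !mul0r.
rewrite -(Rfubini2 iH) (Rfubini1 iH).
apply: eq_Rint => x; rewrite /kerop /tr /H /=.
have iqp : L1 mu (fun s => q x s * phi (s, y)).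
  exact: (L1_bounded (measurable_slice2 x mq) (fun s => hB x s) iphi).
transitivity (g x * \int[mu]_s (q x s * phi (s, y)))%R.
  by rewrite -(RintZ _ iqp); apply: eq_Rint => s /=; ring.
have [xA|Ax] := leP `|x| A; first by rewrite gE.
rewrite (_ : Rintegral _ _ _ = 0) ?mulr0//.
rewrite -[RHS](Rint0 mu); apply: eq_Rint => s.
have [sr|rs] := leP `|s| r; first by rewrite q0// mul0r.
by rewrite phis// mulr0.
Qed.

End kernel_duality.

Section smooth_kernels.
Context {R : realType}.
Notation mR := (measurableTypeR R).
Notation mu := (@lebesgue_measure R).
Notation mu2 := (mu \x mu)%E.
Implicit Types (f g h phi : R * R -> R) (p : R * R) (r M x y s : R) (q : R -> R -> R).

Lemma smooth_measurable f : smooth f -> measurable_fun [set: mR * mR] f.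
Proof. by move=> sf; apply: continuous_measurable2; exact: smooth_continuous. Qed.

(** The bounds are uniform in y: this is the domination used for continuity and
for differentiation under the integral. *)
Lemma kerop_slice q f s r : kernel q -> smooth f -> exists A, exists M,
  forall y, `|y| <= r ->
   [/\ measurable_fun [set: mR] (fun x => q x s * f (x, y)),
   forall x, `|q x s * f (x, y)| <= M,
   forall x, A < `|x| -> q x s * f (x, y) = 0 & L1 mu (fun x => q x s * f (x, y))].
Proof.
move=> [mq [B hB] qA] sf; have [A hA] := qA `|s|.
have [M hM] := smooth_bounded sf (Num.max A r).
exists A, (B * M) => y yr.
have mqf : measurable_fun [set: mR] (fun x => q x s * f (x, y)).
  apply: measurable_funM; first exact: (measurable_slice1 s mq).
  by apply: measurable_slice1; exact: smooth_measurable.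
have bqf x : `|q x s * f (x, y)| <= B * M.
  have B0 : 0 <= B := le_trans (normr_ge0 _) (hB x s).
  have M0 : 0 <= M.
    by apply: le_trans (hM (y, y) _); rewrite // norm_pair_le/= le_max yr orbT.
  have [xA|Ax] := leP `|x| A; last by rewrite hA// mul0r normr0 mulr_ge0.
  by rewrite normrM ler_pM ?hM// norm_pair_le/= !le_max xA yr orbT.
have zqf x : A < `|x| -> q x s * f (x, y) = 0 by move=> /hA ->; rewrite ?mul0r.
by split => //; exact: (L1_bounded_support mqf bqf zqf).
Qed.

Lemma L1_kerop_slice q f s y : kernel q -> smooth f -> L1 mu (fun x => q x s * f (x, y)).
Proof.
move=> kq sf; have [A [M /(_ y (lexx _))[]//]] := kerop_slice s `|y| kq sf.
Qed.

Lemma kerop_locally_bounded q f : kernel q -> smooth f -> locally_bounded (kerop q f).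
Proof.
move=> kq sf r; have [mq [B hB] qA] := kq.
have [A [A0 hA]] : exists A, 0 <= A /\ forall x s, `|s| <= r -> A < `|x| -> q x s = 0.
  have [A0 hA0] := qA r; exists (Num.max A0 0); rewrite le_max lexx orbT; split => // x s sr.
  by rewrite gt_max => /andP[/hA0 ->].
have [M hM] := smooth_bounded sf (Num.max A r).
exists (B * M * (A *+ 2)) => -[s y]; rewrite norm_pair_le => /andP[/= sr yr].
rewrite /kerop /=; apply: Rint_bounded_support => // [|x|x Ax].
- apply: measurable_funM; first exact: (measurable_slice1 s mq).
  by apply: measurable_slice1; exact: smooth_measurable.
- have B0 : 0 <= B := le_trans (normr_ge0 _) (hB x s).
  have M0 : 0 <= M.
    by apply: le_trans (hM (y, y) _); rewrite // norm_pair_le/= le_max yr orbT.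
  have [xA|Ax] := leP `|x| A.
    by rewrite normrM ler_pM ?hM// norm_pair_le/= !le_max xA yr orbT.
  by rewrite hA// ?mul0r ?normr0 ?mulr_ge0.
by rewrite hA ?mul0r.
Qed.

(** Differentiation under the integral: the kernel does not involve y. *)
Lemma is_derive_kerop_dy q f p : kernel q -> smooth f ->
  is_derive p (dir true) (kerop q f) (kerop q ('D_(dir true) f) p).
Proof.
move=> kq sf; apply/is_derive_move; case: p => s y /=.
have sdf := smooth_derive true sf.
have [A [M hM]] := kerop_slice s (`|y| + 1) kq sdf.
pose F (t x : R) := q x s * f (x, t).
have dF t x : is_derive t (1 : R) (F^~ x) (q x s * 'D_(dir true) f (x, t)).
  have := (is_derive_move true f (x, t) _).1 (derivableP (smooth_derivable sf (x, t) true)).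
  move=> /= df; have := is_deriveZ (q x s) df.
  by rewrite [X in is_derive _ _ X _](_ : _ = F^~ x).
pose G (x : R) := M * \1_`[- A, A] x.
have M0 : 0 <= M.
  have [//|_ h _ _] := hM y; first by rewrite lerDl.
  exact: le_trans (normr_ge0 _) (h 0).
have near1 t : t \in `](y - 1), (y + 1)[ -> `|t| <= `|y| + 1.
  rewrite in_itv/= => /andP[t1 t2].
  rewrite -(subrK y t) addrC (le_trans (ler_normD _ _))// lerD2l ler_norml.
  by apply/andP; split; lra.
have Iy : [set` `](y - 1), (y + 1)[ ] y by rewrite /= in_itv/= ltrDl ltrBlDr ltrDl !ltr01.
have iF t : [set` `](y - 1), (y + 1)[ ] t -> mu.-integrable setT (EFin \o F t).
  by move=> _; exact: L1_kerop_slice.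
have derF t x : [set` `](y - 1), (y + 1)[ ] t -> [set: mR] x -> derivable (F^~ x) t 1.
  by move=> _ _; have [] := dF t x.
have G0 x : 0 <= G x by rewrite mulr_ge0.
have iG : mu.-integrable setT (EFin \o G) by apply: L1Z; exact: L1_itv.
have FG t x : [set` `](y - 1), (y + 1)[ ] t -> [set: mR] x -> `|partial1of2 F t x| <= G x.
  move=> It _; rewrite partial1of2E; have [_ ->] := dF t x.
  have [_ h1 h2 _] := hM t (near1 t It).
  rewrite /G indic_itvE; case: ifP => [_|/negbT]; first by rewrite mulr1.
  by rewrite -ltNge => /h2 ->; rewrite normr0 mulr0.
have := cvg_differentiation_under_integral measurableT Iy iF derF G0 iG FG.
rewrite [X in _ --> X](_ : _ = kerop q ('D_(dir true) f) (s, y)); last first.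
  by apply: eq_Rint => x; rewrite -[LHS]/(partial1of2 F y x) partial1of2E; have [_ ->] := dF y x.
move=> cF.
have E : (fun h : R => h^-1 *: (((fun t => kerop q f (s, t)) \o shift y) (h *: 1) - kerop q f (s, y)))
   = (fun h : R => h^-1 *: ((fun x' => \int[mu]_(y0 in setT) F x' y0)%R (h + y) - (fun x' => \int[mu]_(y0 in setT) F x' y0)%R y)).
  by apply/funext => h /=; rewrite -[h *: 1]/(h * 1) mulr1.
split; rewrite /derivable /derive E; first by apply/cvg_ex; eexists; exact: cF.
exact: cvg_lim cF.
Qed.

(** Since d/dy commutes with kerop q, only d/dx has to be controlled; g stands
for the operator (d/dx) o kerop q, here assumed to land in smooth functions. *)
Lemma smooth_kerop q (g : (R * R -> R) -> R * R -> R) : kernel q ->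
  (forall f, smooth f -> smooth (g f) /\
     forall p, is_derive p (dir false) (kerop q f) (g f p)) ->
  forall f, smooth f -> smooth (kerop q f).
Proof.
move=> kq hg f sf.
apply: (@smooth_class _ (fun h => smooth h \/ exists2 f, smooth f & h = kerop q f));
  last by right; exists f.
move=> h [sh|[{sf}f sf ->]].
  split; first exact: smooth_bounded.
  move=> b; split; first by move=> p; exact: smooth_derivable.
  by apply: span_base; left; exact: smooth_derive.
split; first exact: kerop_locally_bounded.
have [sg dg] := hg f sf.
case; split.
- by move=> p; have [] := is_derive_kerop_dy p kq sf.
- apply: span_base; right; exists ('D_(dir true) f); first exact: smooth_derive.
  by apply/funext => p; have [] := is_derive_kerop_dy p kq sf.
- by move=> p; have [] := dg p.
- apply: span_base; left; rewrite (_ : 'D_(dir false) _ = g f) //.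
  by apply/funext => p; have [] := dg p.
Qed.

End smooth_kernels.

Section primitives.
Context {R : realType}.
Notation mR := (measurableTypeR R).
Notation mu := (@lebesgue_measure R).
Notation mu2 := (mu \x mu)%E.
Implicit Types (f g h phi : R * R -> R) (p : R * R) (r M x y s t : R) (q : R -> R -> R).

(** Integrating against this kernel is taking a primitive in the first variable,
normalized by w; for w equal to 1 near -oo and 0 near +oo the kernel has bounded
support in x, locally in s. *)
Definition step (w : R -> R) : R -> R -> R := fun x s => (x <= s)%R%:R - w x.

Definition col (a : R -> R) : R -> R -> R := fun x _ => a x.

Lemma natr_boolE (b : bool) : b%:R = (if b then 1 else 0) :> R.
Proof. by case: b. Qed.

Lemma kernel_col (a : R -> R) A M : measurable_fun [set: mR] a ->
  (forall x, `|a x| <= M) -> (forall x, A < `|x| -> a x = 0) -> kernel (col a).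
Proof.
move=> ma aM aA; split; last by move=> r; exists A => x s _; exact: aA.
  exact: (measurableT_comp ma measurable_fst).
by exists M => x s; exact: aM.
Qed.

Lemma smooth_kerop_col (a : R -> R) f : kernel (col a) -> smooth f ->
  smooth (kerop (col a) f).
Proof.
move=> ka; apply: (@smooth_kerop _ _ (fun _ _ => 0)); first exact: ka.
move=> h sh; split; first exact: smooth_cst.
move=> p; apply/is_derive_move; rewrite (_ : (fun _ => _) = cst (kerop (col a) h p)).
  exact: is_derive_cst.
by apply/funext => t; case: p.
Qed.

Lemma measurable_natr_bool d (T : measurableType d) (b : T -> bool) :
  measurable_fun [set: T] b -> measurable_fun [set: T] (fun z : T => (b z)%:R : R).
Proof.
move=> mb; under eq_fun do rewrite natr_boolE.
by apply: measurable_fun_ifT.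
Qed.

Lemma kernel_step (w : R -> R) A B M : measurable_fun [set: mR] w ->
  (forall x, `|w x| <= M) ->
  (forall x, x <= A -> w x = 1) -> (forall x, B < x -> w x = 0) -> kernel (step w).
Proof.
move=> mw wM wA wB; split.
- apply: measurable_funB; last exact: (measurableT_comp mw measurable_fst).
  apply: measurable_natr_bool.
  by apply: measurable_fun_ler; [exact: measurable_fst|exact: measurable_snd].
- exists (1 + M) => x s; rewrite (le_trans (ler_normB _ _))// lerD//.
  by case: (x <= s); rewrite ?normr1 ?normr0.
- move=> r; exists (Num.max r (Num.max `|A| `|B|)) => x s sr.
  rewrite !gt_max => /and3P[rx Ax Bx]; rewrite /step.
  move: sr rx Ax Bx; rewrite ler_norml => /andP[sr1 sr2].
  case: (ltrgt0P x) => [x0|x0|->].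
  + move=> rx Ax Bx; rewrite wB ?(le_lt_trans (ler_norm B))//.
    by rewrite leNgt (le_lt_trans sr2)//= subr0.
  + move=> rx Ax Bx; rewrite wA; last first.
      by rewrite -lerN2 (le_trans _ (ltW Ax))// -normrN ler_norm.
    by rewrite (le_trans _ sr1) ?subrr// lerNr ltW.
  + by move=> _; rewrite normr_lt0.
Qed.

Lemma L1_continuous_itv (F : R -> R) (u v : R) : continuous F ->
  L1 mu (fun x => \1_`[u, v] x * F x).
Proof.
move=> cF.
have iF : mu.-integrable `[u, v] (EFin \o F).
  apply: continuous_compact_integrable; first exact: segment_compact.
  exact: continuous_subspaceT.
have mI : measurable (`[u, v]%classic : set mR) by exact: measurable_itv.
have := (integrable_mkcond (EFin \o (F : mR -> R)) mI).1 iF.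
apply: eq_integrable => // x _ /=; rewrite patchE indicE.
by case: ifP; rewrite ?mul1r ?mul0r.
Qed.

Lemma smooth_slice_continuous f y : smooth f -> continuous (fun x => f (x, y)).
Proof.
move=> sf x; apply/differentiable_continuous/derivable1_diffP.
by have [] := (is_derive_move false f (x, y) _).1 (derivableP (smooth_derivable sf (x, y) false)).
Qed.

(** To the right of A1, kerop (step w) f differs from the primitive of f based at
A1 by a quantity that does not depend on the upper bound. *)
Lemma is_derive_kerop_step (w : R -> R) A B M f p : measurable_fun [set: mR] w ->
  (forall x, `|w x| <= M) ->
  (forall x, x <= A -> w x = 1) -> (forall x, B < x -> w x = 0) -> smooth f ->
  is_derive p (dir false) (kerop (step w) f) (f p).
Proof.
move=> mw wM wA wB sf; apply/is_derive_move; case: p => s0 y /=.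
(* A1 is to the left of s0 and of the region where w is not constant. *)
pose A1 := Num.min A (s0 - 1) - 1.
have A1A : A1 <= A by have := ge_min A A (s0 - 1); rewrite /A1 lexx /=; lra.
have A1s : A1 < s0 - 1 by have := ge_min (s0 - 1) A (s0 - 1); rewrite /A1 lexx orbT; lra.
move: A1 A1A A1s => A1 A1A A1s.
pose F (x : R) := f (x, y).
have cF : continuous F by exact: smooth_slice_continuous.
have iF (u v : R) : L1 mu (fun x => \1_`[u, v] x * F x) by exact: L1_continuous_itv.
pose c := (\int[mu]_x ((w x - (x < A1)%R%:R) * F x))%R.
have ic : L1 mu (fun x => (w x - (x < A1)%R%:R) * F x).
  rewrite (_ : (fun _ => _) = (fun x => (w x - (x < A1)%R%:R) * (\1_`[A1, B] x * F x))).
    apply: (@L1_bounded _ _ _ mu (fun x => w x - (x < A1)%R%:R) _ (M + 1) _ _ (iF A1 B)) => [|x].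
      apply: measurable_funB => //; apply: measurable_natr_bool.
      exact: measurable_fun_ltr.
    rewrite (le_trans (ler_normB _ _))// lerD//.
    by case: (x < A1); rewrite ?normr1 ?normr0.
  apply/funext => x; rewrite indicE mem_setE in_itv/=.
  have [xA1|A1x] /= := ltP x A1; first by rewrite wA ?subrr ?mul0r// (le_trans (ltW xA1)).
  by have [xB|Bx] := leP x B; rewrite ?mul1r// wB// subrr !mul0r.
have E t : A1 <= t -> kerop (step w) f (t, y) = (\int[mu]_(x in `[A1, t]) F x)%R - c.
  move=> A1t; rewrite Rintegral_mkcond.
  rewrite (_ : F \_ `[A1, t] = fun x => \1_`[A1, t] x * F x); last first.
    by apply/funext => x; rewrite patchE indicE; case: ifP; rewrite ?mul1r ?mul0r.
  rewrite -RintB//; apply: eq_Rint => x; rewrite /step /= -/(F x) -mulrBl; congr (_ * _).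
  rewrite indicE mem_setE in_itv/=.
  have [xA1|A1x] /= := ltP x A1; first by rewrite (le_trans (ltW xA1))//=; ring.
  by ring.
apply: (@near_eq_is_derive _ _ _ (fun t => (\int[mu]_(x in `[A1, t]) F x)%R - c)).
  near=> t; rewrite E//; apply: (le_trans (ltW A1s)); apply: ltW.
  by near: t; apply: lt_nbhsr; rewrite ltrBlDr ltrDl.
have [] := @continuous_FTC1_closed R F A1 s0 (s0 + 1).
- by rewrite ltrDl.
- have mI : measurable (`[A1, s0 + 1]%classic : set mR) by exact: measurable_itv.
  apply: (integrable_mkcond (EFin \o (F : mR -> R)) mI).2; have := iF A1 (s0 + 1).
  apply: eq_integrable => // x _ /=; rewrite patchE indicE.
  by case: ifP; rewrite ?mul1r ?mul0r.
- by rewrite (lt_trans A1s)// ltrBlDr ltrDl.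
- exact: cF.
move=> d1 d2.
have dI : is_derive s0 (1 : R) (fun t => \int[mu]_(x in `[A1, t]) F x)%R (F s0).
  by split; [exact: d1|rewrite -derive1E; exact: d2].
have := is_deriveB dI (is_derive_cst c s0 (1 : R)).
by rewrite subr0.
Unshelve. all: by end_near. Qed.

Lemma smooth_kerop_step (w : R -> R) A B M f : measurable_fun [set: mR] w ->
  (forall x, `|w x| <= M) ->
  (forall x, x <= A -> w x = 1) -> (forall x, B < x -> w x = 0) -> smooth f ->
  smooth (kerop (step w) f).
Proof.
move=> mw wM wA wB; apply: (@smooth_kerop _ _ id); first exact: kernel_step wM wA wB.
by move=> h sh; split; [exact: sh|move=> p; exact: is_derive_kerop_step wM wA wB sh].
Qed.

End primitives.

(** * A primitive that preserves compact supports *)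

Section cutoff.
Context {R : realType}.
Notation mR := (measurableTypeR R).
Notation mu := (@lebesgue_measure R).
Notation mu2 := (mu \x mu)%E.
Implicit Types (f g h phi : R * R -> R) (p : R * R) (r M x y s t : R) (b : bool).

Lemma measurable_bump (u v : R) : measurable_fun [set: mR] (bump u v).
Proof.
have := measurable_slice1 0 (smooth_measurable (@smooth_bump R false u v)).
by [].
Qed.

(** Dividing by it gives chi = x rho the integral 1. *)
Definition bump12_moment : R := (\int[mu]_x (x * bump 1 2 x))%R.

Definition rho x : R := bump 1 2 x / bump12_moment.

Definition chi x : R := x * rho x.

Lemma bump12_eq0 x : ~~ (1 < x < 2) -> bump 1 2 x = 0 :> R.
Proof. by apply: bump_eq0; rewrite ltr1n. Qed.

Lemma L1_moment : L1 mu (fun x : R => x * bump 1 2 x).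
Proof.
apply: (@L1_bounded_support _ _ 2 2) => [|x|x x2].
- by apply: measurable_funM => //; exact: measurable_bump.
- have [/andP[x1 x2]|/bump12_eq0 ->] := boolP (1 < x < 2); last by rewrite mulr0 normr0.
  rewrite normrM (ger0_norm (bump_ge0 _ _ _)) -[leRHS]mulr1 ler_pM// ?bump_ge0 ?bump_le1//.
  by rewrite ger0_norm; lra.
- rewrite bump12_eq0 ?mulr0//; apply/negP => /andP[x1 x2'].
  by move: x2; rewrite ger0_norm; lra.
Qed.

Lemma moment_gt0 : 0 < bump12_moment.
Proof.
pose e : R := expR (- 8).
have e0 : 0 < e by exact: expR_gt0.
apply: (@lt_le_trans _ _ (e * (7 / 4 - 5 / 4))); first by rewrite mulr_gt0//; lra.
rewrite -Rint_segment; last by lra.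
rewrite -RintZ; last exact: L1_itv.
apply: le_Rint; [by apply: L1Z; exact: L1_itv|exact: L1_moment|] => x.
rewrite indicE mem_setE in_itv/=.
case: (boolP (_ && _)) => [/andP[x1 x2]|_].
  have h : e <= bump 1 2 x by apply: bump_ge; [rewrite ltr1n|apply/andP; split; lra].
  rewrite mulr1 (le_trans h)// ler_peMl ?bump_ge0//; lra.
rewrite mulr0; have [/andP[x1 x2]|/bump12_eq0 ->] := boolP (1 < x < 2).
  by rewrite mulr_ge0 ?bump_ge0//; lra.
by rewrite mulr0.
Qed.

Lemma rho_eq0 x : ~~ (1 < x < 2) -> rho x = 0.
Proof. by move=> /bump12_eq0 h; rewrite /rho h mul0r. Qed.

Lemma chi_eq0 x : ~~ (1 < x < 2) -> chi x = 0.
Proof. by move=> /rho_eq0 h; rewrite /chi h mulr0. Qed.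

Lemma smooth_rho b : smooth (fun p => rho (coord b p)).
Proof.
rewrite (_ : (fun _ => _) = fun p => bump12_moment^-1 * bump 1 2 (coord b p)).
  by apply: smoothZ; exact: smooth_bump.
by apply/funext => p; rewrite mulrC.
Qed.

Lemma smooth_chi b : smooth (fun p => chi (coord b p)).
Proof. by apply: smoothM; [exact: smooth_coord|exact: smooth_rho]. Qed.

Lemma chiE x : chi x = bump12_moment^-1 * (x * bump 1 2 x).
Proof. by rewrite /chi /rho mulrA mulrC. Qed.

Lemma Rint_chi : (\int[mu]_x chi x = 1)%R.
Proof.
transitivity (\int[mu]_x (bump12_moment^-1 * (x * bump 1 2 x)))%R.
  by apply: eq_Rint => x; rewrite chiE.
by rewrite RintZ ?mulVf ?gt_eqF ?moment_gt0//; exact: L1_moment.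
Qed.

Lemma chi_itv x : 1 < x < 2 \/ chi x = 0.
Proof. by have [|/chi_eq0] := boolP (1 < x < 2); [left|right]. Qed.

Definition halfline (a x : R) : R := (x <= a)%R%:R.

Lemma measurable_halfline a : measurable_fun [set: mR] (halfline a).
Proof. by apply: measurable_natr_bool; apply: measurable_fun_ler. Qed.

Lemma halfline_le1 a x : `|halfline a x| <= 1.
Proof. by rewrite /halfline; case: (x <= a); rewrite ?normr1 ?normr0. Qed.

Lemma halfline1 a x : x <= a -> halfline a x = 1.
Proof. by rewrite /halfline => ->. Qed.

Lemma halfline0 a x : a < x -> halfline a x = 0.
Proof. by rewrite /halfline leNgt => ->. Qed.

Lemma smooth_kerop_halfline a f : smooth f -> smooth (kerop (step (halfline a)) f).
Proof.
exact: (smooth_kerop_step (measurable_halfline a) (halfline_le1 a) (@halfline1 a) (@halfline0 a)).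
Qed.

Lemma kernel_halfline a : kernel (step (halfline a)).
Proof.
exact: (kernel_step (measurable_halfline a) (halfline_le1 a) (@halfline1 a) (@halfline0 a)).
Qed.

Lemma is_derive_halfline a f p : smooth f ->
  is_derive p (dir false) (kerop (step (halfline a)) f) (f p).
Proof.
exact: (is_derive_kerop_step _ (measurable_halfline a) (halfline_le1 a) (@halfline1 a) (@halfline0 a)).
Qed.

(** The primitive of chi, which goes from 0 to 1 between 1 and 2. *)
Definition cutoff s : R := (\int[mu]_x (step (halfline 0) x s * chi x))%R.

Lemma smooth_cutoff : smooth (fun p => cutoff p.1).
Proof. exact: (smooth_kerop_halfline 0 (smooth_chi false)). Qed.

Lemma is_derive_cutoff p : is_derive p (dir false) (fun p => cutoff p.1) (chi p.1).
Proof. exact: (is_derive_halfline 0 p (smooth_chi false)). Qed.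

Lemma cutoff_eq0 s : s <= 1 -> cutoff s = 0.
Proof.
move=> s1; rewrite /cutoff -[RHS](Rint0 mu); apply: eq_Rint => x; rewrite /step /halfline.
case: (chi_itv x) => [/andP[x1 _]|->]; last by rewrite mulr0.
have -> : (x <= s) = false by lra.
have -> : (x <= 0) = false by lra.
by rewrite subrr mul0r.
Qed.

Lemma cutoff_eq1 s : 2 <= s -> cutoff s = 1.
Proof.
move=> s2; rewrite /cutoff -Rint_chi; apply: eq_Rint => x; rewrite /step /halfline.
case: (chi_itv x) => [/andP[x1 x2]|->]; last by rewrite mulr0.
have -> : (x <= s) = true by lra.
have -> : (x <= 0) = false by lra.
by rewrite subr0 mul1r.
Qed.

Lemma measurable_cutoff : measurable_fun [set: mR] cutoff.
Proof. exact: (measurable_slice1 0 (smooth_measurable smooth_cutoff)). Qed.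

Lemma cutoff_bounded : exists M : R, forall s, `|cutoff s| <= M.
Proof.
have [M hM] := smooth_bounded smooth_cutoff 2.
exists (Num.max M 1) => s; rewrite le_max; have [s2|s2] := leP `|s| 2.
  by have := hM (s, 0); rewrite norm_pair_le /= s2 normr0 ler0n => ->.
have [s0|s0] := leP 0 s.
  by rewrite cutoff_eq1 ?normr1 ?lexx ?orbT// ltW// -(ger0_norm s0).
by rewrite cutoff_eq0 ?normr0 ?ler01 ?orbT//; lra.
Qed.

(** With w = 1 - cutoff, the transpose of this kernel sends phi to minus the
primitive of phi - chi(x) (integral of phi in x). *)
Definition kap : R -> R -> R := step (fun x => 1 - cutoff x).

Lemma kap_data : exists M : R, [/\ measurable_fun [set: mR] (fun x => 1 - cutoff x),
  forall x, `|1 - cutoff x| <= M,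
  forall x, x <= 1 -> 1 - cutoff x = 1 & forall x, 2 < x -> 1 - cutoff x = 0].
Proof.
have [M hM] := cutoff_bounded; exists (1 + M); split.
- by apply: measurable_funB => //; exact: measurable_cutoff.
- by move=> x; rewrite (le_trans (ler_normB _ _))// normr1 lerD2l.
- by move=> x /cutoff_eq0 ->; rewrite subr0.
- by move=> x /ltW/cutoff_eq1 ->; rewrite subrr.
Qed.

Lemma kernel_kap : kernel kap.
Proof. by have [M [m1 m2 m3 m4]] := kap_data; exact: kernel_step m1 m2 m3 m4. Qed.

Lemma smooth_kerop_kap f : smooth f -> smooth (kerop kap f).
Proof. by have [M [m1 m2 m3 m4]] := kap_data; exact: smooth_kerop_step m1 m2 m3 m4. Qed.

Definition box (a x : R) : R := \1_`[- a, a] x.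

Lemma kernel_box a : kernel (col (box a)).
Proof.
apply: (@kernel_col _ _ a 1).
- exact: measurable_indic.
- by move=> x; rewrite /box indic_itvE; case: ifP => _; rewrite ?normr1 ?normr0.
- by move=> x; rewrite ltNge => /negbTE ax; rewrite /box indic_itvE ax.
Qed.

Lemma kernel_rho : kernel (col rho).
Proof.
have m0 := moment_gt0.
apply: (@kernel_col _ _ 2 (bump12_moment^-1)).
- by apply: measurable_funM => //; exact: measurable_bump.
- move=> x; rewrite /rho normrM (ger0_norm (bump_ge0 _ _ _)) ger0_norm ?invr_ge0 ?(ltW m0)//.
  by rewrite ler_piMl ?invr_ge0 ?(ltW m0)// bump_le1.
- move=> x x2; rewrite rho_eq0//; apply/negP => /andP[x1 x2'].
  by move: x2; rewrite ger0_norm; lra.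
Qed.

(** The integral of phi in the first variable, written with a kernel so that the
results on kernels apply; r is a bound on the support of phi. *)
Definition mass r phi := kerop (col (box r)) phi.

Lemma massE r phi p : supported r phi -> mass r phi p = (\int[mu]_s phi (s, p.2))%R.
Proof.
move=> phir; apply: eq_Rint => s; rewrite /col /box indic_itvE.
case: ifP => [_|/negbT]; first by rewrite mul1r.
by rewrite -ltNge => rs; rewrite mul0r phir// norm_pairE lt_max/= rs.
Qed.

(** The primitive in x of phi - chi(x) (integral of phi in x); it has compact
support since chi has integral 1. *)
Definition prim phi p := - kerop (tr kap) phi p.

(** Shows that the primitive is smooth.  In the transpose of kap the normalization
depends on the free variable, so it is traded for a primitive based to the left
of the support of phi, minus a product. *)
Lemma primE r phi p : is_test r phi ->
  prim phi p = kerop (step (halfline (- r - 1))) phi p - cutoff p.1 * mass r phi p.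
Proof.
move=> [sphi phir]; case: p => x y; rewrite /prim /mass /kerop /tr /kap /=.
pose a s := phi (s, y).
have i1 : L1 mu (fun s => step (halfline (- r - 1)) s x * phi (s, y)).
  exact: L1_kerop_slice (kernel_halfline _) sphi.
have i2 : L1 mu (fun s => col (box r) s x * phi (s, y)).
  exact: L1_kerop_slice (kernel_box r) sphi.
rewrite -(RintZ _ i2) -(RintB i1 (L1Z _ i2)).
have mphi : measurable_fun [set: mR] (fun s => phi (s, y)).
  by apply: measurable_slice1; exact: smooth_measurable.
have [N hN] := test_bounded (conj sphi phir).
have phis s : r < `|s| -> phi (s, y) = 0.
  by move=> rs; rewrite phir// norm_pairE lt_max/= rs.
have iphi : L1 mu (fun s => phi (s, y)) by apply: (@L1_bounded_support _ _ r N).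
have i3 : L1 mu (fun s => kap x s * phi (s, y)).
  have [mk [B hB] _] := kernel_kap.
  exact: (L1_bounded (measurable_slice2 x mk) (fun s => hB x s) iphi).
rewrite -[LHS]mulN1r -(RintZ _ i3); apply: ae_eq_Rint.
- exact: L1_measurable (L1Z _ i3).
- exact: L1_measurable (L1B i1 (L1Z _ i2)).
(* The two kernels differ at the jump s = x only. *)
exists [set x]; split; [exact: measurable_set1|exact: lebesgue_measure_set1|].
move=> s /= ne; apply/eqP/negP => /negP/eqP sx; apply: ne.
rewrite /kap /step /col /box indic_itvE /halfline.
have [sr|rs] := leP `|s| r; last by rewrite phis// !mulr0 subrr.
have -> : (s <= - r - 1) = false by move: sr; rewrite ler_norml => /andP[? ?]; lra.
case: (ltgtP x s) => [xs|sx'|xs] /=; [ring|ring|].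
by case: sx; rewrite xs.
Qed.

Lemma is_test_prim r phi : is_test r phi -> is_test (Num.max r 2) (prim phi).
Proof.
move=> tphi; have [sphi phir] := tphi; split.
  rewrite (_ : prim phi = fun p => kerop (step (halfline (- r - 1))) phi p - cutoff p.1 * mass r phi p).
    apply: smoothB; first exact: smooth_kerop_halfline.
    apply: smoothM; first exact: smooth_cutoff.
    by apply: smooth_kerop_col => //; exact: kernel_box.
  by apply/funext => p; exact: primE.
move=> [x y]; rewrite gt_max norm_pairE !lt_max/= => /andP[rxy xy2].
rewrite /prim /kerop /tr /kap /= -[RHS]oppr0; congr (- _).
rewrite -[RHS](Rint0 mu); apply: eq_Rint => s.
have [yr|ry] := leP `|y| r; last by rewrite phir ?mulr0// norm_pairE lt_max/= ry orbT.
have [sr|rs] := leP `|s| r; last by rewrite phir ?mulr0// norm_pairE lt_max/= rs.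
have rx : r < `|x| by move: rxy; rewrite (ltNge _ `|y|) yr orbF.
have x2 : 2 < `|x| by case/orP: xy2 => // y2; rewrite (lt_trans y2)// (le_lt_trans yr).
rewrite /step; case: (ltrgt0P x) rx x2 => [x0 rx x2|x0 rx x2|->]; last by move=> _; rewrite ltNge ler0n.
  rewrite cutoff_eq1 ?(ltW x2)// subrr subr0 leNgt.
  by rewrite (le_lt_trans (le_trans (ler_norm s) sr) rx) mul0r.
rewrite cutoff_eq0 ?subr0; last by lra.
have -> : (x <= s) = true by move: sr; rewrite ler_norml => /andP[? ?]; lra.
by rewrite subrr mul0r.
Qed.

Lemma is_derive_prim r phi p : is_test r phi ->
  is_derive p (dir false) (prim phi) (phi p - chi p.1 * mass r phi p).
Proof.
move=> tphi; have [sphi phir] := tphi.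
rewrite (_ : prim phi = fun p => kerop (step (halfline (- r - 1))) phi p - cutoff p.1 * mass r phi p); last first.
  by apply/funext => q; exact: primE.
have d1 := is_derive_halfline (- r - 1) p sphi.
have d2 : is_derive p (dir false) (fun p => cutoff p.1 * mass r phi p) (chi p.1 * mass r phi p).
  apply/is_derive_move; case: p {d1} => x y /=.
  have d := (is_derive_move false _ (x, y) _).1 (is_derive_cutoff (x, y)).
  have := is_deriveZ (mass r phi (x, y)) d.
  rewrite [X in is_derive _ _ X _](_ : _ = fun t => cutoff t * mass r phi (t, y)); last first.
    by apply/funext => t /=; rewrite mulrC.
  by move/is_derive_eq; apply; rewrite mulrC.
exact: (is_deriveB d1 d2).
Qed.

Lemma smooth_mass r phi : smooth phi -> smooth (mass r phi).
Proof. by apply: smooth_kerop_col; exact: kernel_box. Qed.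

Lemma test_swap r phi : is_test r phi -> is_test r (fun p => phi (swap p)).
Proof.
by move=> [sphi phir]; split; [exact: smooth_swap|move=> p; rewrite -norm_swap => /phir].
Qed.

Definition primy phi p := prim (fun p => phi (swap p)) (swap p).

Lemma is_test_primy r phi : is_test r phi -> is_test (Num.max r 2) (primy phi).
Proof. by move=> tphi; apply: (test_swap (is_test_prim (test_swap tphi))). Qed.

Lemma derive_primy r phi p : is_test r phi ->
  'D_(dir true) (primy phi) p = phi p - chi p.2 * mass r (fun p => phi (swap p)) (swap p).
Proof.
move=> tphi; have tp := test_swap tphi.
rewrite (derive_swap true p (is_test_prim tp).1).
by have [_ ->] := is_derive_prim (swap p) tp; rewrite swapK.
Qed.

Lemma test_L1 r phi : is_test r phi -> L1 mu2 phi.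
Proof.
move=> tphi; have := locint_test (L2loc_locint (smooth_L2loc (smooth_cst 1))) tphi.
by apply: eq_integrable => // p _ /=; rewrite mul1r.
Qed.

Lemma L1_smooth_slice h r y : smooth h -> (forall s, r < `|s| -> h (s, y) = 0) ->
  L1 mu (fun s => h (s, y)).
Proof.
move=> sh hr; have := L1_continuous_itv (- r) r (@smooth_slice_continuous R h y sh).
apply: eq_integrable => // s _ /=; rewrite indic_itvE; congr EFin.
by case: ifP => [_|/negbT]; rewrite ?mul1r// -ltNge => /hr ->; rewrite mul0r.
Qed.

(** The one-dimensional decomposition of the function y -> mass phi, integrated
from the decomposition in y of phi itself. *)
Lemma mass_decomposition r phi p : is_test r phi ->
  mass r phi p = 'D_(dir true) (mass (Num.max r 2) (primy phi)) p
    + chi p.2 * (\int[mu2]_q phi q)%R.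
Proof.
move=> tphi; have [sphi phir] := tphi.
have tN := is_test_primy tphi; have [sN Nr] := tN.
have [_ ->] := is_derive_kerop_dy p (kernel_box (Num.max r 2)) sN.
rewrite -/(mass _ _ _) (massE _ phir).
rewrite massE; last exact: supported_derive.
case: p => x y /=.
have i0 := test_L1 tphi.
have ts := test_swap tphi.
pose m s := mass r (fun p => phi (swap p)) (y, s).
have mE s : m s = (\int[mu]_t phi (s, t))%R by rewrite /m (massE _ ts.2).
have im : L1 mu m.
  apply: (@L1_smooth_slice (fun p => mass r (fun p => phi (swap p)) (swap p)) r y).
    by apply: smooth_swap; exact: smooth_mass ts.1.
  move=> s rs; rewrite (massE _ ts.2) /= -[RHS](Rint0 mu); apply: eq_Rint => t.
  by rewrite phir// norm_pairE lt_max/= rs.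
have iphi : L1 mu (fun s => phi (s, y)).
  by apply: (@L1_smooth_slice phi r y sphi) => s rs; rewrite phir// norm_pairE lt_max/= rs.
rewrite (Rfubini1 i0) -(eq_Rint mu mE) -(RintZ _ im).
have iD : L1 mu (fun s => 'D_(dir true) (primy phi) (s, y)).
  rewrite (_ : (fun _ => _) = fun s => phi (s, y) - chi y * m s).
    by apply: L1B => //; exact: L1Z.
  by apply/funext => s; rewrite (derive_primy _ tphi).
rewrite -(RintD iD (L1Z _ im)).
by apply: eq_Rint => s; rewrite (derive_primy _ tphi) /m /= subrK.
Qed.

End cutoff.

(** * Recovering v from its derivatives d/dx v and x d/dy v *)

Section reconstruction.
Context {R : realType}.
Notation mR := (measurableTypeR R).
Notation mu := (@lebesgue_measure R).
Notation mu2 := (mu \x mu)%E.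
Implicit Types (f g h phi : R * R -> R) (p : R * R) (r x y s t : R) (v : tempered R).

Lemma tempered_comb v (a : R) (S1 S2 : schwartz R) : v (a *: S1 + S2) = a * v S1 + v S2.
Proof. by have [lv _] := temperedP v; rewrite lv. Qed.

Lemma temperedD v (S1 S2 : schwartz R) : v (S1 + S2) = v S1 + v S2.
Proof. by rewrite -[S1 in LHS]scale1r tempered_comb mul1r. Qed.

Definition test_fun r phi (tphi : is_test r phi) : schwartz R := to_schwartz (test_schwartz tphi).

Lemma represents_test f v r phi (tphi : is_test r phi) : represents f v ->
  v (test_fun tphi) = (\int[mu2]_p (f p * phi p))%R.
Proof. by move=> fv; apply: fv; apply: (@compact_support_closure _ r); exact: tphi.2. Qed.

Lemma is_test_schwartz (phi : schwartz R) : compact (closure [set p | phi p != 0]) ->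
  exists r, is_test r phi.
Proof.
by move=> /support_compact[r hr]; exists r; split => //; have [] := schwartzP phi.
Qed.

Lemma is_test_chi2 : is_test 2 (fun p : R * R => chi p.1 * chi p.2).
Proof.
split; first by apply: smoothM; [exact: (smooth_chi false)|exact: (smooth_chi true)].
have chi2 x : 2 < `|x| -> chi x = 0.
  move=> x2; rewrite chi_eq0//; apply/negP => /andP[x1 x2'].
  by move: x2; rewrite ger0_norm; lra.
by move=> p; rewrite norm_pairE lt_max => /orP[]/chi2 ->; rewrite ?mul0r ?mulr0.
Qed.

Lemma is_test_rho_mass r phi : is_test r phi ->
  is_test (Num.max r 2) (fun p => rho p.1 * mass r phi p).
Proof.
move=> [sphi phir]; split.
  by apply: smoothM; [exact: (smooth_rho false)|exact: smooth_mass].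
move=> [x y]; rewrite gt_max norm_pairE !lt_max/= => /andP[rxy xy2].
have [x2|x2] := leP `|x| 2; last first.
  rewrite rho_eq0 ?mul0r//; apply/negP => /andP[x1 x2'].
  by move: x2; rewrite ger0_norm; lra.
have [yr|ry] := leP `|y| r.
  have rx : r < `|x| by move: rxy; rewrite (ltNge _ `|y|) yr orbF.
  have y2 : 2 < `|y| by move: xy2; rewrite (ltNge _ `|x|) x2.
  by have := lt_trans (lt_le_trans y2 yr) rx; rewrite ltNge x2.
rewrite (massE _ phir) (_ : Rintegral _ _ _ = 0) ?mulr0//.
rewrite -[RHS](Rint0 mu); apply: eq_Rint => s.
by rewrite phir// norm_pairE lt_max/= ry orbT.
Qed.

Lemma derive_xmul_rho_mass r phi p : is_test r phi ->
  'D_(dir true) (xmul (fun p => rho p.1 * mass r phi p)) p =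
   chi p.1 * 'D_(dir true) (mass r phi) p.
Proof.
move=> [sphi phir]; suff : is_derive p (dir true) (xmul (fun p => rho p.1 * mass r phi p))
  (chi p.1 * 'D_(dir true) (mass r phi) p) by case.
have d := (is_derive_move true _ _ _).1 (derivableP (smooth_derivable (smooth_mass r sphi) p true)).
apply/is_derive_move; have := is_deriveZ (chi p.1) d.
rewrite [X in is_derive _ _ X _](_ : _ =
  fun t => xmul (fun p => rho p.1 * mass r phi p) (move true p t))//.
by apply/funext => t; rewrite /xmul /= mulrA.
Qed.

(** The factor x in front of d/dy comes from chi = x rho. *)
Lemma test_decomposition r (phi : schwartz R) (tphi : is_test r phi) :
  let N := is_test_primy tphi in
  phi = sderive false (test_fun (is_test_prim tphi))
      + (sderive true (sxmul (test_fun (is_test_rho_mass N)))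
      + (\int[mu2]_q phi q)%R *: test_fun is_test_chi2).
Proof.
move=> N; apply/val_inj/funext => p /=.
have [_ dE] := is_derive_prim p tphi.
rewrite !fctE dE (derive_xmul_rho_mass p N) (mass_decomposition p tphi).
rewrite -[_ *: _]/(_ * _); ring.
Qed.

(** The transposes of the operators of the decomposition, applied to f and g. *)
Definition reconstruct f g (C : R) p : R :=
  kerop kap f p + (kerop kap (fun p => kerop (col rho) g (swap p)) (swap p) + C).

(** Evaluate v on the decomposition of a test function: the derivatives fall on v
as f and g, and duality moves the kernels from the test function to f and g. *)
Theorem represents_reconstruct v f g : L2loc_fun f -> L2loc_fun g ->
  represents f (tderive false v) -> represents g (txmul (tderive true v)) ->
  represents (reconstruct f g (v (test_fun is_test_chi2))) v.
Proof.
move=> f2 g2 fv gv phi /is_test_schwartz[r tphi].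
pose N := is_test_primy tphi.
set C := v (test_fun _).
have G2 : L2loc_fun (kerop (col rho) g) by apply: L2loc_kerop => //; exact: kernel_rho.
have H2 := L2loc_kerop kernel_kap (L2loc_swap G2).
have F2 := L2loc_kerop kernel_kap f2.
have [M hM] := test_bounded tphi.
have mphi := test_measurable tphi.
have phir := tphi.2.
have tphis := test_swap tphi.
have mphis := test_measurable tphis.
have hMs p : `|phi (swap p)| <= M by exact: hM.
have e1 : v (sderive false (test_fun (is_test_prim tphi))) =
    (\int[mu2]_p (kerop kap f p * phi p))%R.
  have := represents_test (is_test_prim tphi) fv.
  rewrite -[LHS]/(- _) => /(congr1 -%R); rewrite opprK => ->.
  rewrite (kerop_duality kernel_kap f2 mphi hM phir) -mulN1r -RintZ; last first.
    exact: locint_test (L2loc_locint f2) (is_test_prim tphi).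
  by apply: eq_Rint => p; rewrite /prim mulN1r mulrN opprK.
have e2 : v (sderive true (sxmul (test_fun (is_test_rho_mass N)))) =
    (\int[mu2]_p (kerop kap (fun p => kerop (col rho) g (swap p)) (swap p) * phi p))%R.
  have := represents_test (is_test_rho_mass N) gv.
  rewrite -[LHS]/(- _) => /(congr1 -%R); rewrite opprK => ->.
  have [B hB] := test_bounded N.
  transitivity (- (\int[mu2]_p (kerop (col rho) g p * primy phi p))%R).
    congr (- _); rewrite (kerop_duality kernel_rho g2 (test_measurable N) hB N.2).
    apply: eq_Rint => -[x y]; congr (_ * _); rewrite (massE _ N.2) /kerop /tr /col /=.
    rewrite RintZ//; apply: (@L1_smooth_slice _ _ (Num.max r 2) _ N.1) => s rs.
    by rewrite N.2// norm_pairE lt_max/= rs.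
  have kd := kerop_duality kernel_kap (L2loc_swap G2) mphis hMs tphis.2.
  have iL := locint_test (L2loc_locint H2) tphis.
  have iR := L1_mul_kerop_tr kernel_kap (L2loc_locint (L2loc_swap G2)) mphis hMs tphis.2.
  have := Rint_swap iL; have := Rint_swap iR; rewrite -kd => <-.
  rewrite -mulN1r -RintZ; last exact: locint_test (L2loc_locint G2) N.
  move=> sL; transitivity (\int[mu2]_p (kerop (col rho) g (swap (swap p)) * kerop (tr kap) (fun p => phi (swap p)) (swap p)))%R.
    by apply: eq_Rint => p; rewrite swapK /primy /prim mulN1r mulrN opprK.
  rewrite -sL; apply: eq_Rint => p; rewrite swapK//.
rewrite [in LHS](test_decomposition tphi) temperedD [X in _ + v X]addrC tempered_comb.
rewrite -/N e1 e2 -/C.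
have i1 := locint_test (L2loc_locint F2) tphi.
have i2 := locint_test (L2loc_locint (L2loc_swap H2)) tphi.
have i3 := test_L1 tphi.
rewrite mulrC -(RintZ C i3) addrA addrAC -addrA.
rewrite -(RintD i2 (L1Z C i3)) -(RintD i1 (L1D i2 (L1Z C i3))).
by apply: eq_Rint => p; rewrite /reconstruct !mulrDl.
Qed.

Lemma L2loc_reconstruct f g C : L2loc_fun f -> L2loc_fun g -> L2loc_fun (reconstruct f g C).
Proof.
move=> f2 g2.
have G2 : L2loc_fun (kerop (col rho) g) by apply: L2loc_kerop => //; exact: kernel_rho.
apply: L2locD; first exact: L2loc_kerop kernel_kap f2.
apply: L2locD; last exact: smooth_L2loc (smooth_cst C).
exact: L2loc_swap (L2loc_kerop kernel_kap (L2loc_swap G2)).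
Qed.

Lemma smooth_reconstruct f g C : smooth f -> smooth g -> smooth (reconstruct f g C).
Proof.
move=> sf sg; apply: smoothD; first exact: smooth_kerop_kap.
apply: smoothD; last exact: smooth_cst.
apply: smooth_swap; apply: smooth_kerop_kap; apply: smooth_swap.
by apply: smooth_kerop_col => //; exact: kernel_rho.
Qed.

End reconstruction.

(** * Polarized fields *)

Section polarization.
Context {R : realType}.
Notation mR := (measurableTypeR R).
Notation mu := (@lebesgue_measure R).
Notation mu2 := (mu \x mu)%E.
Implicit Types (f g h phi : R * R -> R) (v : tempered R) (l : 'cV[R]_2).

Lemma representsD f g (S T : tempered R) : locint f -> locint g ->
  represents f S -> represents g T -> represents (fun p => f p + g p) (S + T).
Proof.
move=> fi gi fS gT phi cphi; have [r tphi] := is_test_schwartz cphi.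
rewrite -[LHS]/(S phi + T phi) (fS _ cphi) (gT _ cphi).
rewrite -(RintD (locint_test fi tphi) (locint_test gi tphi)).
by apply: eq_Rint => p; rewrite mulrDl.
Qed.

Lemma representsZ (a : R) f (T : tempered R) : locint f ->
  represents f T -> represents (fun p => a * f p) (a *: T).
Proof.
move=> fi fT phi cphi; have [r tphi] := is_test_schwartz cphi.
rewrite -[LHS]/(a * T phi) (fT _ cphi) -(RintZ _ (locint_test fi tphi)).
by apply: eq_Rint => p; rewrite mulrA.
Qed.

Lemma unit_circle2 l : unit_circle l -> l 0 0 ^+ 2 + l 1 0 ^+ 2 = 1.
Proof. by rewrite /unit_circle /= big_ord_recl big_ord1 => <-; congr (_ + l _ _ ^+ 2); apply/val_inj. Qed.

(** With [polarized_xdy], the inverse of an orthogonal map. *)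
Lemma polarized_dx l v : unit_circle l ->
  tderive false v = l 0 0 *: opA (polarized l v) 0 0 + l 1 0 *: opA (polarized l v) 1 0.
Proof.
move=> /unit_circle2 l1; apply/val_inj/funext => phi.
rewrite !mxE /=.
transitivity (- v (sderive false phi)); first by [].
transitivity (l 0 0 * (- (l 0 0 * v (sderive false phi)) + - (l 1 0 * v (sderive true (sxmul phi))))
  + l 1 0 * (- - (l 0 0 * v (sderive true (sxmul phi))) + - (l 1 0 * v (sderive false phi)))); last first.
  reflexivity.
set X := v _; set Y := v _.
transitivity (- ((l 0 0 ^+ 2 + l 1 0 ^+ 2) * X)); first by rewrite l1 mul1r.
ring.
Qed.

Lemma polarized_xdy l v : unit_circle l ->
  txmul (tderive true v) = l 1 0 *: opA (polarized l v) 0 0 + - l 0 0 *: opA (polarized l v) 1 0.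
Proof.
move=> /unit_circle2 l1; apply/val_inj/funext => phi.
rewrite !mxE /=.
transitivity (- v (sderive true (sxmul phi))); first by [].
transitivity (l 1 0 * (- (l 0 0 * v (sderive false phi)) + - (l 1 0 * v (sderive true (sxmul phi))))
  + - l 0 0 * (- - (l 0 0 * v (sderive true (sxmul phi))) + - (l 1 0 * v (sderive false phi)))); last first.
  reflexivity.
set X := v (sderive false phi); set Y := v _.
transitivity (- ((l 0 0 ^+ 2 + l 1 0 ^+ 2) * Y)); first by rewrite l1 mul1r.
ring.
Qed.

Lemma polarized_L2loc l v : unit_circle l -> L2loc (opA (polarized l v)) ->
  exists2 h, L2loc_fun h & represents h v.
Proof.
move=> ul A2; have [a a2 aA] := A2 0; have [b b2 bA] := A2 1.
have ai := L2loc_locint a2; have bi := L2loc_locint b2.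
have f2 := L2locD (L2locZ (l 0 0) a2) (L2locZ (l 1 0) b2).
have g2 := L2locD (L2locZ (l 1 0) a2) (L2locZ (- l 0 0) b2).
have li (c : R) h : L2loc_fun h -> locint (fun p => c * h p).
  by move=> h2; apply: L2loc_locint; exact: L2locZ.
have fv := representsD (li (l 0 0) _ a2) (li (l 1 0) _ b2) (representsZ (l 0 0) ai aA) (representsZ (l 1 0) bi bA).
have gv := representsD (li (l 1 0) _ a2) (li (- l 0 0) _ b2) (representsZ (l 1 0) ai aA) (representsZ (- l 0 0) bi bA).
rewrite -polarized_dx// in fv; rewrite -polarized_xdy// in gv.
by have := represents_reconstruct f2 g2 fv gv; eexists; last eassumption; exact: L2loc_reconstruct.
Qed.

Lemma polarized_smooth l v : unit_circle l -> Cinfty (opA (polarized l v)) ->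
  exists2 h, smooth h & represents h v.
Proof.
move=> ul As; have [a sa aA] := As 0; have [b sb bA] := As 1.
have a2 := smooth_L2loc sa; have b2 := smooth_L2loc sb.
have ai := L2loc_locint a2; have bi := L2loc_locint b2.
have f2 := smoothD (smoothZ (l 0 0) sa) (smoothZ (l 1 0) sb).
have g2 := smoothD (smoothZ (l 1 0) sa) (smoothZ (- l 0 0) sb).
have li (c : R) h : L2loc_fun h -> locint (fun p => c * h p).
  by move=> h2; apply: L2loc_locint; exact: L2locZ.
have fv := representsD (li (l 0 0) _ a2) (li (l 1 0) _ b2) (representsZ (l 0 0) ai aA) (representsZ (l 1 0) bi bA).
have gv := representsD (li (l 1 0) _ a2) (li (- l 0 0) _ b2) (representsZ (l 1 0) ai aA) (representsZ (- l 0 0) bi bA).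
rewrite -polarized_dx// in fv; rewrite -polarized_xdy// in gv.
have := represents_reconstruct (smooth_L2loc f2) (smooth_L2loc g2) fv gv.
by eexists; last eassumption; exact: smooth_reconstruct.
Qed.

Lemma L2loc_polarized l v h : L2loc_fun h -> represents h v -> L2loc (polarized l v).
Proof.
move=> h2 hv i; exists (fun p => l i 0 * h p); first exact: L2locZ.
by rewrite mxE; apply: representsZ hv; exact: L2loc_locint.
Qed.

Lemma Cinfty_polarized l v h : smooth h -> represents h v -> Cinfty (polarized l v).
Proof.
move=> sh hv i; exists (fun p => l i 0 * h p); first exact: smoothZ.
by rewrite mxE; apply: representsZ hv; apply: L2loc_locint; exact: smooth_L2loc.
Qed.

Lemma hypoelliptic_opAl l : unit_circle l -> hypoelliptic (opAl l).
Proof.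
move=> ul w Aw i; have [h sh hv] := polarized_smooth ul Aw.
by exists h => //; rewrite (ord1 i).
Qed.

End polarization.

(** * Poisson kernels *)

Section poisson_slices.
Context {R : realType}.
Notation mR := (measurableTypeR R).
Notation mu := (@lebesgue_measure R).
Notation mu2 := (mu \x mu)%E.
Implicit Types (f g h phi w : R * R -> R) (p : R * R) (c r M x y s t : R).

Lemma measurable_invr : measurable_fun [set: mR] (fun x : mR => (x : R)^-1).
Proof.
rewrite -(setvU [set (0 : mR)]); apply/measurable_funU => //.
- exact: measurableC.
split; last exact: measurable_fun_set1.
rewrite (_ : ~` [set 0] = [set x : R | x != 0]); last first.
  by apply/seteqP; split => x /= /eqP.
apply: open_continuous_measurable_fun; first exact: open_neq.
by move=> x /set_mem /= x0; exact: inv_continuous.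
Qed.

Lemma measurable_fun_inv d (T : measurableType d) (a : T -> R) :
  measurable_fun [set: T] a -> measurable_fun [set: T] (fun z => (a z)^-1).
Proof. exact: (measurableT_comp measurable_invr). Qed.

(** Its integral in y is pi for every width c > 0, so c may depend on x without
affecting integrability in the plane. *)
Definition poisson c y : R := c / (c ^+ 2 + y ^+ 2).

Lemma poisson_ge0 c y : 0 <= c -> 0 <= poisson c y.
Proof. by move=> c0; rewrite divr_ge0// addr_ge0// sqr_ge0. Qed.

Lemma poisson0 y : poisson 0 y = 0.
Proof. by rewrite /poisson mul0r. Qed.

Lemma integral_poisson c : 0 < c -> (\int[mu]_y (poisson c y)%:E = pi%:E)%E.
Proof.
move=> c0.
have den y : 0 < c ^+ 2 + y ^+ 2 by rewrite ltr_pwDl ?exprn_gt0// sqr_ge0.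
have cp : continuous (poisson c).
  move=> y; apply: cvgM; first exact: cvg_cst.
  apply: cvgV; first by rewrite gt_eqF.
  by apply: cvgD; [exact: cvg_cst|exact: exprn_continuous].
have dF (y : R) : is_derive y (1 : R) (fun y => atan (y / c)) (poisson c y).
  have dl : is_derive y (1 : R) (fun y : R => y / c) c^-1.
    have := is_deriveZ c^-1 (is_derive_id y (1 : R)).
    rewrite [X in is_derive _ _ X _](_ : _ = fun y => y / c); last first.
      by apply/funext => z; rewrite mulrC.
    by move/is_derive_eq; apply; rewrite [LHS]mulr1.
  have := @is_derive1_comp R atan (fun y => y / c) y _ _ (is_derive1_atan (y / c)) dl.
  move/is_derive_eq; apply; rewrite /poisson.
  have cn : c != 0 by rewrite gt_eqF.
  have -> : c ^+ 2 + y ^+ 2 = (1 + (y / c) ^+ 2) * c * c by field.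
  by rewrite [in RHS]invfM mulrCA divff// mulr1 invfM.
rewrite ge0_symfun_integralT//; last first.
- by move=> y /=; rewrite /poisson sqrrN.
- by move=> y; apply: poisson_ge0; exact: ltW.
rewrite -set_itvcy (ge0_continuous_FTC2y (F := fun y => atan (y / c)) (l := pi / 2)).
- by rewrite mul0r atan0 sube0 -EFinM; congr EFin; field.
- by move=> y _; apply: poisson_ge0; exact: ltW.
- exact: continuous_subspaceT.
- apply: (cvg_comp (fun y => y / c) atan); last exact: cvgy_atan.
  by apply: gt0_cvgMly; [rewrite invr_gt0|exact: cvg_id].
- by move=> x _; have [] := dF x.
- apply: cvg_at_right_filter; apply: differentiable_continuous.
  by apply/derivable1_diffP; have [] := dF 0.
- by move=> x _; rewrite derive1E; have [_ ->] := dF x.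
Qed.

Definition omega t : R := poisson 1 t.

Lemma omega_ge0 t : 0 <= omega t.
Proof. exact: poisson_ge0. Qed.

Lemma omega_le1 t : omega t <= 1.
Proof. by rewrite /omega /poisson div1r invf_le1 ?expr1n ?ltr_pwDl ?sqr_ge0// lerDl sqr_ge0. Qed.

Lemma measurable_poisson (c : R -> R) : measurable_fun [set: mR] c ->
  measurable_fun [set: mR * mR] (fun p => poisson (c p.1) p.2).
Proof.
move=> mc.
have mc1 : measurable_fun [set: mR * mR] (fun p : mR * mR => c p.1).
  exact: (measurableT_comp mc measurable_fst).
apply: measurable_funM => //; apply: measurable_fun_inv; apply: measurable_funD.
  exact: measurable_funX.
by apply: measurable_funX; exact: measurable_snd.
Qed.

Lemma measurable_omega : measurable_fun [set: mR] omega.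
Proof. exact: (measurable_slice2 0 (measurable_poisson (@measurable_cst _ _ mR mR setT (1 : R)))). Qed.

Lemma L1_omega : L1 mu omega.
Proof.
apply/integrableP; split; first by apply/measurable_EFinP; exact: measurable_omega.
under eq_integral do rewrite /= ger0_norm ?omega_ge0//.
by rewrite integral_poisson// ltry.
Qed.

Lemma L1_omega2 : L1 mu2 (fun p => omega p.1 * omega p.2).
Proof. exact: L1_tensor L1_omega L1_omega. Qed.

(** Tonelli's theorem: each vertical slice has mass pi (or 0 when c vanishes). *)
Lemma L1_weighted_poisson (a c : R -> R) : L1 mu a -> (forall x, 0 <= a x) ->
  measurable_fun [set: mR] c -> (forall x, 0 <= c x) ->
  L1 mu2 (fun p => a p.1 * poisson (c p.1) p.2).
Proof.
move=> ia a0 mc c0.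
have ma := L1_measurable ia.
have mS := measurable_poisson mc.
have slice x : (\int[mu]_y (poisson (c x) y)%:E <= pi%:E)%E.
  have := c0 x; rewrite le_eqVlt => /orP[/eqP <-|cx]; last by rewrite integral_poisson.
  under eq_integral do rewrite poisson0.
  by rewrite integral0 lee_fin pi_ge0.
apply/integrable12ltyP.
  apply/measurable_EFinP; apply: measurable_funM => //.
  exact: (measurableT_comp ma measurable_fst).
apply: (@le_lt_trans _ _ (\int[mu]_x ((a x)%:E * pi%:E))%E); last first.
  rewrite ge0_integralZr//; last 3 first.
  - exact/measurable_EFinP.
  - by move=> x _; rewrite lee_fin.
  - by rewrite lee_fin pi_ge0.
  by rewrite (L1_EFin ia) -EFinM ltry.
apply: ge0_le_integral => //.
- by move=> x _; exact: integral_ge0.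
- have mF : measurable_fun [set: mR]
      (fubini_F mu (fun p : mR * mR => `|(a p.1 * poisson (c p.1) p.2)%:E|)%E).
    apply: measurable_fun_fubini_tonelli_F => //.
    apply: measurableT_comp => //; apply/measurable_EFinP; apply: measurable_funM => //.
    exact: (measurableT_comp ma measurable_fst).
  exact: mF.
- apply: emeasurable_funM => //; exact/measurable_EFinP.
move=> x _ /=.
under eq_integral => y _ do rewrite (ger0_norm (mulr_ge0 (a0 x) (poisson_ge0 y (c0 x)))) EFinM.
rewrite ge0_integralZl ?lee_fin//; last 2 first.
- by apply/measurable_EFinP; exact: (measurable_slice2 x mS).
- by move=> y _; rewrite lee_fin poisson_ge0.
by rewrite lee_wpmul2l// lee_fin.
Qed.

Lemma L1_omega_poisson (c : R -> R) : measurable_fun [set: mR] c -> (forall x, 0 <= c x) ->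
  L1 mu2 (fun p => omega p.1 * poisson (c p.1) p.2).
Proof. by apply: L1_weighted_poisson; [exact: L1_omega|exact: omega_ge0]. Qed.

End poisson_slices.

(** * Integration by parts against Schwartz functions *)

Section integration_by_parts.
Context {R : realType}.
Notation mR := (measurableTypeR R).
Notation mu := (@lebesgue_measure R).
Notation mu2 := (mu \x mu)%E.
Implicit Types (f g h phi w : R * R -> R) (p : R * R) (c r M K x y s t : R).

(** The integral over [- N, N] is F N - F (- N), which is O(1/N^2). *)
Lemma Rint_derivative_eq0 (F F' : R -> R) K :
  (forall x : R, is_derive x 1 F (F' x)) -> continuous F' -> L1 mu F' ->
  (forall x, `|F x| <= K * omega x) -> (\int[mu]_x F' x = 0)%R.
Proof.
move=> dF cF' iF' FK.
have K0 : 0 <= K.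
  have := le_trans (normr_ge0 _) (FK 0).
  by rewrite /omega /poisson expr1n expr0n addr0 divr1 mulr1.
have cF x : {for x, continuous F}.
  by apply/differentiable_continuous/derivable1_diffP; have [] := dF x.
pose I n := (\int[mu]_x (\1_`[- n.+1%:R, n.+1%:R] x * F' x))%R.
have IE n : I n = F n.+1%:R - F (- n.+1%:R).
  rewrite /I; set N : R := n.+1%:R.
  have N0 : - N < N by rewrite gtrN ?ltr0n.
  transitivity (\int[mu]_(x in `[- N, N]) F' x)%R.
    rewrite [RHS]Rintegral_mkcond (_ : F' \_ `[- N, N] = fun x => \1_`[- N, N] x * F' x)//.
    by apply/funext => x; rewrite patchE indicE; case: ifP; rewrite ?mul1r ?mul0r.
  rewrite /Rintegral (@continuous_FTC2 R F' F (- N) N)//.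
  - exact: continuous_subspaceT.
  - split => [x _||]; first by have [] := dF x.
      by apply: cvg_at_right_filter; exact: cF.
    by apply: cvg_at_left_filter; exact: cF.
  - by move=> x _; rewrite derive1E; have [_ ->] := dF x.
have I1 : I n @[n --> \oo] --> (\int[mu]_x F' x)%R.
  have : (\int[mu]_x (\1_`[- n.+1%:R, n.+1%:R] x * F' x)%:E)%E @[n --> \oo] --> (\int[mu]_x (F' x)%:E)%E.
    apply: (@dominated_cvg _ _ _ mu setT _
      (fun n x => (\1_`[- n.+1%:R, n.+1%:R] x * F' x)%:E) _ (fun x => (`|F' x|)%:E)) => //.
    - by move=> n; apply/measurable_EFinP; apply: L1_measurable (L1_continuous_itv _ _ cF').
    - move=> x _; apply: cvg_EFin; first exact: nearW.
      apply: cvg_near_cst; near=> n; rewrite /= indic_itvE ifT ?mul1r//.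
      apply: (@le_trans _ _ n%:R); last by rewrite ler_nat.
      by near: n; exact: nbhs_infty_ger.
    - exact: L1_norm.
    - move=> n x _; rewrite lee_fin indic_itvE; case: ifP => _; rewrite ?mul1r// mul0r normr0//.
  by rewrite (L1_EFin iF') => /fine_cvgP[_]; apply.
have I0 : I n @[n --> \oo] --> (0 : R).
  apply/cvgrPdist_le => e e0; near=> n.
  rewrite sub0r normrN IE (le_trans (ler_normB _ _))//.
  have b (x : R) : `|x| = n.+1%:R -> `|F x| <= K / n.+1%:R.
    move=> xn; apply: le_trans (FK x) _; rewrite ler_wpM2l// /omega /poisson div1r expr1n.
    have n0 : (0 : R) < n.+1%:R by rewrite ltr0n.
    rewrite lef_pV2 ?posrE// ?ltr_pwDl ?sqr_ge0//.
    rewrite -(ger0_norm (sqr_ge0 x)) normrX xn -natrX nat1r ler_nat.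
    by rewrite (leq_trans _ (leqnSn _))// -mulnn leq_pmulr.
  apply: (@le_trans _ _ (K / n.+1%:R + K / n.+1%:R)).
    by rewrite lerD// b// ?normrN ger0_norm.
  rewrite -mulrDl ler_pdivrMr ?ltr0n// -ler_pdivrMl//.
  near: n; exists (Num.bound (e^-1 * (K + K))) => // m /= Bm.
  have := archi_boundP (_ : 0 <= e^-1 * (K + K)).
  rewrite mulr_ge0 ?invr_ge0 ?addr_ge0 ?(ltW e0)// => /(_ isT)/ltW h.
  by rewrite (le_trans h)// ler_nat (leq_trans Bm).
exact: cvg_unique I1 I0.
Unshelve. all: by end_near. Qed.

(** Decay in each variable separately, so that it can be used on lines. *)
Definition decay K phi := forall p, `|phi p| <= K * (omega p.1 * omega p.2).

(** (1 + |p|)^4 dominates (1 + x^2)(1 + y^2). *)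
Lemma schwartz_decay (phi : R * R -> R) : is_schwartz phi -> decay (seminorm 4 phi) phi.
Proof.
move=> [sphi dphi] [x y]; have := weighted_seminorm (x, y) dphi (isT : (size ([::] : seq bool) <= 4)%N).
rewrite /weighted /= => h; apply: le_trans (_ : (1 + `|(x, y)|) ^+ 4 * `|phi (x, y)| * (omega x * omega y) <= _); last first.
  by rewrite ler_wpM2r// mulr_ge0// omega_ge0.
rewrite mulrAC ler_peMl// /omega /poisson !div1r expr1n -invfM.
have d (t : R) : 0 < 1 + t ^+ 2 by rewrite ltr_pwDl ?sqr_ge0.
rewrite ler_pdivlMr ?mulr_gt0// mul1r.
have sq (t : R) : `|t| <= `|(x, y)| -> 1 + t ^+ 2 <= (1 + `|(x, y)|) ^+ 2.
  move=> th; rewrite -(ger0_norm (sqr_ge0 t)) normrX; have := normr_ge0 t; nra.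
rewrite (_ : 4 = 2 + 2)%N// exprD; apply: ler_pM; [exact: (ltW (d x))|exact: (ltW (d y))| |].
  by apply: sq; rewrite norm_pairE le_max lexx.
by apply: sq; rewrite norm_pairE le_max lexx orbT.
Qed.

Lemma L1_decay K w phi M : measurable_fun [set: mR * mR] w -> (forall p, `|w p| <= M) ->
  measurable_fun [set: mR * mR] phi -> decay K phi -> L1 mu2 (fun p => w p * phi p).
Proof.
move=> mw wM mphi dphi; apply: (L1_bounded mw wM).
by apply: L1_dom mphi (L1Z K L1_omega2) dphi.
Qed.

(** Almost every horizontal line avoids the singularities of w; on such a line
w phi has an integrable derivative and vanishes at infinity. *)
Lemma Rint_by_parts1 w w' phi M K K' :
  measurable_fun [set: mR * mR] w -> (forall p, `|w p| <= M) ->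
  (forall p, p.2 != 0 -> is_derive p (dir false) w (w' p)) ->
  (forall y, y != 0 -> continuous (fun x => w' (x, y))) ->
  smooth phi -> decay K phi -> decay K' ('D_(dir false) phi) ->
  L1 mu2 (fun p => w' p * phi p) ->
  (\int[mu2]_p (w p * 'D_(dir false) phi p) = - \int[mu2]_p (w' p * phi p))%R.
Proof.
move=> mw wM dw cw' sphi dphi ddphi iw'.
have sd := smooth_derive false sphi.
have iw := L1_decay mw wM (smooth_measurable sd) ddphi.
apply/eqP; rewrite -subr_eq0 opprK -(RintD iw iw') (Rfubini2 (L1D iw iw')) -(Rint0 mu).
apply/eqP; apply: ae_eq_Rint => //.
  exact: (measurable_Rint2 (L1_measurable (L1D iw iw'))).
have M0 : 0 <= M := le_trans (normr_ge0 _) (wM 0).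
have ne0 : {ae mu, forall y : mR, y != 0 :> R}.
  exists [set 0]; split; [exact: measurable_set1|exact: lebesgue_measure_set1|].
  by move=> y /= /negP; rewrite negbK => /eqP.
have isl := ae_integrable2 (L1D iw iw').
near=> y.
have y0 : y != 0 :> R by near: y.
have iy : L1 mu (fun x => w (x, y) * 'D_(dir false) phi (x, y) + w' (x, y) * phi (x, y)).
  by near: y; exact: isl.
have dwx x := (is_derive_move false _ (x, y) _).1 (dw (x, y) y0).
have dphix x := (is_derive_move false _ (x, y) _).1 (derivableP (smooth_derivable sphi (x, y) false)).
apply: (@Rint_derivative_eq0 (fun x => w (x, y) * phi (x, y)) _ (M * K)) => //.
- move=> x; have := is_deriveM (dwx x) (dphix x).
  rewrite [X in is_derive _ _ X _](_ : _ = fun x => w (x, y) * phi (x, y))//.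
  by move/is_derive_eq; apply => /=; congr (_ + _); exact: mulrC.
- have cw : continuous (fun x => w (x, y)).
    move=> x; apply/differentiable_continuous/derivable1_diffP.
    by have [] := dwx x.
  move=> x; apply: cvgD; apply: cvgM.
  + exact: cw.
  + exact: (smooth_slice_continuous sd).
  + exact: cw'.
  + exact: (smooth_slice_continuous sphi).
- move=> x; rewrite normrM -mulrA ler_pM//.
  apply: le_trans (dphi (x, y)) _.
  have K0 : 0 <= K.
    have := le_trans (normr_ge0 _) (dphi 0).
    by rewrite /omega /poisson /= expr1n expr0n addr0 divr1 !mulr1.
  by rewrite ler_wpM2l// ler_piMr ?omega_ge0 ?omega_le1.
Unshelve. all: by end_near. Qed.

Lemma decay_swap K phi : decay K phi -> decay K (fun p => phi (swap p)).
Proof. by move=> dphi p; have := dphi (swap p); rewrite /= (mulrC (omega p.2)). Qed.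

Lemma Rint_by_parts2 w w' phi M K K' :
  measurable_fun [set: mR * mR] w -> (forall p, `|w p| <= M) ->
  (forall p, p.1 != 0 -> is_derive p (dir true) w (w' p)) ->
  (forall x, x != 0 -> continuous (fun y => w' (x, y))) ->
  smooth phi -> decay K phi -> decay K' ('D_(dir true) phi) ->
  L1 mu2 (fun p => w' p * phi p) ->
  (\int[mu2]_p (w p * 'D_(dir true) phi p) = - \int[mu2]_p (w' p * phi p))%R.
Proof.
move=> mw wM dw cw' sphi dphi ddphi iw'.
have iw := L1_decay mw wM (smooth_measurable (smooth_derive true sphi)) ddphi.
rewrite -(Rint_swap iw) -(Rint_swap iw').
transitivity (\int[mu2]_p (w (swap p) * 'D_(dir false) (fun p => phi (swap p)) p))%R.
  by apply: eq_Rint => p; rewrite (derive_swap false p sphi).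
apply: (@Rint_by_parts1 (fun p => w (swap p)) (fun p => w' (swap p)) (fun p => phi (swap p)) M K K').
- exact: measurable_fun_swap.
- by move=> p; exact: wM.
- by move=> p p0; apply: is_derive_swap; exact: dw.
- by move=> y y0; exact: cw'.
- exact: smooth_swap.
- exact: decay_swap.
- rewrite (_ : 'D_(dir false) _ = fun p => 'D_(dir true) phi (swap p)).
    exact: (decay_swap ddphi).
  by apply/funext => p; rewrite (derive_swap false p sphi).
- exact: (L1_swap iw').
Qed.

End integration_by_parts.

(** * Bounded functions as tempered distributions *)

Section bounded_distributions.
Context {R : realType}.
Notation mR := (measurableTypeR R).
Notation mu := (@lebesgue_measure R).
Notation mu2 := (mu \x mu)%E.
Implicit Types (f g h w : R * R -> R) (p : R * R) (c r M K x y s t : R).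

Lemma schwartz_measurable (phi : schwartz R) : measurable_fun [set: mR * mR] phi.
Proof. by apply: smooth_measurable; have [] := schwartzP phi. Qed.

Lemma L1_bounded_schwartz w M (phi : schwartz R) : measurable_fun [set: mR * mR] w ->
  (forall p, `|w p| <= M) -> L1 mu2 (fun p => w p * phi p).
Proof.
move=> mw wM.
exact: (L1_decay mw wM (schwartz_measurable phi) (schwartz_decay (schwartzP phi))).
Qed.

Lemma bounded_tempered_subproof w M : measurable_fun [set: mR * mR] w ->
  (forall p, `|w p| <= M) ->
  (fun phi : schwartz R => (\int[mu2]_p (w p * phi p))%R : R^o) \in @tempered_pred R.
Proof.
move=> mw wM; apply/tempered_predP; split.
  move=> a S1 S2; have i1 := L1_bounded_schwartz S1 mw wM; have i2 := L1_bounded_schwartz S2 mw wM.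
  transitivity (a * (\int[mu2]_p (w p * S1 p))%R + (\int[mu2]_p (w p * S2 p))%R); last by [].
  rewrite -(RintZ _ i1) -(RintD (L1Z a i1) i2).
  by apply: eq_Rint => p; rewrite -[(a *: S1 + S2) p]/(a * S1 p + S2 p); ring.
exists 4%N, (M * (\int[mu2]_p (omega p.1 * omega p.2))%R) => phi.
have i1 := L1_bounded_schwartz phi mw wM.
apply: le_trans (normr_Rint i1) _.
rewrite mulrAC -(RintZ _ (@L1_omega2 R)); apply: le_Rint.
- exact: L1_norm i1.
- exact: L1Z L1_omega2.
move=> p; rewrite normrM -mulrA ler_pM//.
exact: schwartz_decay (schwartzP phi) p.
Qed.

Definition tbounded w M (mw : measurable_fun [set: mR * mR] w)
  (wM : forall p, `|w p| <= M) : tempered R := Tempered (bounded_tempered_subproof mw wM).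

(** A growth condition ensuring integrability against Schwartz functions. *)
Definition moderate g := measurable_fun [set: mR * mR] g /\
  exists A, exists B, exists c : R -> R, [/\ measurable_fun [set: mR] c, forall x, 0 <= c x &
    forall p, `|g p| <= A + B * poisson (c p.1) p.2].

(** phi is dominated by omega x omega, and the second omega may be dropped against
the Poisson kernel. *)
Lemma moderate_L1 g (phi : schwartz R) : moderate g -> L1 mu2 (fun p => g p * phi p).
Proof.
move=> [mg [A [B [c [mc c0 gb]]]]].
have dphi := schwartz_decay (schwartzP phi).
set K := seminorm 4 phi in dphi.
have i1 : L1 mu2 (fun p => `|A| * K * (omega p.1 * omega p.2) + `|B| * K * (omega p.1 * poisson (c p.1) p.2)).
  by apply: L1D; apply: L1Z; [exact: L1_omega2|exact: L1_omega_poisson].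
apply: L1_dom i1 _; first by apply: measurable_funM => //; exact: schwartz_measurable.
move=> p; rewrite normrM.
have K0 : 0 <= K by apply: seminorm_ge0; have [] := schwartzP phi.
have P0 : 0 <= poisson (c p.1) p.2 by exact: poisson_ge0.
apply: (@le_trans _ _ ((`|A| + `|B| * poisson (c p.1) p.2) * (K * (omega p.1 * omega p.2)))).
  apply: ler_pM; [by []|by []| |exact: dphi].
  by apply: le_trans (gb p) _; rewrite lerD ?ler_norm// ler_wpM2r// ler_norm.
rewrite mulrDl; apply: lerD; first by rewrite -!mulrA.
rewrite (_ : _ * _ = (`|B| * K * (omega p.1 * poisson (c p.1) p.2)) * omega p.2); last by ring.
rewrite ler_piMr ?omega_le1//; apply: mulr_ge0; first exact: mulr_ge0.
by apply: mulr_ge0; [exact: omega_ge0|].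
Qed.

Lemma tbounded_dx w M mw wM w' (phi : schwartz R) :
  (forall p, p.2 != 0 -> is_derive p (dir false) w (w' p)) ->
  (forall y, y != 0 -> continuous (fun x => w' (x, y))) -> moderate w' ->
  tderive false (@tbounded w M mw wM) phi = (\int[mu2]_p (w' p * phi p))%R.
Proof.
move=> dw cw' mod; have sp := schwartzP phi.
rewrite -[LHS]/(- (\int[mu2]_p (w p * 'D_(dir false) phi p))%R).
rewrite (Rint_by_parts1 mw wM dw cw' sp.1 (schwartz_decay sp)
  (schwartz_decay (is_schwartz_derive false sp))) ?opprK//.
exact: moderate_L1.
Qed.

Lemma tbounded_xdy w M mw wM w' (phi : schwartz R) :
  (forall p, p.1 != 0 -> is_derive p (dir true) w (w' p)) ->
  (forall x, x != 0 -> continuous (fun y => w' (x, y))) ->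
  moderate (fun p => p.1 * w' p) ->
  txmul (tderive true (@tbounded w M mw wM)) phi = (\int[mu2]_p (p.1 * w' p * phi p))%R.
Proof.
move=> dw cw' mod; have sp := schwartzP (sxmul phi).
rewrite -[LHS]/(- (\int[mu2]_p (w p * 'D_(dir true) (sxmul phi) p))%R).
have E : (fun p : R * R => w' p * sxmul phi p) = (fun p => p.1 * w' p * phi p).
  by apply/funext => p; rewrite /= /xmul; ring.
rewrite (Rint_by_parts2 mw wM dw cw' sp.1 (schwartz_decay sp)
  (schwartz_decay (is_schwartz_derive true sp))) ?E ?opprK//.
exact: moderate_L1.
Qed.

Lemma poisson_L2loc g B (c : R -> R) : measurable_fun [set: mR * mR] g ->
  measurable_fun [set: mR] c -> (forall x, 0 <= c x) -> 0 <= B ->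
  (forall p, g p ^+ 2 <= B * poisson (c p.1) p.2) -> L2loc_fun g.
Proof.
move=> mg mc c0 B0 gb; apply/L2loc_funP; split=> // r.
have i1 : L1 mu2 (fun p => B * (box r p.1 * poisson (c p.1) p.2)).
  apply: L1Z; apply: L1_weighted_poisson => //; first exact: L1_itv.
apply: L1_dom i1 _.
  by apply: measurable_funM; [exact: measurable_fun_cball|exact: measurable_funX].
move=> p; rewrite cball_indicE norm_pair_le /box indic_itvE.
case: (`|p.1| <= r) => /=; last by rewrite !mul0r normr0 mulr0.
rewrite mul1r; case: ifP => _; last by rewrite mul0r normr0 mulr_ge0// poisson_ge0.
by rewrite mul1r ger0_norm ?sqr_ge0.
Qed.

Definition bump2 (u1 v1 u2 v2 : R) p := bump u1 v1 p.1 * bump u2 v2 p.2.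

Lemma smooth_bump2 u1 v1 u2 v2 : smooth (bump2 u1 v1 u2 v2).
Proof. by apply: smoothM; [exact: (smooth_bump false)|exact: (smooth_bump true)]. Qed.

Lemma bump2_ge0 u1 v1 u2 v2 p : 0 <= bump2 u1 v1 u2 v2 p.
Proof. by rewrite mulr_ge0// bump_ge0. Qed.

Lemma bump2_le1 u1 v1 u2 v2 p : bump2 u1 v1 u2 v2 p <= 1.
Proof. by rewrite mulr_ile1 ?bump_ge0 ?bump_le1. Qed.

Lemma bump2_support u1 v1 u2 v2 p : u1 < v1 -> u2 < v2 ->
  bump2 u1 v1 u2 v2 p = 0 \/ (u1 < p.1 < v1) && (u2 < p.2 < v2).
Proof.
move=> uv1 uv2; rewrite /bump2.
have [h1|/(bump_eq0 uv1) ->] := boolP (u1 < p.1 < v1); last by rewrite mul0r; left.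
have [h2|/(bump_eq0 uv2) ->] := boolP (u2 < p.2 < v2); last by rewrite mulr0; left.
by right.
Qed.

Lemma is_test_bump2 u1 v1 u2 v2 : u1 < v1 -> u2 < v2 ->
  exists r, is_test r (bump2 u1 v1 u2 v2).
Proof.
move=> uv1 uv2; exists (`|u1| + `|v1| + `|u2| + `|v2|); split; first exact: smooth_bump2.
move=> p; case: (bump2_support p uv1 uv2) => // /andP[/andP[a1 b1] /andP[a2 b2]].
rewrite ltNge norm_pair_le => /negP; case.
have := ler_norm u1; have := ler_norm (- u1); have := ler_norm v1; have := ler_norm (- v1).
have := ler_norm u2; have := ler_norm (- u2); have := ler_norm v2; have := ler_norm (- v2).
rewrite !normrN => *; apply/andP; split; rewrite ler_norml; apply/andP; split; lra.
Qed.

Lemma L1_bump u v : u < v -> L1 mu (bump u v).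
Proof.
move=> uv; apply: (@L1_bounded_support _ _ (`|u| + `|v|) 1) => [|x|x].
- exact: measurable_bump.
- by rewrite ger0_norm ?bump_ge0 ?bump_le1.
- move=> h; apply: bump_eq0 => //; apply/negP => /andP[ux xv].
  have := ler_norm (- u); have := ler_norm v; have := normr_ge0 u; have := normr_ge0 v.
  rewrite normrN => ? ? ? ?; move: h; apply/negP; rewrite -leNgt ler_norml; apply/andP; split; lra.
Qed.

Lemma Rint_bump_ge u v : u < v -> expR (- 8) * ((v - u) / 2) <= (\int[mu]_x bump u v x)%R.
Proof.
move=> uv.
have E : (v - u) / 2 = (v - (v - u) / 4) - (u + (v - u) / 4) by field.
rewrite E -Rint_segment; last by lra.
rewrite -RintZ; last exact: L1_itv.
apply: le_Rint; [by apply: L1Z; exact: L1_itv|exact: L1_bump|] => x.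
rewrite indicE mem_setE in_itv/=; case: (boolP (_ && _)) => h; last by rewrite mulr0 bump_ge0.
by rewrite mulr1 bump_ge.
Qed.

Lemma Rint_bump2_ge u1 v1 u2 v2 : u1 < v1 -> u2 < v2 ->
  expR (- 8) ^+ 2 * ((v1 - u1) * (v2 - u2) / 4) <= (\int[mu2]_p bump2 u1 v1 u2 v2 p)%R.
Proof.
move=> uv1 uv2; rewrite (Rint_tensor (L1_bump uv1) (L1_bump uv2)).
rewrite (_ : _ * _ = (expR (- 8) * ((v1 - u1) / 2)) * (expR (- 8) * ((v2 - u2) / 2))); last by field.
by apply: ler_pM; rewrite ?Rint_bump_ge// mulr_ge0 ?expR_ge0// divr_ge0// subr_ge0 ltW.
Qed.

(** A bump supported in a small box around p. *)
Lemma locint_positive g p (d : R) : locint g -> 0 < d -> (\forall q \near p, d <= g q) ->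
  exists r, exists phi, is_test r phi /\ (0 < \int[mu2]_q (g q * phi q))%R.
Proof.
move=> gi d0 /nbhs_ballP[e /= e0 he].
have u1 : p.1 - e < p.1 + e by lra.
have u2 : p.2 - e < p.2 + e by lra.
have [r tb] := is_test_bump2 u1 u2.
exists r, (bump2 (p.1 - e) (p.1 + e) (p.2 - e) (p.2 + e)); split => //.
have ib := test_L1 tb; have ig := locint_test gi tb.
apply: (@lt_le_trans _ _ (d * \int[mu2]_q bump2 (p.1 - e) (p.1 + e) (p.2 - e) (p.2 + e) q)%R).
  rewrite mulr_gt0//; apply: lt_le_trans (Rint_bump2_ge u1 u2).
  by rewrite mulr_gt0 ?exprn_gt0 ?expR_gt0// divr_gt0// mulr_gt0// subr_gt0.
rewrite -(RintZ _ ib); apply: le_Rint => //; first exact: L1Z.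
move=> q; case: (bump2_support q u1 u2) => [->|/andP[/andP[a1 b1] /andP[a2 b2]]].
  by rewrite !mulr0.
rewrite ler_wpM2r ?bump2_ge0//; apply: he; split; rewrite /ball /= ltr_norml; apply/andP; split; lra.
Qed.

(** A representative is determined wherever it is continuous: near a point where
two of them differ, a small bump would separate them. *)
Lemma represents_unique_at h w (T : tempered R) p : locint h -> locint w ->
  represents h T -> represents w T ->
  {for p, continuous h} -> {for p, continuous w} -> h p = w p.
Proof.
move=> hi wi hT wT ch cw.
have main f g : locint f -> locint g -> represents f T -> represents g T ->
    {for p, continuous f} -> {for p, continuous g} -> f p < g p -> False.
  move=> fi gi fT gT cf cg fg.
  pose d := (g p - f p) / 2.
  have d0 : 0 < d by rewrite divr_gt0// subr_gt0.
  have di : locint (fun q => g q - f q).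
    split; first by apply: measurable_funB; [exact: gi.1|exact: fi.1].
    move=> r; have := L1B (gi.2 r) (fi.2 r).
    by apply: eq_integrable => // q _ /=; rewrite mulrBr.
  have cd : {for p, continuous (fun q => g q - f q)} by exact: cvgB.
  have [] := @locint_positive (fun q => g q - f q) p d di d0.
    have : d < g p - f p by rewrite /d; lra.
    move=> dl; near=> q; apply: ltW; near: q.
    exact: (cvgr_gt (g p - f p) cd).
  move=> r [phi [tphi]]; rewrite (_ : Rintegral _ _ _ = 0) ?ltxx//.
  rewrite (_ : Rintegral _ _ _ = \int[mu2]_q (g q * phi q - f q * phi q))%R; last first.
    by apply: eq_Rint => q; rewrite mulrBl.
  rewrite (RintB (locint_test gi tphi) (locint_test fi tphi)).
  by rewrite -(represents_test tphi gT) -(represents_test tphi fT) subrr.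
apply/eqP; rewrite eq_le; apply/andP; split; rewrite leNgt; apply/negP.
- exact: main.
- exact: main.
Unshelve. all: by end_near. Qed.

End bounded_distributions.

(** * The powers of the reciprocal of zeta = k x^2 - i y *)

Section zeta.
Context {R : realType}.
Notation mR := (measurableTypeR R).
Implicit Types (p : R * R) (k x y : R).

(** The real part of zeta = k x^2 - i y. *)
Definition zre k p : R := k * p.1 ^+ 2.
(** The squared modulus of zeta. *)
Definition znorm k p : R := zre k p ^+ 2 + p.2 ^+ 2.
(** The real part of 1/zeta. *)
Definition re1 k p : R := zre k p / znorm k p.
(** The imaginary part of 1/zeta. *)
Definition im1 k p : R := p.2 / znorm k p.
(** The real part of 1/zeta^2. *)
Definition re2 k p : R := (zre k p ^+ 2 - p.2 ^+ 2) / znorm k p ^+ 2.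
(** The imaginary part of 1/zeta^2.  At the origin all four quantities are 0, by
the convention on division. *)
Definition im2 k p : R := 2 * zre k p * p.2 / znorm k p ^+ 2.

Lemma znorm_ge0 k p : 0 <= znorm k p.
Proof. by rewrite addr_ge0 ?sqr_ge0. Qed.

Lemma znorm_neq0 k p b : k != 0 -> coord b p != 0 -> znorm k p != 0.
Proof.
move=> k0 c0; rewrite /znorm paddr_eq0 ?sqr_ge0// !expf_eq0/= negb_and.
case: b c0 => /= [->|p0]; first by rewrite orbT.
by rewrite /zre mulf_neq0// expf_neq0.
Qed.

Section at_point.
Variables (k : R) (p : R * R).
Hypothesis n0 : znorm k p != 0.

Let dzre b : is_derive p (dir b) (zre k) (if b then 0 else 2 * k * p.1).
Proof.
have dx := is_derive_coord b false p.
have := is_derive_mul (is_derive_cst k p (dir b)) (is_derive_mul dx dx).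
rewrite [X in is_derive _ _ X _](_ : _ = zre k); last first.
  by apply/funext => q; rewrite /zre expr2.
by move/is_derive_eq; apply; rewrite /cst; case: b {dx} => /=; ring.
Qed.

Let dsnd b : is_derive p (dir b) (fun q : R * R => q.2) (if b then 1 else 0).
Proof. by have := is_derive_coord b true p; case: b. Qed.

Let dznorm b : is_derive p (dir b) (znorm k)
  (if b then 2 * p.2 else 4 * k * p.1 * zre k p).
Proof.
have := is_derive_add (is_derive_mul (dzre b) (dzre b)) (is_derive_mul (dsnd b) (dsnd b)).
rewrite [X in is_derive _ _ X _](_ : _ = znorm k); last first.
  by apply/funext => q; rewrite /znorm !expr2.
by move/is_derive_eq; apply; case: b => /=; ring.
Qed.

(** With [is_derive_im1], these are the real and imaginary parts of
d(1/zeta)/dx = - 2 k x / zeta^2 and d(1/zeta)/dy = i / zeta^2. *)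
Lemma is_derive_re1 b : is_derive p (dir b) (re1 k)
  (if b then - im2 k p else - (2 * k * p.1) * re2 k p).
Proof.
apply: is_derive_eq (is_derive_mul (dzre b) (is_derive_comp1 (is_derive_inv n0) (dznorm b))) _.
by rewrite /im2 /re2 /zre; move: n0; rewrite /znorm /zre => n0'; case: b; field.
Qed.

Lemma is_derive_im1 b : is_derive p (dir b) (im1 k)
  (if b then re2 k p else - (2 * k * p.1) * im2 k p).
Proof.
apply: is_derive_eq (is_derive_mul (dsnd b) (is_derive_comp1 (is_derive_inv n0) (dznorm b))) _.
by rewrite /im2 /re2 /zre; move: n0; rewrite /znorm /zre => n0'; case: b; field.
Qed.

Let czre : {for p, continuous (zre k)}.
Proof.
apply: cvgM; first exact: cvg_cst.
by rewrite expr2; under eq_fun do rewrite expr2; apply: cvgM; exact: cvg_fst.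
Qed.

Let csnd : {for p, continuous (fun q : R * R => q.2 : R)}.
Proof. exact: cvg_snd. Qed.

Let csqr (f : R * R -> R) : {for p, continuous f} -> {for p, continuous (fun q => f q ^+ 2)}.
Proof.
move=> cf; rewrite (_ : (fun _ => _) = fun q => f q * f q); first exact: cvgM.
by apply/funext => q; rewrite expr2.
Qed.

Let cznorm : {for p, continuous (znorm k)}.
Proof. by apply: cvgD; exact: csqr. Qed.

Lemma continuous_re1 : {for p, continuous (re1 k)}.
Proof. by apply: cvgM; [exact: czre|exact: cvgV]. Qed.

Lemma continuous_im1 : {for p, continuous (im1 k)}.
Proof. by apply: cvgM; [exact: csnd|exact: cvgV]. Qed.

Lemma continuous_re2 : {for p, continuous (re2 k)}.
Proof.
apply: cvgM; first by apply: cvgB; exact: csqr.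
by apply: cvgV; [rewrite expf_neq0|exact: csqr].
Qed.

Lemma continuous_im2 : {for p, continuous (im2 k)}.
Proof.
apply: cvgM; first by apply: cvgM; [apply: cvgM; [exact: cvg_cst|exact: czre]|exact: csnd].
by apply: cvgV; [rewrite expf_neq0|exact: csqr].
Qed.

End at_point.

Lemma measurable_zre k : measurable_fun [set: mR * mR] (zre k).
Proof. by apply: measurable_funM => //; apply: measurable_funX; exact: measurable_fst. Qed.

Lemma measurable_znorm k : measurable_fun [set: mR * mR] (znorm k).
Proof.
apply: measurable_funD; apply: measurable_funX; last exact: measurable_snd.
exact: measurable_zre.
Qed.

Lemma measurable_re1 k : measurable_fun [set: mR * mR] (re1 k).
Proof.
apply: measurable_funM; first exact: measurable_zre.
by apply: measurable_fun_inv; exact: measurable_znorm.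
Qed.

Lemma measurable_im1 k : measurable_fun [set: mR * mR] (im1 k).
Proof.
apply: measurable_funM; first exact: measurable_snd.
by apply: measurable_fun_inv; exact: measurable_znorm.
Qed.

Lemma measurable_re2 k : measurable_fun [set: mR * mR] (re2 k).
Proof.
apply: measurable_funM.
  apply: measurable_funB; apply: measurable_funX; last exact: measurable_snd.
  exact: measurable_zre.
by apply: measurable_fun_inv; apply: measurable_funX; exact: measurable_znorm.
Qed.

Lemma measurable_im2 k : measurable_fun [set: mR * mR] (im2 k).
Proof.
apply: measurable_funM.
  apply: measurable_funM; last exact: measurable_snd.
  by apply: measurable_funM => //; exact: measurable_zre.
by apply: measurable_fun_inv; apply: measurable_funX; exact: measurable_znorm.
Qed.

Lemma sqr_re2_im2 k p : re2 k p ^+ 2 + im2 k p ^+ 2 = (znorm k p)^-1 ^+ 2.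
Proof.
have [n0|n0] := eqVneq (znorm k p) 0.
  by rewrite /re2 /im2 n0 expr0n/= invr0 !mulr0 expr0n/= addr0.
by rewrite /re2 /im2; move: n0; rewrite /znorm => n0; field.
Qed.

Lemma znorm_inv k p : (znorm k p)^-1 * znorm k p <= 1.
Proof.
by have [->|n0] := eqVneq (znorm k p) 0; rewrite ?mulr0 ?ler01// mulVf.
Qed.

Lemma sqr_re2_le k p : re2 k p ^+ 2 <= (znorm k p)^-1 ^+ 2.
Proof. by rewrite -sqr_re2_im2 lerDl sqr_ge0. Qed.

Lemma slice_continuous (f : R * R -> R) x y : {for (x, y), continuous f} ->
  {for x, continuous (fun t => f (t, y))} /\ {for y, continuous (fun t => f (x, t))}.
Proof.
move=> cf; split.
  apply: (continuous_comp (f := fun t => (t, y)) (g := f)) => //.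
  exact: (cvg_pair (cvg_id : id @ x --> x) (cvg_cst y)).
apply: (continuous_comp (f := fun t => (x, t)) (g := f)) => //.
exact: (cvg_pair (cvg_cst x) (cvg_id : id @ y --> y)).
Qed.

End zeta.

(** * No gain of derivatives: the function x^2 Im(1/zeta) *)

Section sharpness.
Context {R : realType}.
Notation mR := (measurableTypeR R).
Notation mu := (@lebesgue_measure R).
Notation mu2 := (mu \x mu)%E.
Implicit Types (f g h w : R * R -> R) (p : R * R) (c r M K x y s t : R).

(** x^2 Im(1/zeta) = x^2 y / (x^4 + y^2): homogeneous of degree 0 for the
dilations (e x, e^2 y), hence bounded but discontinuous. *)
Definition saddle p : R := zre 1 p * im1 1 p.
(** From dx (x^2 Im(1/zeta)) = 2 x (Im(1/zeta) - x^2 Im(1/zeta^2))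
= - 2 x y Re(1/zeta^2). *)
Definition saddle_x p : R := - (2 * p.1 * p.2) * re2 1 p.
Definition saddle_y p : R := zre 1 p * re2 1 p.

Lemma is_derive_saddle b p : znorm 1 p != 0 ->
  is_derive p (dir b) saddle (if b then saddle_y p else saddle_x p).
Proof.
move=> n0; have dx := is_derive_coord b false p.
have := is_derive_mul (is_derive_mul dx dx) (is_derive_im1 n0 b).
rewrite [X in is_derive _ _ X _](_ : _ = saddle); last first.
  by apply/funext => q; rewrite /saddle /zre mul1r expr2.
move/is_derive_eq; apply; case: b {dx}; rewrite /saddle_x /saddle_y /= ?mul0r ?mulr0 ?add0r.
  by rewrite /zre; ring.
by rewrite /im1 /im2 /re2; move: n0; rewrite /znorm /zre mul1r => n0; field.
Qed.

Lemma saddle_le1 p : `|saddle p| <= 1.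
Proof.
apply: le_trans (znorm_inv 1 p); rewrite /saddle /im1 mulrA normrM normfV.
rewrite (ger0_norm (znorm_ge0 1 p)) [leRHS]mulrC ler_wpM2r ?invr_ge0 ?znorm_ge0//.
rewrite ler_norml /znorm; have := sqr_ge0 (zre 1 p + p.2); have := sqr_ge0 (zre 1 p - p.2).
by have := sqr_ge0 (zre 1 p); have := sqr_ge0 p.2; move=> *; apply/andP; split; nra.
Qed.

Lemma measurable_saddle : measurable_fun [set: mR * mR] saddle.
Proof. by apply: measurable_funM; [exact: measurable_zre|exact: measurable_im1]. Qed.

Lemma measurable_saddle_x : measurable_fun [set: mR * mR] saddle_x.
Proof.
apply: measurable_funM; last exact: measurable_re2.
apply: measurableT_comp => //; apply: measurable_funM; last exact: measurable_snd.
by apply: measurable_funM => //; exact: measurable_fst.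
Qed.

Lemma measurable_xsaddle_y : measurable_fun [set: mR * mR] (fun p => p.1 * saddle_y p).
Proof.
apply: measurable_funM; first exact: measurable_fst.
by apply: measurable_funM; [exact: measurable_zre|exact: measurable_re2].
Qed.

(** |1/zeta^2| = 1/|zeta|^2, so that a factor of size at most |zeta| leaves a
square of size at most 1/|zeta|^2. *)
Lemma sqr_re2_bound k p a : a ^+ 2 <= znorm k p -> (a * re2 k p) ^+ 2 <= (znorm k p)^-1.
Proof.
move=> aN; set i := (znorm k p)^-1; have i0 : 0 <= i by rewrite invr_ge0 znorm_ge0.
rewrite exprMn; apply: (@le_trans _ _ (znorm k p * i ^+ 2)).
  by apply: ler_pM; rewrite ?sqr_ge0// sqr_re2_le.
by rewrite expr2 mulrA ler_piMl// mulrC znorm_inv.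
Qed.

Lemma saddle_x_bound p : saddle_x p ^+ 2 <= 4 * poisson (zre 1 (p.1, 0)) p.2.
Proof.
rewrite (_ : saddle_x p = - (2 * p.1) * (p.2 * re2 1 p)); last by rewrite /saddle_x; ring.
rewrite exprMn (_ : 4 * _ = (- (2 * p.1)) ^+ 2 * (znorm 1 p)^-1); last first.
  by rewrite /poisson /znorm /zre /= ; ring.
by rewrite ler_wpM2l ?sqr_ge0// sqr_re2_bound// /znorm lerDr sqr_ge0.
Qed.

Lemma xsaddle_y_bound p : (p.1 * saddle_y p) ^+ 2 <= 4 * poisson (zre 1 (p.1, 0)) p.2.
Proof.
apply: (@le_trans _ _ (poisson (zre 1 (p.1, 0)) p.2)); last first.
  by rewrite ler_peMl ?ler1n// poisson_ge0// /zre mul1r sqr_ge0.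
rewrite exprMn (_ : poisson _ _ = p.1 ^+ 2 * (znorm 1 p)^-1); last first.
  by rewrite /poisson /znorm /zre /=; ring.
by rewrite ler_wpM2l ?sqr_ge0// sqr_re2_bound// /znorm lerDl sqr_ge0.
Qed.

Lemma measurable_zre_slice (k : R) : measurable_fun [set: mR] (fun x => zre k (x, 0)).
Proof. exact: (measurable_slice1 0 (measurable_zre k)). Qed.

(** |g| <= 1 + g^2. *)
Lemma sqr_poisson_moderate g B (c : R -> R) : measurable_fun [set: mR * mR] g ->
  measurable_fun [set: mR] c -> (forall x, 0 <= c x) ->
  (forall p, g p ^+ 2 <= B * poisson (c p.1) p.2) -> moderate g.
Proof.
move=> mg mc c0 gb; split => //; exists 1, B, c; split => // p.
apply: le_trans (lerD (lexx 1) (gb p)); rewrite -(ger0_norm (sqr_ge0 (g p))) normrX.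
by have := normr_ge0 (g p); nra.
Qed.

Let zre0 x : 0 <= zre 1 (x, 0) :> R.
Proof. by rewrite /zre mul1r sqr_ge0. Qed.

Definition saddle_distribution : tempered R := tbounded measurable_saddle saddle_le1.

Lemma saddle_x_L2loc : L2loc_fun saddle_x.
Proof.
by apply: (poisson_L2loc measurable_saddle_x (measurable_zre_slice 1) zre0 _ saddle_x_bound).
Qed.

Lemma xsaddle_y_L2loc : L2loc_fun (fun p => p.1 * saddle_y p).
Proof.
by apply: (poisson_L2loc measurable_xsaddle_y (measurable_zre_slice 1) zre0 _ xsaddle_y_bound).
Qed.

Lemma saddle_dx phi :
  tderive false saddle_distribution phi = (\int[mu2]_p (saddle_x p * phi p))%R.
Proof.
apply: tbounded_dx => [p p2|y y0|].
- exact: (is_derive_saddle false (znorm_neq0 (b := true) (oner_neq0 _) p2)).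
- move=> x; have n0 : znorm 1 (x, y) != 0 by exact: (znorm_neq0 (b := true) (oner_neq0 _)).
  have [+ _] := slice_continuous (continuous_re2 n0).
  move=> cr; apply: cvgM; last exact: cr.
  apply: cvgN; apply: cvgM; last exact: cvg_cst.
  by apply: cvgM; [exact: cvg_cst|exact: cvg_id].
- exact: (sqr_poisson_moderate measurable_saddle_x (measurable_zre_slice 1) zre0 saddle_x_bound).
Qed.

Lemma saddle_xdy phi :
  txmul (tderive true saddle_distribution) phi =
  (\int[mu2]_p (p.1 * saddle_y p * phi p))%R.
Proof.
apply: tbounded_xdy => [p p1|x x0|].
- exact: (is_derive_saddle true (znorm_neq0 (b := false) (oner_neq0 _) p1)).
- move=> y; have n0 : znorm 1 (x, y) != 0 by exact: (znorm_neq0 (b := false) (oner_neq0 _)).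
  have [_ cr] := slice_continuous (continuous_re2 n0).
  by apply: cvgM; [exact: (cvg_cst (zre 1 (x, 0)))|exact: cr].
- exact: (sqr_poisson_moderate measurable_xsaddle_y (measurable_zre_slice 1) zre0 xsaddle_y_bound).
Qed.

Lemma L2loc_opA_saddle (l : 'cV[R]_2) : L2loc (opA (polarized l saddle_distribution)).
Proof.
have fi := L2loc_locint saddle_x_L2loc; have gi := L2loc_locint xsaddle_y_L2loc.
have fT : represents saddle_x (tderive false saddle_distribution).
  by move=> phi _; exact: saddle_dx.
have gT : represents (fun p => p.1 * saddle_y p) (txmul (tderive true saddle_distribution)).
  by move=> phi _; exact: saddle_xdy.
pose comb (a b : R) p := a * saddle_x p + b * (p.1 * saddle_y p).
have comb2 a b : L2loc_fun (comb a b).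
  by apply: L2locD; apply: L2locZ; [exact: saddle_x_L2loc|exact: xsaddle_y_L2loc].
have combT a b : represents (comb a b)
    (a *: tderive false saddle_distribution + b *: txmul (tderive true saddle_distribution)).
  have fa := L2loc_locint (L2locZ a saddle_x_L2loc).
  have gb := L2loc_locint (L2locZ b xsaddle_y_L2loc).
  exact: (representsD fa gb (representsZ a fi fT) (representsZ b gi gT)).
move=> i; have [->|i1] := eqVneq i 0.
  exists (comb (l 0 0) (l 1 0)) => //.
  rewrite (_ : opA _ _ _ = l 0 0 *: tderive false saddle_distribution
    + l 1 0 *: txmul (tderive true saddle_distribution)); first exact: combT.
  apply/val_inj/funext => phi; rewrite !mxE /=.
  transitivity (- (l 0 0 * saddle_distribution (sderive false phi)) +
    - (l 1 0 * saddle_distribution (sderive true (sxmul phi)))); first by [].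
  transitivity (l 0 0 * - saddle_distribution (sderive false phi) +
    l 1 0 * - saddle_distribution (sderive true (sxmul phi))); last by [].
  by rewrite !mulrN.
exists (comb (l 1 0) (- l 0 0)) => //.
rewrite (_ : opA _ _ _ = l 1 0 *: tderive false saddle_distribution
    + - l 0 0 *: txmul (tderive true saddle_distribution)); first exact: combT.
apply/val_inj/funext => phi; rewrite !mxE /= (negbTE i1).
transitivity (- - (l 0 0 * saddle_distribution (sderive true (sxmul phi))) +
    - (l 1 0 * saddle_distribution (sderive false phi))); first by [].
transitivity (l 1 0 * - saddle_distribution (sderive false phi) +
    - l 0 0 * - saddle_distribution (sderive true (sxmul phi))); last by [].
by rewrite !mulrN mulNr addrC.
Qed.

End sharpness.

Section not_H1.
Context {R : realType}.
Notation mR := (measurableTypeR R).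
Notation mu := (@lebesgue_measure R).
Notation mu2 := (mu \x mu)%E.
Implicit Types (f g h w : R * R -> R) (p : R * R) (c r M K x y s t : R).

(** On this box y^2 <= x^4 / 4, so x saddle_y is comparable to 1/x, that is to
its value on the x axis. *)
Lemma xsaddle_y_ge (e : R) p : 0 < e -> e < p.1 < 2 * e ->
  - (e ^+ 2 / 2) < p.2 < e ^+ 2 / 2 -> (5 * e)^-1 <= p.1 * saddle_y p.
Proof.
case: p => x y /= e0 /andP[ex xe] /andP[ya yb].
have x0 : 0 < x by lra.
rewrite /saddle_y /re2 /znorm /zre /= !mul1r.
have y2 : y ^+ 2 <= (x ^+ 2) ^+ 2 / 4.
  have : e ^+ 2 <= x ^+ 2 by rewrite ler_sqr ?nnegrE; lra.
  by set s := e ^+ 2 in ya yb *; set t := x ^+ 2 => ?; nra.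
have X0 : 0 < x ^+ 2 by rewrite exprn_gt0.
set X := x ^+ 2 in y2 X0 *; set Y := y ^+ 2 in y2 *.
have Y0 : 0 <= Y by rewrite sqr_ge0.
have X20 : 0 < X ^+ 2 by rewrite exprn_gt0.
have n0 : 0 < X ^+ 2 + Y by lra.
rewrite -[leLHS]mul1r ler_pdivrMr ?mulr_gt0//.
rewrite (_ : x * (X * ((X ^+ 2 - Y) / (X ^+ 2 + Y) ^+ 2)) * (5 * e)
  = (5 * e * x * X * (X ^+ 2 - Y)) / (X ^+ 2 + Y) ^+ 2); last first.
  by field; rewrite gt_eqF.
rewrite ler_pdivlMr ?exprn_gt0// mul1r.
apply: (@le_trans _ _ (5 / 2 * X ^+ 2 * (X ^+ 2 - Y))).
  by set Z := X ^+ 2 in y2 X20 *; nra.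
apply: ler_wpM2r; first by lra.
rewrite (_ : 5 / 2 * X ^+ 2 = 5 / 2 * x * x * X); last by rewrite /X; ring.
by apply: ler_wpM2r; [exact: ltW|nra].
Qed.

(** The inequality between arithmetic and geometric means, with weights chosen
for the final step of [saddle_not_H1loc]: the constant 1/(10 e) is half of the
lower bound of [xsaddle_y_ge]. *)
Lemma AMGM (e a b : R) : 0 < e -> 0 <= b -> b <= 2 * e ->
  a * b <= (10 * e)^-1 + 10 * e ^+ 3 * a ^+ 2.
Proof.
move=> e0 b0 be.
have i0 : 0 < (10 * e)^-1 by rewrite invr_gt0 mulr_gt0.
have E : (10 * e)^-1 * (10 * e) = 1 by rewrite mulVf// gt_eqF// mulr_gt0.
set i := (10 * e)^-1 in i0 E *.
have : 0 <= i * (1 - a * (10 * e ^+ 2)) ^+ 2 by rewrite mulr_ge0 ?sqr_ge0// ltW.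
rewrite (_ : i * _ = i - 2 * (i * (10 * e)) * e * a + (i * (10 * e)) * 10 * e ^+ 3 * a ^+ 2); last by ring.
rewrite E => h.
have [a0|a0] := leP 0 a.
  by apply: (@le_trans _ _ (a * (2 * e))); [exact: ler_wpM2l|lra].
have Q0 : 0 <= 10 * e ^+ 3 * a ^+ 2.
  by apply: mulr_ge0; [apply: mulr_ge0 => //; apply: exprn_ge0; exact: ltW|exact: sqr_ge0].
by apply: (@le_trans _ _ 0); [rewrite mulr_le0_ge0// ltW|lra].
Qed.

(** Suppose g in L2loc represents dv/dy, and test x g = x dv/dy on the box
e < x < 2 e, |y| < e^2 / 2, of area e^3.  The left side is at least area/(5 e).
By the arithmetic-geometric inequality it is at most area/(10 e) plus
10 e^3 times the integral of g^2.  Since area/e is e^2, this fails for small e. *)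
Theorem saddle_not_H1loc (l : 'cV[R]_2) : unit_circle l ->
  ~ H1loc (polarized l saddle_distribution).
Proof.
move=> /unit_circle2 l1 [_ /(_ true) H].
have [i li] : exists i, l i 0 != 0.
  have [l0|l0] := eqVneq (l 0 0) 0; last by exists 0.
  exists 1; apply: contra_eq_neq l1 => ->.
  by rewrite l0 expr0n/= addr0 eq_sym oner_eq0.
have [g' g'2 g'T] := H i; rewrite !mxE in g'T.
have g2 := L2locZ (l i 0)^-1 g'2.
set g := (fun p => _) in g2.
have gi := L2loc_locint g2.
have gxT r (phi : R * R -> R) : is_test r phi ->
    (\int[mu2]_p (p.1 * saddle_y p * phi p) = \int[mu2]_p (g p * (p.1 * phi p)))%R.
  move=> tphi.
  have tx : is_test r (xmul phi).
    split; first by apply: smooth_xmul; exact: tphi.1.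
    by move=> p rp; rewrite /xmul tphi.2// mulr0.
  rewrite -(saddle_xdy (test_fun tphi)).
  have E := represents_test tx g'T.
  have i' := locint_test (L2loc_locint g'2) tx.
  apply: (mulfI li).
  rewrite -(RintZ _ (locint_test gi tx)).
  transitivity (\int[mu2]_p (g' p * xmul phi p))%R; last first.
    by apply: eq_Rint => p; rewrite /g /xmul; field.
  rewrite -E.
  transitivity (l i 0 * - saddle_distribution (sderive true (test_fun tx))).
    congr (_ * - saddle_distribution _); exact/val_inj.
  by rewrite mulrN.
have /L2loc_funP[_ /(_ 1) iG] := g2.
set G := (\int[mu2]_p (\1_(cball 1) p * g p ^+ 2))%R.
have G0 : 0 <= G.
  rewrite -(Rint0 mu2); apply: le_Rint => //.
  - by rewrite (_ : (fun=> 0) = fun p => 0 * (\1_(cball 1) p * g p ^+ 2)); [exact: L1Z|apply/funext => p; rewrite mul0r].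
  - by move=> p; rewrite mulr_ge0 ?sqr_ge0// indicE ler0n.
pose c0 : R := expR (- 8) ^+ 2 / 4.
have c00 : 0 < c0 by rewrite divr_gt0 ?exprn_gt0 ?expR_gt0.
have c01 : c0 <= 1.
  have E1 : expR (- 8) <= 1 :> R by rewrite -[leRHS](expR0 R) ler_expR; lra.
  have E0 : 0 <= expR (- 8) :> R by exact: expR_ge0.
  by rewrite /c0; nra.
(* Small enough for 100 e G < c0, and at most 1/2 to keep the box in the unit ball. *)
pose e := c0 / (100 * G + 2).
have d0 : 0 < 100 * G + 2 by lra.
have e0 : 0 < e by rewrite divr_gt0.
have eG : e * (100 * G + 2) = c0 by rewrite /e mulfVK ?gt_eqF.
have K0 : 0 <= 10 * e ^+ 3 by apply: mulr_ge0 => //; apply: exprn_ge0; exact: ltW.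
have e2 : e <= 1 / 2.
  rewrite /e ler_pdivrMr//; lra.
have e20 : 0 < e ^+ 2 by rewrite exprn_gt0.
have u1 : e < 2 * e by lra.
have u2 : - (e ^+ 2 / 2) < e ^+ 2 / 2 by lra.
pose psi := bump2 e (2 * e) (- (e ^+ 2 / 2)) (e ^+ 2 / 2).
have [r tpsi] : exists r, is_test r psi := is_test_bump2 u1 u2.
have ipsi := test_L1 tpsi.
set I := (\int[mu2]_p psi p)%R.
have tx : is_test r (xmul psi).
  split; first by apply: smooth_xmul; exact: tpsi.1.
  by move=> p rp; rewrite /xmul tpsi.2// mulr0.
have I1 : c0 * e ^+ 3 <= I.
  apply: le_trans (Rint_bump2_ge u1 u2); rewrite /c0.
  by rewrite le_eqVlt; apply/orP; left; apply/eqP; field.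
have low : (5 * e)^-1 * I <= (\int[mu2]_p (p.1 * saddle_y p * psi p))%R.
  rewrite -(RintZ _ ipsi); apply: le_Rint.
  - exact: L1Z.
  - exact: (locint_test (L2loc_locint xsaddle_y_L2loc) tpsi).
  move=> p; have [psi0|/andP[h1 h2]] := bump2_support p u1 u2; first by rewrite /psi psi0 !mulr0.
  by rewrite ler_wpM2r ?bump2_ge0// xsaddle_y_ge.
have up : (\int[mu2]_p (g p * (p.1 * psi p)) <= (10 * e)^-1 * I + 10 * e ^+ 3 * G)%R.
  rewrite -(RintZ _ ipsi) -(RintZ _ iG) -(RintD (L1Z _ ipsi) (L1Z _ iG)).
  apply: le_Rint.
  - exact: (locint_test gi tx).
  - by apply: L1D; exact: L1Z.
  move=> p; have [psi0|/andP[/andP[h1 h1'] /andP[h2 h2']]] := bump2_support p u1 u2.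
    rewrite /psi psi0 !mulr0 add0r; apply: mulr_ge0; first exact: K0.
    by rewrite mulr_ge0 ?sqr_ge0// indicE ler0n.
  rewrite cball_indicE ifT; last first.
    clear -e0 e2 h1 h1' h2 h2'.
    by rewrite norm_pair_le !ler_norml; apply/andP; split; apply/andP; split; nra.
  have b0 : 0 <= psi p by exact: bump2_ge0.
  have b1 : psi p <= 1 by exact: bump2_le1.
  have p0 : 0 <= p.1 by rewrite ltW// (lt_trans e0).
  rewrite mulrA; apply: (@le_trans _ _ (((10 * e)^-1 + 10 * e ^+ 3 * g p ^+ 2) * psi p)).
    by rewrite ler_wpM2r// AMGM// ltW.
  rewrite mulrDl lerD// mul1r ler_piMr//.
  by apply: mulr_ge0; [exact: K0|exact: sqr_ge0].
have := gxT r psi tpsi => E; rewrite E in low.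
have {low up} := le_trans low up.
rewrite (_ : (5 * e)^-1 = 2 * (10 * e)^-1); last by field; rewrite gt_eqF.
move=> h.
have {}h : (10 * e)^-1 * I <= 10 * e ^+ 3 * G by lra.
have i10 : 0 < (10 * e)^-1 by rewrite invr_gt0; apply: mulr_gt0.
have {}h : I <= 100 * e ^+ 4 * G.
  rewrite -(ler_pM2l i10); apply: le_trans h _.
  by rewrite le_eqVlt; apply/orP; left; apply/eqP; field; rewrite gt_eqF.
have : c0 * e ^+ 3 <= (100 * e * G) * e ^+ 3.
  by rewrite (_ : 100 * e * G * _ = 100 * e ^+ 4 * G); [exact: le_trans I1 h|ring].
rewrite ler_pM2r ?exprn_gt0// => {I1 u2 e20 e2 i10 tx tpsi} h'.
by rewrite -eG in h'; nra.
Qed.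

End not_H1.

(** * A singular solution: exp(-1/zeta) *)

Section singular_solution.
Context {R : realType}.
Notation mR := (measurableTypeR R).
Notation mu := (@lebesgue_measure R).
Notation mu2 := (mu \x mu)%E.
Implicit Types (f g h w : R * R -> R) (p : R * R) (c r M x y s t : R).

Notation k := (2^-1 : R).

(** The modulus of exp(-1/zeta) for zeta = x^2/2 - i y. *)
Definition flat_exp p : R := expR (- re1 k p).
(** The real part of exp(-1/zeta). *)
Definition sol1 p : R := flat_exp p * cos (im1 k p).
(** The imaginary part of exp(-1/zeta). *)
Definition sol2 p : R := - (flat_exp p * sin (im1 k p)).
Definition sol1_y p : R := flat_exp p * (im2 k p * cos (im1 k p) - re2 k p * sin (im1 k p)).
Definition sol2_y p : R := - (flat_exp p * (im2 k p * sin (im1 k p) + re2 k p * cos (im1 k p))).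

Lemma is_derive_flat_exp b p : znorm k p != 0 ->
  is_derive p (dir b) flat_exp (flat_exp p * (if b then im2 k p else p.1 * re2 k p)).
Proof.
move=> n0; apply: is_derive_eq (is_derive_comp1 (is_derive_expR _) (is_derive_neg (is_derive_re1 n0 b))) _.
by rewrite /flat_exp; case: b; [rewrite opprK|congr (_ * _); field].
Qed.

(** With [is_derive_sol2], the equation dU/dx = i x dU/dy of functions of
zeta = x^2/2 - i y. *)
Lemma is_derive_sol1 b p : znorm k p != 0 ->
  is_derive p (dir b) sol1 (if b then sol1_y p else - (p.1 * sol2_y p)).
Proof.
move=> n0.
apply: is_derive_eq (is_derive_mul (is_derive_flat_exp b n0)
  (is_derive_comp1 (is_derive_cos _) (is_derive_im1 n0 b))) _.
by rewrite /sol1_y /sol2_y; case: b; field.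
Qed.

Lemma is_derive_sol2 b p : znorm k p != 0 ->
  is_derive p (dir b) sol2 (if b then sol2_y p else p.1 * sol1_y p).
Proof.
move=> n0.
apply: is_derive_eq (is_derive_neg (is_derive_mul (is_derive_flat_exp b n0)
  (is_derive_comp1 (is_derive_sin _) (is_derive_im1 n0 b)))) _.
by rewrite /sol1_y /sol2_y; case: b; field.
Qed.

Lemma re1_ge0 p : 0 <= re1 k p.
Proof. by rewrite /re1 divr_ge0 ?znorm_ge0// /zre mulr_ge0 ?sqr_ge0// invr_ge0. Qed.

Lemma flat_exp_ge0 p : 0 <= flat_exp p.
Proof. exact: expR_ge0. Qed.

Lemma flat_exp_le p : flat_exp p * (1 + re1 k p) <= 1.
Proof.
rewrite /flat_exp expRN mulrC ler_pdivrMr ?expR_gt0// mul1r.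
exact: expR_ge1Dx.
Qed.

Lemma flat_exp_le1 p : flat_exp p <= 1.
Proof. by have := flat_exp_le p; have := re1_ge0 p; have := flat_exp_ge0 p; nra. Qed.

Lemma sol1_le1 p : `|sol1 p| <= 1.
Proof.
rewrite normrM ger0_norm ?flat_exp_ge0// mulr_ile1 ?flat_exp_ge0 ?flat_exp_le1//.
by rewrite ler_norml cos_le1 cos_geN1.
Qed.

Lemma sol2_le1 p : `|sol2 p| <= 1.
Proof.
rewrite normrN normrM ger0_norm ?flat_exp_ge0// mulr_ile1 ?flat_exp_ge0 ?flat_exp_le1//.
by rewrite ler_norml sin_le1 sin_geN1.
Qed.

Lemma measurable_flat_exp : measurable_fun [set: mR * mR] flat_exp.
Proof.
apply: measurableT_comp => //; apply: measurableT_comp => //; exact: measurable_re1.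
Qed.

Lemma measurable_cos_im1 : measurable_fun [set: mR * mR] (fun p => cos (im1 k p)).
Proof.
apply: (measurableT_comp (f := cos : mR -> mR)); last exact: measurable_im1.
by apply: continuous_measurable_fun; exact: continuous_cos.
Qed.

Lemma measurable_sin_im1 : measurable_fun [set: mR * mR] (fun p => sin (im1 k p)).
Proof.
apply: (measurableT_comp (f := sin : mR -> mR)); last exact: measurable_im1.
by apply: continuous_measurable_fun; exact: continuous_sin.
Qed.

Lemma measurable_sol1 : measurable_fun [set: mR * mR] sol1.
Proof. by apply: measurable_funM; [exact: measurable_flat_exp|exact: measurable_cos_im1]. Qed.

Lemma measurable_sol2 : measurable_fun [set: mR * mR] sol2.
Proof.
apply: measurableT_comp => //.
by apply: measurable_funM; [exact: measurable_flat_exp|exact: measurable_sin_im1].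
Qed.

Lemma measurable_sol1_y : measurable_fun [set: mR * mR] sol1_y.
Proof.
apply: measurable_funM; first exact: measurable_flat_exp.
apply: measurable_funB.
  by apply: measurable_funM; [exact: measurable_im2|exact: measurable_cos_im1].
by apply: measurable_funM; [exact: measurable_re2|exact: measurable_sin_im1].
Qed.

Lemma measurable_sol2_y : measurable_fun [set: mR * mR] sol2_y.
Proof.
apply: measurableT_comp => //.
apply: measurable_funM; first exact: measurable_flat_exp.
apply: measurable_funD.
  by apply: measurable_funM; [exact: measurable_im2|exact: measurable_sin_im1].
by apply: measurable_funM; [exact: measurable_re2|exact: measurable_cos_im1].
Qed.

(** |dU/dy| = |U| / |zeta|^2. *)
Lemma sqr_sol_y p : sol1_y p ^+ 2 + sol2_y p ^+ 2 = (flat_exp p * (znorm k p)^-1) ^+ 2.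
Proof.
rewrite [RHS]exprMn -sqr_re2_im2 -[RHS]mulr1 -[X in _ = _ * X](cos2Dsin2 (im1 k p)) /sol1_y /sol2_y.
ring.
Qed.

(** x / |zeta|^2 is not integrable near the origin.  Since
exp(- Re(1/zeta)) <= 1/(1 + Re(1/zeta)), the exponential replaces |zeta|^2 by
|zeta|^2 + Re zeta, which is at least a multiple of x^2 + y^2. *)
Lemma flat_exp_znorm_bound p :
  `|p.1| * (flat_exp p * (znorm k p)^-1) <= 2 * poisson (`|p.1| / 2) p.2.
Proof.
have P0 : 0 <= poisson (`|p.1| / 2) p.2 by rewrite poisson_ge0// divr_ge0.
have [n0|n0] := eqVneq (znorm k p) 0; first by rewrite n0 invr0 !mulr0 mulr_ge0.
have {}n0 : 0 < znorm k p by rewrite lt_def n0 znorm_ge0.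
have d0 : 0 < (`|p.1| / 2) ^+ 2 + p.2 ^+ 2.
  rewrite lt_def addr_ge0 ?sqr_ge0// andbT paddr_eq0 ?sqr_ge0// !expf_eq0/=.
  apply/negP => /andP[p1 /eqP p2]; move: n0; rewrite /znorm /zre p2.
  move: p1; rewrite mulf_eq0 normr_eq0 invr_eq0 pnatr_eq0 orbF => /eqP ->.
  by rewrite expr0n/= mulr0 expr0n/= addr0 ltxx.
rewrite /poisson (_ : 2 * _ = `|p.1| * ((`|p.1| / 2) ^+ 2 + p.2 ^+ 2)^-1); last first.
  by rewrite mulrA; congr (_ * _); field.
apply: ler_wpM2l => //.
rewrite ler_pdivrMr// ler_pdivlMl// mulrC.
have := flat_exp_le p; rewrite /re1 -(ler_pM2r n0) mul1r -mulrA mulrDl mul1r divfK ?gt_eqF//.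
apply: le_trans; apply: ler_wpM2l; first exact: flat_exp_ge0.
rewrite /znorm /zre exprMn -normrX ger0_norm ?sqr_ge0//.
set X := p.1 ^+ 2; have X0 : 0 <= X by rewrite sqr_ge0.
by have := sqr_ge0 (2^-1 * X); lra.
Qed.

Lemma moderate_sol g : measurable_fun [set: mR * mR] g ->
  (forall p, g p ^+ 2 <= (flat_exp p * (znorm k p)^-1) ^+ 2) ->
  moderate (fun p => p.1 * g p).
Proof.
move=> mg gb; split.
  by apply: measurable_funM; [exact: measurable_fst|exact: mg].
exists 0, 2, (fun x => `|x| / 2); split => [|x|p].
- by apply: measurable_funM => //; exact: measurableT_comp.
- by rewrite divr_ge0.
rewrite add0r; apply: le_trans (flat_exp_znorm_bound p).
rewrite normrM; apply: ler_wpM2l => //.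
rewrite -ler_sqr ?nnegrE ?mulr_ge0 ?flat_exp_ge0 ?invr_ge0 ?znorm_ge0//.
by rewrite -normrX ger0_norm ?sqr_ge0.
Qed.

Lemma moderate_sol1_y : moderate (fun p => p.1 * sol1_y p).
Proof.
apply: moderate_sol; first exact: measurable_sol1_y.
by move=> p; rewrite -sqr_sol_y lerDl sqr_ge0.
Qed.

Lemma moderate_sol2_y : moderate (fun p => p.1 * sol2_y p).
Proof.
apply: moderate_sol; first exact: measurable_sol2_y.
by move=> p; rewrite -sqr_sol_y lerDr sqr_ge0.
Qed.

Lemma moderateN g : moderate g -> moderate (fun p => - g p).
Proof.
move=> [mg [A [B [c [mc c0 gb]]]]]; split; first exact: measurableT_comp.
by exists A, B, c; split => // p; rewrite normrN.
Qed.

Section continuity.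
Variable p : R * R.
Hypothesis n0 : znorm k p != 0.

Let cexp : {for p, continuous flat_exp}.
Proof.
apply: (continuous_comp (f := fun q => - re1 k q) (g := expR)); last exact: continuous_expR.
by apply: cvgN; exact: continuous_re1.
Qed.

Let ccos : {for p, continuous (fun q => cos (im1 k q))}.
Proof.
apply: (continuous_comp (f := im1 k) (g := cos)); last exact: continuous_cos.
exact: continuous_im1.
Qed.

Let csin : {for p, continuous (fun q => sin (im1 k q))}.
Proof.
apply: (continuous_comp (f := im1 k) (g := sin)); last exact: continuous_sin.
exact: continuous_im1.
Qed.

Lemma continuous_sol1 : {for p, continuous sol1}.
Proof. exact: cvgM. Qed.

Lemma continuous_sol2 : {for p, continuous sol2}.
Proof. by apply: cvgN; exact: cvgM. Qed.

Lemma continuous_sol1_y : {for p, continuous sol1_y}.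
Proof.
apply: cvgM; first exact: cexp.
by apply: cvgB; apply: cvgM => //; [exact: continuous_im2|exact: continuous_re2].
Qed.

Lemma continuous_sol2_y : {for p, continuous sol2_y}.
Proof.
apply: cvgN; apply: cvgM; first exact: cexp.
by apply: cvgD; apply: cvgM => //; [exact: continuous_im2|exact: continuous_re2].
Qed.

End continuity.

Let k0 : k != 0. Proof. by []. Qed.

Let ny y : y != 0 -> forall x, znorm k (x, y) != 0.
Proof. by move=> y0 x; exact: (znorm_neq0 (b := true)). Qed.

Let nx x : x != 0 -> forall y, znorm k (x, y) != 0.
Proof. by move=> x0 y; exact: (znorm_neq0 (b := false)). Qed.

Definition sol1_distribution : tempered R := tbounded measurable_sol1 sol1_le1.
Definition sol2_distribution : tempered R := tbounded measurable_sol2 sol2_le1.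

Lemma sol1_dx phi : tderive false sol1_distribution phi =
  (\int[mu2]_p (- (p.1 * sol2_y p) * phi p))%R.
Proof.
apply: tbounded_dx => [p p2|y y0|].
- exact: (is_derive_sol1 false (znorm_neq0 (b := true) k0 p2)).
- move=> x; have [+ _] := slice_continuous (continuous_sol2_y (ny y0 x)).
  by move=> cr; apply: cvgN; apply: cvgM; [exact: cvg_id|exact: cr].
- exact: (moderateN moderate_sol2_y).
Qed.

Lemma sol2_dx phi : tderive false sol2_distribution phi =
  (\int[mu2]_p (p.1 * sol1_y p * phi p))%R.
Proof.
apply: tbounded_dx => [p p2|y y0|].
- exact: (is_derive_sol2 false (znorm_neq0 (b := true) k0 p2)).
- move=> x; have [+ _] := slice_continuous (continuous_sol1_y (ny y0 x)).
  by move=> cr; apply: cvgM; [exact: cvg_id|exact: cr].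
- exact: moderate_sol1_y.
Qed.

Lemma sol1_xdy phi : txmul (tderive true sol1_distribution) phi =
  (\int[mu2]_p (p.1 * sol1_y p * phi p))%R.
Proof.
apply: tbounded_xdy => [p p1|x x0|].
- exact: (is_derive_sol1 true (znorm_neq0 (b := false) k0 p1)).
- by move=> y; have [_ cr] := slice_continuous (continuous_sol1_y (nx x0 y)).
- exact: moderate_sol1_y.
Qed.

Lemma sol2_xdy phi : txmul (tderive true sol2_distribution) phi =
  (\int[mu2]_p (p.1 * sol2_y p * phi p))%R.
Proof.
apply: tbounded_xdy => [p p1|x x0|].
- exact: (is_derive_sol2 true (znorm_neq0 (b := false) k0 p1)).
- by move=> y; have [_ cr] := slice_continuous (continuous_sol2_y (nx x0 y)).
- exact: moderate_sol2_y.
Qed.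

Definition sol : 'cV[tempered R]_2 :=
  \col_i if i == 0 then sol1_distribution else sol2_distribution.

Lemma opA_sol : opA sol = 0.
Proof.
apply/colP => i; apply/val_inj/funext => phi; rewrite !mxE /=; case: ifP => _.
  transitivity (tderive false sol1_distribution phi + txmul (tderive true sol2_distribution) phi); first by [].
  rewrite sol1_dx sol2_xdy -(RintD (moderate_L1 _ (moderateN moderate_sol2_y)) (moderate_L1 _ moderate_sol2_y)).
  transitivity (\int[mu2]_p (0 : R))%R; last exact: Rint0.
  by apply: eq_Rint => p; rewrite mulNr addNr.
transitivity (- txmul (tderive true sol1_distribution) phi + tderive false sol2_distribution phi); first by [].
by rewrite sol1_xdy sol2_dx addNr.
Qed.

Lemma bounded_locint w M : measurable_fun [set: mR * mR] w -> (forall p, `|w p| <= M) ->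
  locint w.
Proof.
move=> mw wM; split => // r.
have := L1_bounded mw wM (L1_cball r).
by apply: eq_integrable => // p _ /=; rewrite mulrC.
Qed.

(** Smooth representatives agree with sol1 and sol2 off the origin, by continuity.
The sum of their squares is then |U|^2, equal to 1 on the y axis and tending to 0
along the x axis, so it is not continuous at the origin. *)
Lemma not_Cinfty_sol : ~ Cinfty sol.
Proof.
move=> S; have [h1 s1 r1] := S 0; have [h2 s2 r2] := S 1.
rewrite !mxE /= in r1 r2.
have T1 : represents sol1 sol1_distribution by [].
have T2 : represents sol2 sol2_distribution by [].
have E1 p : znorm k p != 0 -> h1 p = sol1 p.
  move=> n0; apply: (represents_unique_at (L2loc_locint (smooth_L2loc s1))
    (bounded_locint measurable_sol1 sol1_le1) r1 T1 (smooth_continuous s1 (x := p))).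
  exact: continuous_sol1.
have E2 p : znorm k p != 0 -> h2 p = sol2 p.
  move=> n0; apply: (represents_unique_at (L2loc_locint (smooth_L2loc s2))
    (bounded_locint measurable_sol2 sol2_le1) r2 T2 (smooth_continuous s2 (x := p))).
  exact: continuous_sol2.
pose F p := h1 p * h1 p + h2 p * h2 p.
have FE p : znorm k p != 0 -> F p = flat_exp p ^+ 2.
  move=> n0; rewrite /F E1// E2// /sol1 /sol2 -[RHS]mulr1 -[X in _ = _ * X](cos2Dsin2 (im1 k p)); ring.
have cF : {for (0 : R * R), continuous F}.
  by apply: cvgD; apply: cvgM; exact: smooth_continuous.
have /nbhs_ballP[e /= e0 he] : \forall q \near (0 : R * R), `|F 0 - F q| < 1 / 4.
  by move/cvgrPdist_lt: cF; apply; rewrite divr_gt0.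
pose t := Num.min (e / 2) 1.
have t0 : 0 < t by rewrite lt_min divr_gt0 ?ltr01.
have te : t < e by rewrite gt_min ltr_pdivrMr// mulr_natr mulr2n ltrDl e0.
have t1 : t <= 1 by rewrite ge_min lexx orbT.
have b1 : ball (0 : R * R) e (0, t).
  by split; rewrite /ball /= ?subr0 ?sub0r ?normrN ?normr0// gtr0_norm.
have b2 : ball (0 : R * R) e (t, 0).
  by split; rewrite /ball /= ?subr0 ?sub0r ?normrN ?normr0// gtr0_norm.
have := he _ b1; have := he _ b2.
rewrite (FE (t, 0) (nx (lt0r_neq0 t0) 0)) (FE (0, t) (ny (lt0r_neq0 t0) 0)).
have -> : flat_exp (0, t) = 1.
  by rewrite /flat_exp /re1 /zre /= expr0n/= mulr0 mul0r oppr0 expR0.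
have : flat_exp (t, 0) * 3 <= 1.
  apply: le_trans (flat_exp_le (t, 0)); apply: ler_wpM2l; first exact: flat_exp_ge0.
  have -> : re1 k (t, 0) = 2 * (t ^+ 2)^-1.
    by rewrite /re1 /znorm /zre /= expr0n/= addr0; field; rewrite gt_eqF.
  have : 1 <= (t ^+ 2)^-1 by rewrite invf_ge1 ?exprn_gt0// expr_le1// ltW.
  lra.
have := flat_exp_ge0 (t, 0); set E := flat_exp _ => E0 E3.
rewrite !ltr_norml => /andP[a1 a2] /andP[a3 a4].
nra.
Qed.

Lemma Cinfty0 n : Cinfty (0 : 'cV[tempered R]_n).
Proof.
move=> i; exists (cst 0); first exact: smooth_cst.
move=> phi _; rewrite mxE.
transitivity (\int[mu2]_p (0 : R))%R; first by rewrite Rint0.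
by apply: eq_Rint => p; rewrite /cst mul0r.
Qed.

(** Otherwise part (i), applied to A u = 0, would make the solution smooth. *)
Lemma not_constant_polarized_sol : ~ constant_polarized sol.
Proof.
move=> [l ul [v E]]; apply: not_Cinfty_sol; rewrite E.
have [|h sh hv] := @polarized_smooth R l v ul; last exact: Cinfty_polarized sh hv.
by rewrite -E opA_sol; exact: Cinfty0.
Qed.

End singular_solution.

Theorem theorem1p3 (R : realType) :
  ((forall u : 'cV[tempered R]_2, constant_polarized u ->
      (L2loc (opA u) -> L2loc u) /\ (Cinfty (opA u) -> Cinfty u)) /\
   (forall l : 'cV[R]_2, unit_circle l ->
      hypoelliptic (opAl l) /\
      exists v : tempered R,
        L2loc (opA (polarized l v)) /\ ~ H1loc (polarized l v))) /\
  ((exists u : 'cV[tempered R]_2,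
      opA u = 0%R /\ ~ constant_polarized u /\ ~ Cinfty u) /\
   ~ hypoelliptic (@opA R)).
Proof.
split; split.
- move=> _ [l ul [v ->]]; split => A.
    by have [h h2 hv] := polarized_L2loc ul A; exact: L2loc_polarized h2 hv.
  by have [h sh hv] := polarized_smooth ul A; exact: Cinfty_polarized sh hv.
- move=> l ul; split; first exact: hypoelliptic_opAl.
  exists saddle_distribution; split; first exact: L2loc_opA_saddle.
  exact: saddle_not_H1loc.
- exists sol; split; first exact: opA_sol.
  by split; [exact: not_constant_polarized_sol|exact: not_Cinfty_sol].
- by move=> hyp; apply/not_Cinfty_sol/hyp; rewrite opA_sol; exact: Cinfty0.
Qed.
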